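(* Let $r,p,\ell$ be integers with $p>r\ge 4$ and $2\le \ell\le p$, and let $F$ be a doubly edge-$p$-critical $2$-graph in class $\ell$. Then for all sufficiently large $n$ (i.e. $1/n\ll r,p$), $$\mathrm{ar}(n,r,F^{(r)})=t_p(n,r)+2.$$
   Context: An $r$-graph is identified with its edge set, a family of $r$-element subsets of a vertex set; $K_n^r=\binom{[n]}{r}$. For an edge-coloring of an $r$-graph, a subgraph is rainbow if no two of its edges have the same color. The anti-Ramsey number $\mathrm{ar}(n,r,H)$ is the minimum number $c$ such that every edge-coloring of $K_n^r$ using at least $c$ colors contains a rainbow subgraph isomorphic to $H$. For a $2$-graph $F$, the expansion $F^{(r)}$ is the $r$-graph on $|V(F)|+(r-2)|F|$ vertices obtained by adding to each edge of $F$ a set of $r-2$ new vertices (distinct new vertices for distinct edges). $\chi$ denotes the chromatic number. A $2$-graph $F$ is doubly edge-$p$-critical if $\chi(F-e)\ge p$ for every edge $e\in F$ and there exist two edges $e_1,e_2\in F$ with $\chi(F-e_1-e_2)=p-1$. For a partition $\mathcal P=V_1\cup\dots\cup V_{p-1}$ of $V(F)$ into $p-1$ parts, the index vector is $\mathbf a_F(\mathcal P)=(e(V_1),\dots,e(V_{p-1}))$, where $e(V_i)$ is the number of edges of $F$ inside $V_i$. Let $\mathbf{\mathcal P}(F)$ be the set of $(p-1)$-partitions $\mathcal P$ of $V(F)$ with $\|\mathbf a_F(\mathcal P)\|_\infty=1$. For $1\le \ell\le p-1$, $F$ is in class $\ell$ if $\min_{\mathcal P\in\mathbf{\mathcal P}(F)}\|\mathbf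 a_F(\mathcal P)\|_1=\ell$; if $\mathbf{\mathcal P}(F)=\emptyset$, $F$ is in class $p$. $T_p(n,r)$ is the $r$-graph on $[n]$ obtained by partitioning $[n]$ into $p-1$ parts whose sizes differ by at most one and taking all $r$-sets meeting each part in at most one vertex; $t_p(n,r)=|T_p(n,r)|$.
   Formalization: ''Sufficiently large n'' is taken with a threshold that may depend on F as well as on r and p; a threshold depending only on r, p is impossible, since for n below the number of vertices of F^(r) no copy exists (e.g. F = two disjoint K_p plus a long path). *)

(* Defs.v *)
From mathcomp Require Import all_boot.
From mathcomp Require Import boolp.

Set Implicit Arguments.
Unset Strict Implicit.
Unset Printing Implicit Defensive.

(* A hypergraph on a finite vertex type [T] is its edge set, a [{set {set T}}]. *)

Definition is_rgraph (r : nat) (T : finType) (H : {set {set T}}) : Prop :=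
  forall e, e \in H -> #|e| = r.

Definition complete_rgraph (n r : nat) : {set {set 'I_n}} :=
  [set e : {set 'I_n} | #|e| == r].

Definition has_rainbow_copy (n r : nat) (T : finType) (H : {set {set T}})
    (C : finType) (col : {set 'I_n} -> C) : Prop :=
  exists phi : T -> 'I_n,
    [/\ injective phi,
        forall e, e \in H -> phi @: e \in complete_rgraph n r &
        {in H &, injective (fun e : {set T} => col (phi @: e))}].

(* A coloring of the complete r-graph is given as a function on all subsets of
   [n]; its values off the r-subsets are never used. *)
Definition forces_rainbow (n r : nat) (T : finType) (H : {set {set T}})
    (c : nat) : Prop :=
  forall (C : finType) (col : {set 'I_n} -> C),
    c <= #|[set col e | e in complete_rgraph n r]| -> has_rainbow_copy r H col.

Lemma forces_rainbow_ex (n r : nat) (T : finType) (H : {set {set T}}) :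
  exists c, `[< forces_rainbow n r H c >].
Proof.
exists #|complete_rgraph n r|.+1; apply/asboolP => C col.
by rewrite ltnNge leq_imset_card.
Qed.

Definition ar (n r : nat) (T : finType) (H : {set {set T}}) : nat :=
  ex_minn (forces_rainbow_ex n r H).

Definition expansion_vertex (r : nat) (V : finType) (F : {set {set V}}) : finType :=
  (V + {e : {set V} | e \in F} * 'I_(r - 2))%type.

Definition expansion_edge (r : nat) (V : finType) (F : {set {set V}})
    (e : {e : {set V} | e \in F}) : {set expansion_vertex r F} :=
  [set inl v | v in val e] :|: [set inr (e, i) | i : 'I_(r - 2)].

Definition expansion (r : nat) (V : finType) (F : {set {set V}}) :
    {set {set expansion_vertex r F}} :=
  [set expansion_edge r e | e : {e : {set V} | e \in F}].

Definition colorable (V : finType) (F : {set {set V}}) (k : nat) : bool :=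
  [exists f : {ffun V -> 'I_k},
     [forall x, forall y, (x != y) && ([set x; y] \in F) ==> (f x != f y)]].

Lemma colorable_ex (V : finType) (F : {set {set V}}) : exists k, colorable F k.
Proof.
exists #|V|; apply/existsP; exists [ffun x => enum_rank x].
apply/forallP => x; apply/forallP => y; apply/implyP => /andP[xy _].
by rewrite !ffunE (inj_eq enum_rank_inj).
Qed.

Definition chromatic_number (V : finType) (F : {set {set V}}) : nat :=
  ex_minn (colorable_ex F).

Definition doubly_edge_critical (p : nat) (V : finType) (F : {set {set V}}) : Prop :=
  (forall e, e \in F -> p <= chromatic_number (F :\ e)) /\
  (exists e1 e2, [/\ e1 \in F, e2 \in F, e1 != e2 &
     chromatic_number (F :\ e1 :\ e2) = p.-1]).

(* A (p-1)-partition of V is the map sending a vertex to the index of its part;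
   parts may be empty. *)
Definition index_vector (p : nat) (V : finType) (F : {set {set V}})
    (P : {ffun V -> 'I_p.-1}) : {ffun 'I_p.-1 -> nat} :=
  [ffun i => #|[set e in F | e \subset P @^-1: [set i]]|].

Definition norm_infty (m : nat) (a : {ffun 'I_m -> nat}) : nat := \max_(i < m) a i.

Definition norm_one (m : nat) (a : {ffun 'I_m -> nat}) : nat := \sum_(i < m) a i.

Definition unit_partitions (p : nat) (V : finType) (F : {set {set V}}) :
    {set {ffun V -> 'I_p.-1}} :=
  [set P | norm_infty (index_vector F P) == 1].

Definition in_class (p l : nat) (V : finType) (F : {set {set V}}) : Prop :=
  if unit_partitions p F == set0 then l = p
  else [/\ 1 <= l <= p.-1,
           exists2 P, P \in unit_partitions p F & norm_one (index_vector F P) = l &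
           forall P, P \in unit_partitions p F -> l <= norm_one (index_vector F P)].

(* The parts are the residue classes modulo p-1, whose sizes in {0, ..., n-1}
   differ by at most one. *)
Definition turan_rgraph (p n r : nat) : {set {set 'I_n}} :=
  [set e in complete_rgraph n r |
     [forall i : 'I_p.-1, #|[set v in e | v %% p.-1 == i]| <= 1]].

(* Main.v *)
Require Import Defs.
From mathcomp Require Import all_boot all_order all_algebra perm.
From mathcomp Require Import zify ring lra.

(** Put [k = p - 1].  Lower bound: colour the edges of the Turan hypergraph
    injectively and all other [r]-sets with one further colour; a rainbow copy
    would give a proper [k]-colouring of some [F - e].

    Upper bound: let [H] contain one [r]-set of each colour, and call a pair
    heavy if its codegree in [H] exceeds a constant times [n^(r-3)].  Heavy
    pairs extend greedily and disjointly to edges of [H] of unused colours, and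
    an edge of [F] can always be assigned an arbitrary [r]-set, whatever its
    colour; so a copy of [F - e1] in the graph of heavy pairs already yields a
    rainbow copy.  As [F - e1] is [(k+1)]-colourable, that graph has
    [o(n^(k+1))] cliques of order [k+1], while it has at least
    [t_p(n,r) - O(n^(r-1))] cliques of order [r].  The Moon-Moser inequalities
    are then nearly tight, which forces the heavy graph to be close to a
    balanced complete [k]-partite graph; take its parts from a maximum cut.

    Call a vertex generic if it has few light neighbours in the other parts.
    Two [r]-sets of different colours, each containing two generic vertices of
    one part, placed as prescribed by [e1] and [e2], give a rainbow copy; since
    [r >= 4] there are [r]-sets containing two generic vertices in each of two
    parts, and they link any two such sets through a chain of equal colours.
    So at most one edge of [H] contains two generic vertices of one part.  A
    nongeneric vertex lies on many missing crossing [r]-sets but on few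
    noncrossing edges of [H], because max-cut gives a vertex with many heavy
    neighbours in its own part many heavy neighbours in every part, hence a copy
    of [F - e1].  Double counting gives [|H| <= t_p(n,r) + 1]. *)

Set Implicit Arguments.
Unset Strict Implicit.
Unset Printing Implicit Defensive.

Import Order.TTheory GRing.Theory Num.Theory.

(** * Crossing sets and elementary symmetric functions *)

Lemma bin_leq_exp n m : 'C(n, m) <= n ^ m.
Proof.
apply: (@leq_trans (n ^_ m)); first by rewrite -bin_ffact leq_pmulr ?fact_gt0.
by elim: m => // m IH; rewrite ffactnSr expnSr leq_mul // leq_subr.
Qed.

(** Removing [A] is injective on these sets and leaves sets of size [r - #|A|]. The bound is applied
    to pairs and to triples. *)
Lemma card_rsets_containing (X : finType) r (A : {set X}) :
  #|[set e : {set X} | (#|e| == r) && (A \subset e)]| <= #|X| ^ (r - #|A|).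
Proof.
apply: leq_trans (bin_leq_exp _ _); rewrite -card_draws.
have inj : {in [set e : {set X} | (#|e| == r) && (A \subset e)] &, injective (fun e => e :\: A)}.
  move=> e e'; rewrite !inE => /andP[_ sAe] /andP[_ sAe'] eq_D.
  by rewrite -(setID e A) -(setID e' A) eq_D (setIidPr sAe) (setIidPr sAe').
rewrite -(card_in_imset inj); apply/subset_leq_card/subsetP => B /imsetP[e].
rewrite !inE => /andP[/eqP er sAe] ->.
by rewrite cardsD (setIidPr sAe) er.
Qed.

Section Crossing.
Variables (X I : finType) (P : X -> I).

Implicit Types (i j : I) (J : {set I}) (x y : X) (e : {set X}).

Definition part i := [set x | P x == i].
Definition transversals J : {set {set X}} :=
  [set A : {set X} | (P @: A == J) && (#|A| == #|J|)].
(** Equality of the two cardinalities encodes injectivity of [P] on [e]: such a set meets each part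
    at most once. *)
Definition crossing r : {set {set X}} := [set e : {set X} | (#|e| == r) && (#|P @: e| == r)].

Lemma crossing_inj r e : e \in crossing r -> {in e &, injective P}.
Proof. by rewrite inE => /andP[/eqP er /eqP ir]; apply/imset_injP; rewrite ir er. Qed.

Lemma card_transversals0 : transversals set0 = [set set0].
Proof.
apply/setP=> A; rewrite !inE cards0; apply/andP/eqP => [[_ /eqP/cards0_eq]|->] //.
by rewrite imset0 cards0.
Qed.

Lemma transversalsU1 J i : i \notin J ->
  transversals (i |: J) = [set x |: (A : {set X}) | x in part i, A in transversals J].
Proof.
move=> iJ; apply/setP=> B; apply/idP/imset2P => [|[x A]]; last first.
  rewrite !inE => /eqP Px /andP[/eqP PA /eqP cA] ->.
  rewrite imsetU1 PA Px eqxx /= !cardsU1 cA iJ; suff -> : x \notin A by [].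
  by apply: contra iJ => xA; rewrite -PA -Px imset_f.
rewrite !inE => /andP[/eqP PB /eqP cB].
have injP : {in B &, injective P} by apply/imset_injP; rewrite PB cB.
have /imsetP[x xB ix] : i \in P @: B by rewrite PB setU11.
exists x (B :\ x); rewrite ?inE -?ix ?eqxx ?setD1K //.
have cB' : #|B :\ x| = #|J|.
  by move: cB; rewrite cardsU1 iJ (cardsD1 x B) xB => -[].
rewrite cB' eqxx andbT eqEcard; apply/andP; split; last first.
  rewrite -cB' card_in_imset // => y z /setD1P[_ yB] /setD1P[_ zB]; exact: injP.
apply/subsetP=> j /imsetP[y /setD1P[yx yB] ->].
have : P y \in i |: J by rewrite -PB imset_f.
rewrite in_setU1 => /orP[|//]; rewrite ix => /eqP /(injP _ _ yB xB) eyx.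
by rewrite eyx eqxx in yx.
Qed.

Lemma card_transversals J : #|transversals J| = \prod_(i in J) #|part i|.
Proof.
have [m] := ubnP #|J|; elim: m J => // m IH J.
have [->|[i iJ]] := set_0Vmem J.
  by rewrite card_transversals0 cards1 big_set0.
rewrite (cardsD1 i J) iJ ltnS => /IH {}IH.
rewrite -{1}(setD1K iJ) transversalsU1 ?setD11 // (big_setD1 i) //= -IH.
rewrite curry_imset2X card_in_imset ?cardsX // => -[x A] [y B] /=.
have Jx z C : z \in part i -> C \in transversals (J :\ i) -> z \notin C.
  rewrite !inE => /eqP Pz /andP[/eqP PC _]; apply/negP=> zC.
  by have := imset_f P zC; rewrite PC Pz setD11.
rewrite !in_setX /= => /andP[xi At] /andP[yi Bt] eq.
have xy : x = y.
  have : x \in y |: B by rewrite -eq setU11.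
  rewrite in_setU1 => /orP[/eqP//|xB].
  by have := Jx _ _ xi Bt; rewrite xB.
rewrite -{y}xy in yi eq *; congr (_, _).
by rewrite -(setU1K (Jx _ _ xi At)) eq setU1K // Jx.
Qed.

(** Grouping the crossing sets by the set of parts they meet yields an elementary symmetric function
    of the part sizes. *)
Lemma card_crossing r :
  #|crossing r| = \sum_(J : {set I} | #|J| == r) \prod_(i in J) #|part i|.
Proof.
rewrite -sum1_card (partition_big (fun e => P @: e) (fun J => #|J| == r)) /=; last first.
  by move=> e; rewrite inE => /andP[].
apply: eq_bigr => J /eqP Jr; rewrite -card_transversals -sum1_card.
apply: eq_bigl => e; rewrite !inE Jr; case: (P @: e =P J) => [->|_]; last by rewrite andbF.
by rewrite Jr eqxx !andbT.
Qed.

(** Any [r - 2] parts other than those of [x] and [y] have at least [m ^ (r - 2)] transversals, and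
    each of them completes the pair to a crossing set. *)
Lemma card_crossing_pair r m x y : (forall i, m <= #|part i|) ->
  2 <= r <= #|I| -> P x != P y ->
  m ^ (r - 2) <= #|[set e in crossing r | (x \in e) && (y \in e)]|.
Proof.
move=> hm /andP[r2 rI] Pxy.
have [J sJ cJ] : exists2 J : {set I}, J \subset ~: [set P x; P y] & #|J| = r - 2.
  have : 0 < #|[set J : {set I} | (J \subset ~: [set P x; P y]) & #|J| == r - 2]|.
    rewrite cards_draws bin_gt0 cardsCs setCK cards2 Pxy; lia.
  by case/card_gt0P=> J; rewrite inE => /andP[sJ /eqP cJ]; exists J.
have notin z : z \in [set x; y] -> forall A, A \in transversals J -> z \notin A.
  move=> zxy A; rewrite inE => /andP[/eqP PA _]; apply/negP=> zA.
  have := subsetP sJ (P z); rewrite -PA imset_f // => /(_ isT).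
  by case/set2P: zxy => ->; rewrite !inE eqxx ?orbT.
have xA := notin x (set21 _ _); have yA := notin y (set22 _ _).
have xy : x != y by apply: contraNneq Pxy => ->.
apply: (@leq_trans #|transversals J|).
  rewrite card_transversals -cJ -prod_nat_const; exact: leq_prod.
have inj : {in transversals J &, injective (fun A => x |: (y |: A))}.
  move=> A B AJ BJ /(congr1 (fun C => C :\ x :\ y)).
  by rewrite !setU1K ?yA // in_setU1 negb_or xy xA.
rewrite -(card_in_imset inj); apply/subset_leq_card/subsetP => e /imsetP[A AJ ->].
move: (AJ); rewrite inE => /andP[/eqP PA /eqP cA].
rewrite !inE !eqxx !orbT !andbT !imsetU1 PA !cardsU1 !in_setU1 cA (negPf xy) xA ?yA //=.
have nJ z : z \in [set x; y] -> P z \notin J.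
  move=> zxy; apply/negP=> /(subsetP sJ).
  by case/set2P: zxy => ->; rewrite !inE eqxx ?orbT.
rewrite (negPf Pxy) !nJ ?set21 ?set22 //= cJ; lia.
Qed.

End Crossing.

Lemma sum_subsetsU1 (I : finType) (i : I) (S : {set I}) (E : {set I} -> nat) :
  i \notin S ->
  \sum_(J : {set I} | J \subset i |: S) E J =
  \sum_(J : {set I} | J \subset S) (E J + E (i |: J)).
Proof.
move=> iS; rewrite big_split /= (bigID (fun J : {set I} => i \in J)) /= addnC; congr (_ + _).
  apply: eq_bigl => J; apply/andP/idP => [[sJ iJ]|sJ].
    apply/subsetP=> j jJ; have := subsetP sJ j jJ; rewrite in_setU1.
    by case/orP=> // /eqP ji; rewrite -ji jJ in iJ.
  split; first exact: subset_trans sJ (subsetUr _ _).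
  by apply: contra iS => /(subsetP sJ).
rewrite (reindex_onto (fun J => i |: J) (fun J => J :\ i)) /=; last first.
  by move=> J /andP[_ iJ]; rewrite setD1K.
apply: eq_bigl => J; rewrite setU11 andbT; apply/andP/idP => [[sJ /eqP eJ]|sJ].
  apply/subsetP=> j jJ; have := subsetP sJ j; rewrite !in_setU1 jJ orbT => /(_ isT).
  by case/orP=> // /eqP ji; move: jJ; rewrite -eJ ji setD11.
by rewrite setUS // setU1K //; apply: contra iS => /(subsetP sJ).
Qed.

(** * Elementary symmetric functions are largest at balanced vectors *)

Section Balanced.
Variable I : finType.
Implicit Types a b : {ffun I -> nat}.

Definition elem_sym r a := \sum_(J : {set I} | #|J| == r) \prod_(i in J) a i.

(** The truncation in [.-1] is harmless: the transfer is used only when [a j < a i]. *)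
Definition shift1 i j a : {ffun I -> nat} :=
  [ffun l => if l == i then (a l).-1 else if l == j then (a l).+1 else a l].

(** Sorting the sets by their trace on the pair [i], [j] shows that, the other entries being fixed,
    the sum depends only on [a i + a j] and [a i * a j], and is nondecreasing in both. *)
Lemma elem_sym_split r (i j : I) a : i != j ->
  elem_sym r a = \sum_(J : {set I} | J \subset ~: [set i; j])
    ((#|J| == r) + (#|J|.+1 == r) * (a i + a j) + (#|J|.+2 == r) * (a i * a j))
      * \prod_(l in J) a l.
Proof.
move=> ij; rewrite /elem_sym big_mkcond /=.
pose E (J : {set I}) := if #|J| == r then \prod_(i0 in J) a i0 else 0.
have eT : i |: (j |: ~: [set i; j]) = setT.
  by apply/setP=> l; rewrite !inE; case: eqP; case: eqP.
rewrite (eq_bigl (fun J : {set I} => J \subset i |: (j |: ~: [set i; j]))); last first.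
  by move=> J; rewrite eT subsetT.
rewrite sum_subsetsU1 ?sum_subsetsU1 ?inE ?eqxx ?orbT //; last first.
  by rewrite (negPf ij).
apply: eq_bigr => J sJ.
have iJ : i \notin J by apply: contraTN sJ => iJ; apply/subsetPn; exists i; rewrite ?inE ?eqxx.
have jJ : j \notin J by apply: contraTN sJ => jJ; apply/subsetPn; exists j; rewrite ?inE ?eqxx ?orbT.
have ijJ : i \notin j |: J by rewrite in_setU1 negb_or ij.
rewrite !cardsU1 ijJ iJ jJ !big_setU1 //= !add1n.
by do 3!case: eqP => _; rewrite /= ?mul0n ?mul1n ?addn0 ?add0n //; lia.
Qed.

(** The transfer keeps the sum of the two entries and changes their product by
    [a i - a j - 1 >= 0]. *)
Lemma elem_sym_shift r i j a : a j < a i -> elem_sym r a <= elem_sym r (shift1 i j a).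
Proof.
move=> ltji; have ij : i != j by apply: contraTneq ltji => ->; rewrite ltnn.
rewrite !(elem_sym_split _ _ ij); apply: leq_sum => J sJ.
have -> : \prod_(l in J) shift1 i j a l = \prod_(l in J) a l.
  apply: eq_bigr => l lJ; rewrite ffunE; have := subsetP sJ l lJ.
  by rewrite !inE negb_or => /andP[/negPf-> /negPf->].
rewrite leq_mul2r !ffunE !eqxx [j == i]eq_sym (negPf ij); apply/orP; right.
by apply: leq_add; [apply: leq_add|]; rewrite // leq_mul2l; apply/orP; right; nia.
Qed.

(* Move a unit from [i] with [a i > b i] to [j] with [a j < b j]: as [b] is
   balanced, [a j < a i], so the sum does not decrease while [a] approaches [b]. *)
Lemma elem_sym_max r a b : \sum_i a i = \sum_i b i ->
  (forall i j, b i <= (b j).+1) -> elem_sym r a <= elem_sym r b.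
Proof.
(* The induction is on the total excess of [a] over [b]; truncated subtraction keeps only the
   indices with [b i < a i]. *)
move=> eqab bal; have [m] := ubnP (\sum_i (a i - b i)); elim: m => // m IH in a eqab *.
move=> ltm; have [/existsP[i lti]|] := boolP [exists i, b i < a i]; last first.
  rewrite negb_exists => /forallP le_ab.
  have {}le_ab i : a i <= b i by have := le_ab i; rewrite -leqNgt.
  suff -> : a = b by [].
  apply/ffunP=> i; apply/eqP; rewrite eqn_leq le_ab leqNgt; apply/negP=> lt.
  suff : \sum_i a i < \sum_i b i by rewrite eqab ltnn.
  rewrite (bigD1 i) //= [X in _ < X](bigD1 i) //= -addSn.
  by apply: leq_add => //; apply: leq_sum => j _.
have [/existsP[j ltj]|] := boolP [exists j, a j < b j]; last first.
  rewrite negb_exists => /forallP le_ba.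
  have {}le_ba j : b j <= a j by have := le_ba j; rewrite -leqNgt.
  suff : \sum_i b i < \sum_i a i by rewrite eqab ltnn.
  rewrite (bigD1 i) //= [X in _ < X](bigD1 i) //= -addSn.
  by apply: leq_add => //; apply: leq_sum => j _.
have ij : i != j by apply: contraTneq lti => ->; rewrite -leqNgt ltnW.
have ltji : a j < a i by have := bal j i; lia.
apply: leq_trans (elem_sym_shift r ltji) _; apply: IH.
  rewrite -eqab (bigD1 i) //= (bigD1 j) 1?eq_sym //=.
  rewrite [in RHS](bigD1 i) //= [in RHS](bigD1 j) 1?eq_sym //=.
  rewrite !ffunE !eqxx [j == i]eq_sym (negPf ij) (eq_bigr a); last first.
    by move=> l /andP[/negPf li /negPf lj]; rewrite ffunE li lj.
  by rewrite !addnA; congr (_ + _); move: ltji; clear; case: (a i) => //= q _; rewrite addnS.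
rewrite ltnS in ltm; apply: leq_trans ltm.
rewrite (bigD1 i) //= [X in _ < X](bigD1 i) //= -addSn; apply: leq_add.
  by rewrite ffunE eqxx; lia.
apply: leq_sum => l li; rewrite ffunE (negPf li); case: eqP => [->|//]; lia.
Qed.

End Balanced.

(** * The Turan hypergraph and the lower bound *)

Section Turan.
Variables (n k : nat).
Hypothesis k_gt0 : 0 < k.

Definition residue (v : 'I_n) : 'I_k := Ordinal (ltn_pmod v k_gt0).

Lemma turan_crossing r : turan_rgraph k.+1 n r = crossing residue r.
Proof.
apply/setP=> e; rewrite !inE /=; case: eqP => //= er.
rewrite -er; apply/forallP/imset_injP => [le1 x y xe ye /(congr1 val) /= eq|inj i].
  have := le1 (residue x); move/card_le1_eqP; apply; rewrite inE ?xe ?ye //=.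
  by rewrite eq.
apply/card_le1_eqP => x y; rewrite !inE => /andP[xe /eqP xi] /andP[ye /eqP yi].
by apply: inj => //; apply: val_inj; rewrite /= xi yi.
Qed.

Lemma card_residue_ge i : n %/ k <= #|part residue i|.
Proof.
have lt (q : 'I_(n %/ k)) : q * k + i < n.
  have := ltn_ord q; have := ltn_ord i; have := leq_divM n k; nia.
have inj : injective (fun q => Ordinal (lt q)).
  by move=> q q' [] /addIn /eqP; rewrite eqn_pmul2r // => /eqP /val_inj.
rewrite -{1}(card_ord (n %/ k)) -cardsT -(card_imset _ inj).
apply/subset_leq_card/subsetP => _ /imsetP[q _ ->].
by rewrite inE; apply/eqP/val_inj; rewrite /= modnMDl modn_small.
Qed.

Lemma card_residue_le i : #|part residue i| <= (n %/ k).+1.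
Proof.
have lt (v : 'I_n) : v %/ k < (n %/ k).+1 by rewrite ltnS leq_div2r // ltnW.
have inj : {in part residue i &, injective (fun v => Ordinal (lt v))}.
  move=> v w; rewrite !inE => /eqP vi /eqP wi [] eqd; apply: val_inj => /=.
  rewrite (divn_eq v k) (divn_eq w k) eqd.
  by have /= -> := congr1 val vi; have /= -> := congr1 val wi.
by rewrite -(card_in_imset inj) -[X in _ <= X]card_ord max_card.
Qed.

Lemma sum_card_part (X I : finType) (P : X -> I) : \sum_i #|part P i| = #|X|.
Proof.
rewrite -sum1_card (partition_big P xpredT) //=; apply: eq_bigr => i _.
by rewrite -sum1_card; apply: eq_bigl => x; rewrite inE.
Qed.

(** Each residue class has [n %/ k] or [(n %/ k).+1] elements, so its vector of sizes is the
    balanced one. *)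
Lemma crossing_le_turan (P : 'I_n -> 'I_k) r :
  #|crossing P r| <= #|turan_rgraph k.+1 n r|.
Proof.
rewrite turan_crossing !card_crossing.
pose a := [ffun i => #|part P i|]; pose b := [ffun i => #|part residue i|].
have -> : \sum_(J : {set 'I_k} | #|J| == r) \prod_(i in J) #|part P i| = elem_sym r a.
  by apply: eq_bigr => J _; apply: eq_bigr => i _; rewrite ffunE.
have -> : \sum_(J : {set 'I_k} | #|J| == r) \prod_(i in J) #|part residue i| = elem_sym r b.
  by apply: eq_bigr => J _; apply: eq_bigr => i _; rewrite ffunE.
apply: elem_sym_max => [|i j].
  transitivity n; [rewrite -[RHS]card_ord -(sum_card_part P)|
                   rewrite -[LHS]card_ord -(sum_card_part residue)];
  by apply: eq_bigr => i _; rewrite ffunE.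
rewrite !ffunE; apply: leq_trans (card_residue_le i) _.
by rewrite ltnS card_residue_ge.
Qed.

Lemma turan_ge r : 'C(k, r) * (n %/ k) ^ r <= #|turan_rgraph k.+1 n r|.
Proof.
rewrite turan_crossing card_crossing -{1}(card_ord k) -cardsT -cards_draws.
rewrite -sum_nat_const (eq_bigl (fun J : {set 'I_k} => #|J| == r)); last first.
  by move=> J; rewrite inE subsetT.
apply: leq_sum => J /eqP <-; rewrite -prod_nat_const.
by apply: leq_prod => i _; apply: card_residue_ge.
Qed.

End Turan.

(** * The lower bound colouring *)

Section LowerBound.

Lemma expansion_edge_inj r (V : finType) (F : {set {set V}}) : 
  injective (@expansion_edge r V F).
Proof.
move=> e e' eq; apply/val_inj/setP => v.
have H (d : {e : {set V} | e \in F}) : (inl v \in expansion_edge r d) = (v \in val d).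
  rewrite in_setU; apply/orP/idP => [[|]|vd]; last by left; apply: imset_f.
    by case/imsetP=> u ud [->].
  by case/imsetP.
by rewrite -!H eq.
Qed.

Lemma not_colorable_sub1 p (V : finType) (F : {set {set V}}) e :
  0 < p -> p <= chromatic_number (F :\ e) -> ~~ colorable (F :\ e) p.-1.
Proof.
move=> p0; rewrite /chromatic_number; case: ex_minnP => m _ min le.
apply/negP=> /min; lia.
Qed.

Lemma colorable_chromatic (V : finType) (F : {set {set V}}) : colorable F (chromatic_number F).
Proof. by rewrite /chromatic_number; case: ex_minnP. Qed.

(** At most one edge of a rainbow copy has colour [None]. Once the corresponding edge of [F] is
    deleted, all other images are crossing, so the residues of the core vertices give a proper
    colouring with [p.-1] colours, which criticality excludes. *)
Lemma rainbow_free_turan (r p n : nat) (V : finType) (F : {set {set V}}) :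
  1 < p ->
  (forall e, e \in F -> ~~ colorable (F :\ e) p.-1) -> F != set0 ->
  ~ has_rainbow_copy r (expansion r F)
     (fun e : {set 'I_n} => if e \in turan_rgraph p n r then Some e else None).
Proof.
move=> p1 crit F0 [phi [inj_phi _ phi_inj]].
case: p p1 crit phi phi_inj inj_phi => // k k0 crit phi phi_inj inj_phi.
rewrite ltnS in k0.
pose E e := expansion_edge r e : {set expansion_vertex r F}.
have EF e : E e \in expansion r F by apply: imset_f.
(* [d] is the edge of colour [None] if there is one; otherwise any edge of [F] serves. *)
have [d dF dT] : exists2 d, d \in F & forall e : {e | e \in F}, val e != d ->
    phi @: E e \in turan_rgraph k.+1 n r.
  have [/existsP[d dT]|] := boolP [exists d, phi @: E d \notin turan_rgraph k.+1 n r].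
    exists (val d); first exact: (valP d).
    move=> e; apply: contraNT => eT; apply/eqP; congr val.
    apply: (@expansion_edge_inj r); apply: phi_inj; rewrite ?EF //=.
    by rewrite (negPf eT) (negPf dT).
  rewrite negb_exists => /forallP allT.
  have /set0Pn[d dF] := F0; exists d => // e _.
  by have := allT e; rewrite negbK.
have /negP := crit d dF; apply; apply/existsP.
exists [ffun v => residue k0 (phi (inl v))].
apply/forallP=> x; apply/forallP=> y; apply/implyP=> /andP[xy].
rewrite !inE => /andP[xyd xyF]; rewrite !ffunE.
have := dT (exist _ [set x; y] xyF) xyd.
rewrite (turan_crossing _ k0) => /crossing_inj inj; apply: contraNneq xy => /inj.
have mem v : v \in [set x; y] -> phi (inl v) \in phi @: E (exist _ [set x; y] xyF).
  by move=> vxy; apply: imset_f; rewrite in_setU imset_f.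
by move=> /(_ (mem x (set21 _ _)) (mem y (set22 _ _))) /inj_phi [->].
Qed.

Lemma ar_lower (r p n : nat) (V : finType) (F : {set {set V}}) :
  1 < p -> 2 <= r -> p + r <= n ->
  (forall e, e \in F -> ~~ colorable (F :\ e) p.-1) -> F != set0 ->
  #|turan_rgraph p n r| + 2 <= ar n r (expansion r F).
Proof.
move=> p1 r2 np crit F0; rewrite /ar; case: ex_minnP => m /boolp.asboolP forces _.
rewrite leqNgt; apply/negP=> ltm.
apply: (rainbow_free_turan (n := n) p1 crit F0); apply: forces.
rewrite addnS ltnS in ltm; apply: leq_trans ltm _.
(* The extra colour has to occur. The vertices [0] and [p.-1] have the same residue, so an [r]-set
   containing both is not crossing. *)
have [e er eT] : exists2 e, e \in complete_rgraph n r & e \notin turan_rgraph p n r.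
  have lt0 : 0 < n by lia.
  have ltp : p.-1 < n by lia.
  pose x := Ordinal lt0; pose y := Ordinal ltp.
  have xy : x != y by rewrite -val_eqE /=; lia.
  have : 0 < #|[set B : {set 'I_n} | (B \subset ~: [set x; y]) & #|B| == r - 2]|.
    by rewrite cards_draws bin_gt0 cardsCs setCK cards2 xy card_ord; lia.
  case/card_gt0P=> B; rewrite inE => /andP[sB /eqP cB].
  have notB z : z \in [set x; y] -> z \notin B.
    by move=> zxy; apply/negP=> /(subsetP sB); rewrite inE zxy.
  exists (x |: (y |: B)).
    by rewrite inE !cardsU1 in_setU1 (negPf xy) !notB ?set21 ?set22 //= cB; lia.
  rewrite inE negb_and; apply/orP; right; rewrite negb_forall.
  have p0 : 0 < p.-1 by lia.
  apply/existsP; exists (Ordinal p0); rewrite -ltnNge.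
  have -> : 1 = #|[set x; y]|.-1 by rewrite cards2 xy.
  rewrite prednK ?cards2 ?xy //; apply: (@leq_trans #|[set x; y]|); first by rewrite cards2 xy.
  apply/subset_leq_card/subsetP=> z zxy; rewrite !inE.
  by case/set2P: zxy => ->; rewrite eqxx ?orbT /= ?mod0n ?modnn.
set col := fun e => _; set T := turan_rgraph p n r.
have injS : injective (Some : {set 'I_n} -> _) by move=> a b [].
rewrite -(card_imset T injS).
have -> : #|[set Some e | e in T]| + 1 = #|None |: [set Some e | e in T]|.
  rewrite cardsU1 addnC; suff -> : None \notin [set Some e | e in T] by [].
  by apply/imsetP=> -[].
apply/subset_leq_card/subsetP=> c; rewrite in_setU1 => /orP[/eqP->|/imsetP[a aT ->]].
  by apply/imsetP; exists e; rewrite // /col (negPf eT).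
by apply/imsetP; exists a; rewrite /col ?aT //; move: aT; rewrite inE => /andP[].
Qed.

End LowerBound.

(** * Greedy expansion of heavy pairs *)

Lemma leq_card_bigcup (T I : finType) (J : {set I}) (S : I -> {set T}) m :
  (forall i, i \in J -> #|S i| <= m) -> #|\bigcup_(i in J) S i| <= #|J| * m.
Proof.
move=> le_m; rewrite -sum_nat_const.
apply: (@leq_trans (\sum_(i in J) #|S i|)); last exact: leq_sum.
elim/big_rec2: _ => [|i m' U iJ IH]; first by rewrite cards0.
by apply: leq_trans (leq_card_setU _ _) _; rewrite leq_add2l.
Qed.

Definition codegree (X : finType) (H : {set {set X}}) x y :=
  #|[set a in H | (x \in a) && (y \in a)]|.

Lemma codegreeC (X : finType) (H : {set {set X}}) x y : codegree H x y = codegree H y x.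
Proof. by apply: eq_card => a; rewrite !inE; case: (x \in a); rewrite ?andbF ?andbT. Qed.

Section Expansion.
Variables (n r : nat) (V : finType) (F : {set {set V}}) (C : finType).
Variable col : {set 'I_n} -> C.
Hypotheses (r2 : 2 <= r) (F2 : is_rgraph 2 F).
Implicit Types (E : {set {set V}}) (phi : V -> 'I_n) (A : {set V} -> {set 'I_n}).

Definition rainbow_assignment E phi A : Prop :=
  [/\ forall e, e \in E -> #|A e| = r,
      forall e, e \in E -> A e :&: phi @: setT = phi @: e,
      {in E &, forall e e', e != e' -> A e :&: A e' \subset phi @: setT} &
      {in E &, injective (fun e => col (A e))}].

(** Outside the core, [A e] has exactly [r - 2] vertices; an enumeration of them gives the images of
    the new vertices of [e]. *)
Lemma rainbow_copy_of_assignment phi A : injective phi ->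
  rainbow_assignment F phi A -> has_rainbow_copy r (expansion r F) col.
Proof.
move=> inj_phi [cA trA disjA inj_col].
pose B e := A e :\: phi @: setT.
have cB (e : {e : {set V} | e \in F}) : r - 2 = #|B (val e)|.
  by rewrite cardsD trA ?(valP e) // card_imset // cA ?F2 // (valP e).
pose psi (x : expansion_vertex r F) : 'I_n := match x with
  | inl v => phi v
  | inr (e, i) => enum_val (cast_ord (cB e) i) end.
have psiB e i : psi (inr (e, i)) \in B (val e) by apply: enum_valP.
have psi_edge e : psi @: expansion_edge r e = A (val e).
  have eF := valP e; apply/setP=> x; apply/imsetP/idP => [[y]|xA].
    rewrite in_setU => /orP[/imsetP[v ve ->] ->|/imsetP[i _ ->] ->].
      by have : phi v \in phi @: val e by [exact: imset_f]; rewrite -trA // => /setIP[].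
    by have /setDP[] := psiB e i.
  have [xphi|xphi] := boolP (x \in phi @: setT).
    have : x \in phi @: val e by rewrite -trA // inE xA.
    case/imsetP=> v ve ->; exists (inl v) => //.
    by rewrite in_setU imset_f.
  have xB : x \in B (val e) by rewrite inE xphi.
  exists (inr (e, cast_ord (esym (cB e)) (enum_rank_in xB x))).
    by rewrite in_setU; apply/orP; right; apply: imset_f.
  by rewrite /= cast_ordKV enum_rankK_in.
exists psi; split.
- move=> [v|[e i]] [w|[e' i']].
  + by move=> /inj_phi ->.
  + move=> /= eq; have := psiB e' i'; rewrite /= -eq inE => /andP[/negP[]].
    exact: imset_f.
  + move=> /= eq; have := psiB e i; rewrite /= eq inE => /andP[/negP[]].
    exact: imset_f.
  move=> eq; have ee' : e = e'.
    apply: val_inj; apply: contraTeq isT => nee'.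
    have /setDP[x1 x2] := psiB e i; have /setDP[] := psiB e' i'; rewrite -eq => x3 _.
    have := disjA _ _ (valP e) (valP e') nee' => /subsetP /(_ (psi (inr (e, i)))).
    by rewrite inE x1 x3 (negPf x2) => /(_ isT).
  rewrite -{e'}ee' in i' eq *; congr (inr (_, _)).
  by move: eq => /= /enum_val_inj /cast_ord_inj.
- by move=> _ /imsetP[e _ ->]; rewrite psi_edge inE cA ?(valP e).
move=> _ _ /imsetP[e _ ->] /imsetP[e' _ ->]; rewrite !psi_edge => eq.
by congr (expansion_edge r _); apply: val_inj; apply: inj_col eq; apply: valP.
Qed.

Variable H : {set {set 'I_n}}.
Hypotheses (Hr : is_rgraph r H) (colH : {in H &, injective col}).
Let s := #|V| + r * #|F|.

(** Greedy completion, where [s] bounds both the number of occupied vertices and the number of used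
    colours. An occupied vertex off the pair spoils at most [n ^ (r - 3)] edges of [H] through it,
    and a used colour spoils at most one, so a heavy pair always retains a usable edge. *)
Lemma rainbow_copy_of_heavy E phi A : injective phi -> E \subset F ->
  rainbow_assignment E phi A ->
  (forall u v, [set u; v] \in F :\: E -> u != v ->
      s * n ^ (r - 3) + s < codegree H (phi u) (phi v)) ->
  has_rainbow_copy r (expansion r F) col.
Proof.
move=> inj_phi; have [m] := ubnP #|F :\: E|.
elim: m => // m IH in E A * => ltm sEF nice heavy.
have [/eqP FE|[e eFE]] := set_0Vmem (F :\: E).
  apply: (rainbow_copy_of_assignment inj_phi (A := A)).
  by rewrite setD_eq0 in FE; have/eqP <- : E == F by rewrite eqEsubset sEF.
have [eF eE] := setDP eFE.
have [u [v [uv defe]]] : exists u v, u != v /\ e = [set u; v].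
  by apply/cards2P; rewrite F2.
have {}heavy_e : s * n ^ (r - 3) + s < codegree H (phi u) (phi v).
  by apply: heavy; rewrite -?defe.
have [cA trA disjA inj_col] := nice.
pose S := phi @: setT :|: \bigcup_(e' in E) A e'.
have cS : #|S| <= s.
  apply: leq_trans (leq_card_setU _ _) _; apply: leq_add.
    by rewrite card_imset // cardsT.
  apply: leq_trans (leq_card_bigcup (m := r) _) _; first by move=> e' /cA ->.
  by rewrite mulnC leq_mul2l subset_leq_card ?orbT.
(* [Bad1] collects the [r]-sets through the pair that touch another occupied vertex, [Bad2] the
   members of [H] whose colour is already used. *)
pose Bad1 := \bigcup_(z in S :\: [set phi u; phi v])
   [set a : {set 'I_n} | (#|a| == r) && ([set phi u; phi v; z] \subset a)].
pose Bad2 := [set a in H | [exists e' in E, col a == col (A e')]].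
have cBad1 : #|Bad1| <= s * n ^ (r - 3).
  apply: leq_trans (leq_card_bigcup (m := n ^ (r - 3)) _) _.
    move=> z; rewrite !inE negb_or => /andP[/andP[zu zv] _].
    apply: leq_trans (card_rsets_containing _ _) _.
    suff -> : #|[set phi u; phi v; z]| = 3 by rewrite card_ord.
    rewrite setUC cardsU1 cards2 (inj_eq inj_phi) uv !inE negb_or.
    by rewrite zu zv.
  rewrite leq_mul2r; apply/orP; right; apply: leq_trans cS.
  by apply/subset_leq_card/subsetDl.
have cBad2 : #|Bad2| <= s.
  apply: (@leq_trans #|E|); last first.
    apply: (@leq_trans #|F|); first exact: subset_leq_card.
    by rewrite /s -[X in X <= _]mul1n; apply: leq_trans (leq_addl _ _); rewrite leq_mul2r; lia.
  have injB : {in Bad2 &, injective col}.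
    by move=> a b; rewrite inE => /andP[aH _]; rewrite inE => /andP[bH _]; apply: colH.
  rewrite -(card_in_imset injB); apply: leq_trans (leq_imset_card (fun e => col (A e)) E).
  apply/subset_leq_card/subsetP=> c /imsetP[a]; rewrite inE => /andP[_ /existsP[e' /andP[e'E /eqP ->]]] ->.
  exact: imset_f.
have [a aH aNB] : exists2 a, a \in [set a in H | (phi u \in a) && (phi v \in a)] & a \notin Bad1 :|: Bad2.
  apply/subsetPn; apply: contraTN heavy_e => /subset_leq_card le; rewrite -leqNgt.
  by apply: leq_trans le _; apply: leq_trans (leq_card_setU _ _) _; apply: leq_add.
move: aH aNB; rewrite in_setU negb_or inE => /and3P[aH ua va] /andP[aB1 aB2].
have aS z : z \in a -> z \in S -> z \in [set phi u; phi v].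
  move=> za zS; apply: contraR aB1 => zuv; apply/bigcupP; exists z; first by rewrite inE zuv.
  rewrite inE Hr // eqxx; apply/subsetP=> t; rewrite !inE.
  by case/orP=> [/orP[]|] /eqP ->.
have phie : phi @: e = [set phi u; phi v] by rewrite defe imsetU1 imset_set1.
pose A' e' := if e' == e then a else A e'.
have A'E e' : e' \in E -> A' e' = A e'.
  by rewrite /A'; case: eqP => // ->; rewrite (negPf eE).
have A'e : A' e = a by rewrite /A' eqxx.
apply: (IH (e |: E) A').
- apply: leq_ltn_trans (_ : #|F :\: E|.-1 < m); last first.
    by move: ltm; rewrite (cardsD1 e (F :\: E)) eFE /=; lia.
  by rewrite setUC -setDDl [X in _ <= X.-1](cardsD1 e) eFE.
- by rewrite subUset sub1set eF.
- split.
  + move=> e'; rewrite in_setU1 => /orP[/eqP ->|e'E]; first by rewrite A'e Hr.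
    by rewrite A'E // cA.
  + move=> e'; rewrite in_setU1 => /orP[/eqP ->|e'E]; last by rewrite A'E // trA.
    rewrite A'e; apply/setP=> z; apply/setIP/idP => [[za zphi]|].
      by rewrite phie aS // in_setU zphi.
    rewrite phie => zuv; split; first by case/set2P: zuv => ->.
    by case/set2P: zuv => ->; apply: imset_f.
  + have key e' : e' \in E -> a :&: A e' \subset [set phi x | x in setT].
      move=> e'E; apply/subsetP=> z /setIP[za zA].
      have : z \in [set phi u; phi v].
        by apply: aS => //; rewrite in_setU; apply/orP; right; apply/bigcupP; exists e'.
      by case/set2P=> ->; apply: imset_f.
    move=> e1 e2; rewrite !in_setU1 => /orP[/eqP ->|e1E] /orP[/eqP ->|e2E].
    * by rewrite eqxx.
    * by rewrite A'e A'E // => _; apply: key.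
    * by rewrite A'e A'E // setIC => _; apply: key.
    * by rewrite !A'E //; apply: disjA.
  + have key e' : e' \in E -> col a <> col (A e').
      move=> e'E eq; case/negP: aB2; rewrite inE aH; apply/existsP; exists e'.
      by rewrite e'E eq eqxx.
    move=> e1 e2; rewrite !in_setU1 => /orP[/eqP ->|e1E] /orP[/eqP ->|e2E] //.
    * by rewrite A'e A'E // => /key; case.
    * by rewrite A'e A'E // => /esym/key; case.
    * by rewrite !A'E //; apply: inj_col.
move=> x y; rewrite inE => /andP[]; rewrite in_setU1 negb_or => /andP[_ nE] xF.
by apply: heavy; rewrite inE nE.
Qed.

End Expansion.

(** * Greedy embedding into a nearly complete multipartite graph *)

Section Embedding.
Variables (X I : finType) (P : X -> I) (g : rel X) (d : nat).
Hypothesis g_sym : symmetric g.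

Definition light_in x i := [set z | (P z == i) && ~~ g x z].
Definition generic : {set X} := [set x | [forall i, (i != P x) ==> (#|light_in x i| <= d)]].

Lemma genericP x i : x \in generic -> i != P x -> #|light_in x i| <= d.
Proof. by rewrite inE => /forallP /(_ i) /implyP. Qed.

(** The images on [U] are prescribed and the other vertices are placed one at a time. Each placed
    vertex excludes itself and at most [d] light neighbours, hence at most [#|V| * d.+1] candidates
    in all. Nothing is claimed about pairs inside [U]. *)
Lemma greedy_embedding (V : finType) (f : V -> I) (U : {set V}) (phi0 : V -> X)
    (S : I -> {set X}) :
  {in U &, injective phi0} ->
  {in U, forall u, P (phi0 u) = f u /\ phi0 u \in generic} ->
  (forall i, S i \subset part P i :&: generic) ->
  (forall i, #|V| * d.+1 < #|S i|) ->
  exists phi : V -> X, [/\ injective phi, {in U, phi =1 phi0},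
    forall v, v \notin U -> phi v \in S (f v) &
    forall u v, f u != f v -> (u \notin U) || (v \notin U) -> g (phi u) (phi v)].
Proof.
move=> inj0 U0 sS cS.
pose good (D : {set V}) phi := [/\ {in D &, injective phi}, {in U, phi =1 phi0},
  forall v, v \in D -> v \notin U -> phi v \in S (f v) &
  forall u v, u \in D -> v \in D -> f u != f v -> (u \notin U) || (v \notin U) -> g (phi u) (phi v)].
suff: forall m (D : {set V}) phi, #|~: D| < m -> U \subset D -> good D phi -> exists phi, good setT phi.
  have good0 : good U phi0.
    by split=> // [v ->//|u v -> -> _].
  move=> /(_ _ _ _ (ltnSn _) (subxx U) good0) [phi [inj eq0 SS gg]].
  by exists phi; split=> // [u v|v vU|u v]; [apply: inj|apply: SS|apply: gg].
elim=> // m IH D phi ltm sUD [inj eq0 SS gg].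
have [eqT|[v vD]] := set_0Vmem (~: D).
  by exists phi; rewrite -[setT]setC0 -eqT setCK.
rewrite inE in vD; have vU : v \notin U by apply: contra vD => /(subsetP sUD).
have gen u : u \in D -> P (phi u) = f u /\ phi u \in generic.
  move=> uD; have [uU|uU] := boolP (u \in U).
    by rewrite eq0 //; apply: U0.
  by have := subsetP (sS (f u)) _ (SS u uD uU); rewrite !inE => /andP[/eqP -> ->].
(* If [u] and [v] have the same colour, no heavy pair is required and only the image of [u] itself
   is forbidden. *)
pose bad u := phi u |: (if f u == f v then set0 else light_in (phi u) (f v)).
have [x xS xbad] : exists2 x, x \in S (f v) & x \notin \bigcup_(u in D) bad u.
  apply/subsetPn; apply: contraTN (cS (f v)) => /subset_leq_card le; rewrite -leqNgt.
  apply: leq_trans le _; apply: leq_trans (leq_card_bigcup (m := d.+1) _) _; last first.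
    by rewrite leq_mul2r max_card orbT.
  move=> u uD; have [Pu genu] := gen u uD.
  rewrite cardsU1 -add1n; apply: leq_add; first by case: (_ \notin _).
  case: ifPn => [_|fuv]; first by rewrite cards0.
  by apply: genericP; rewrite // Pu eq_sym.
have xbadu u : u \in D -> x != phi u /\ (f u != f v -> g (phi u) x).
  move=> uD; have : x \notin bad u by apply: contra xbad => xb; apply/bigcupP; exists u.
  rewrite in_setU1 negb_or => /andP[-> xn]; split=> // fuv.
  move: xn; rewrite (negPf fuv) inE negb_and negbK => /orP[|//].
  by have := subsetP (sS (f v)) _ xS; rewrite !inE => /andP[-> _].
pose phi' u := if u == v then x else phi u.
have phi'E u : u \in D -> phi' u = phi u.
  by rewrite /phi'; case: eqP => // ->; rewrite (negPf vD).
have phi'v : phi' v = x by rewrite /phi' eqxx.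
apply: (IH (v |: D) phi'); last split.
- by move: ltm; rewrite setCU setIC -setDE (cardsD1 v (~: D)) inE vD.
- exact: subset_trans sUD (subsetUr _ _).
- move=> u w; rewrite !in_setU1 => /orP[/eqP->|uD] /orP[/eqP->|wD] //.
  + by rewrite phi'v phi'E // => eq; have [] := xbadu w wD; rewrite eq eqxx.
  + by rewrite phi'v phi'E // => eq; have [] := xbadu u uD; rewrite eq eqxx.
  + by rewrite !phi'E //; apply: inj.
- by move=> u uU; rewrite phi'E ?eq0 //; apply: (subsetP sUD).
- by move=> u; rewrite in_setU1 => /orP[/eqP->|uD]; rewrite ?phi'v // phi'E //; apply: SS.
move=> u w; rewrite !in_setU1 => /orP[/eqP->|uD] /orP[/eqP->|wD].
- by rewrite eqxx.
- by rewrite phi'v phi'E // g_sym eq_sym => fwv _; apply: (xbadu w wD).2.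
- by rewrite phi'v phi'E // => fuv _; apply: (xbadu u uD).2.
- by rewrite !phi'E //; apply: gg.
Qed.

End Embedding.

(** * Consequences of the absence of a rainbow copy *)

Lemma extend_rset (X : finType) r (Q Z : {set X}) : #|Q| <= r -> #|Z| + r <= #|X| ->
  exists D : {set X}, [/\ #|D| = r, Q \subset D & D :&: Z \subset Q].
Proof.
move=> Qr Zr; have : 0 < #|[set B : {set X} | (B \subset ~: (Q :|: Z)) & #|B| == r - #|Q|]|.
  rewrite cards_draws bin_gt0.
  have := cardsC (Q :|: Z); have : #|Q :|: Z| <= #|Q| + #|Z| := leq_card_setU Q Z; lia.
case/card_gt0P=> B; rewrite inE => /andP[/subsetP sB /eqP cB]; exists (Q :|: B); split.
- have dQB : Q :&: B = set0.
    apply/setP=> x; rewrite !inE; apply/negP=> /andP[xQ /sB].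
    by rewrite !inE xQ.
  by rewrite cardsU dQB cards0 cB; lia.
- exact: subsetUl.
apply/subsetP=> x; rewrite !inE => /andP[/orP[//|/sB]].
by rewrite !inE negb_or => /andP[_ /negPf->].
Qed.

Lemma card_setD_ge (T : finType) (A B : {set T}) : #|A| - #|B| <= #|A :\: B|.
Proof. by rewrite cardsD leq_sub2l // subset_leq_card ?subsetIr. Qed.

Lemma cardsU_le (T : finType) (A B : {set T}) a b :
  #|A| <= a -> #|B| <= b -> #|A :|: B| <= a + b.
Proof. by move=> Aa Bb; apply: leq_trans (leq_card_setU _ _) (leq_add Aa Bb). Qed.

Lemma cards4_le (T : finType) (x y z t : T) : #|[set x; y; z; t]| <= 4.
Proof. by rewrite -[4]/(1 + 1 + 1 + 1) !cardsU_le ?cards1. Qed.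

(** The condition [x != y] is imposed because [codegree H x x] is a degree and may be large; it
    makes the relation irreflexive. *)
Definition heavy (X : finType) (H : {set {set X}}) h x y := (x != y) && (h < codegree H x y).

Lemma heavyC (X : finType) (H : {set {set X}}) h : symmetric (heavy H h).
Proof. by move=> x y; rewrite /heavy eq_sym codegreeC. Qed.

Lemma heavyxx (X : finType) (H : {set {set X}}) h x : heavy H h x x = false.
Proof. by rewrite /heavy eqxx. Qed.

Section NoRainbow.
Variables (n r k : nat) (V : finType) (F : {set {set V}}) (C : finType).
Variables (col : {set 'I_n} -> C) (H : {set {set 'I_n}}).
Hypotheses (r4 : 4 <= r) (rk : r <= k) (F2 : is_rgraph 2 F).
Hypotheses (Hr : is_rgraph r H) (colH : {in H &, injective col}).
Hypothesis no_rainbow : ~ has_rainbow_copy r (expansion r F) col.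
Variables (e1 e2 : {set V}) (f : V -> 'I_k).
Hypotheses (e1F : e1 \in F) (e2F : e2 \in F) (e12 : e1 != e2).
Hypothesis proper_f : forall u v, [set u; v] \in F -> [set u; v] != e1 ->
  [set u; v] != e2 -> u != v -> f u != f v.
Hypothesis mono1 : {in e1 &, forall u v, f u = f v}.
Hypothesis mono2 : {in e2 &, forall u v, f u = f v}.

Let s := #|V| + r * #|F|.
Let g := heavy H (s * n ^ (r - 3) + s).

Let r2 : 2 <= r. Proof. exact: leq_trans r4. Qed.

(** [e1] is assigned an arbitrary [r]-set meeting the core exactly in its image. Whatever colour
    this set has, the greedy completion avoids it. *)
Lemma no_almost_copy (phi : V -> 'I_n) : #|V| + r <= n -> injective phi ->
  ~ (forall u v, [set u; v] \in F -> [set u; v] != e1 -> u != v -> g (phi u) (phi v)).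
Proof.
move=> nbig inj_phi gphi.
have [D [cD sD dD]] : exists D : {set 'I_n}, [/\ #|D| = r, phi @: e1 \subset D & D :&: phi @: setT \subset phi @: e1].
  by apply: extend_rset; rewrite card_imset //; [rewrite F2|rewrite cardsT card_ord].
apply: no_rainbow; apply: (rainbow_copy_of_heavy r2 F2 Hr colH (E := [set e1]) (A := fun=> D) inj_phi).
- by rewrite sub1set.
- split.
  + by [].
  + move=> e /set1P ->; apply/eqP; rewrite eqEsubset dD subsetI sD.
    by apply: imsetS; apply: subsetT.
  + by move=> e e' /set1P -> /set1P ->; rewrite eqxx.
  + by move=> e e' /set1P -> /set1P ->.
move=> u v; rewrite in_setD in_set1 => /andP[ne1 uvF] uv.
by have /andP[] := gphi u v uvF ne1 uv.
Qed.

Variables (P : 'I_n -> 'I_k) (d : nat).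
Let G := generic P g d.

(* [w] would serve as the image of an endpoint of [e2]: removing that endpoint
   makes [F - e1] properly coloured by [f]. *)
Lemma no_apex (w : 'I_n) : #|V| + r <= n ->
  exists i, #|[set z in part P i :&: G | g w z]| <= #|V| * d.+1.
Proof.
move=> nbig; apply/existsP; apply: contraT; rewrite negb_exists => /forallP all_gt.
have /cards2P[a [b [ab de2]]] : #|e2| == 2 by rewrite F2.
have {}all_gt i : #|V| * d.+1 < #|[set z in part P i :&: G | g w z]| by rewrite ltnNge all_gt.
pose S i := [set z in part P i :&: G | g w z].
have inj0 : {in set0 &, injective (fun _ : V => w)} by move=> u v; rewrite inE.
have gen0 : {in set0, forall u, P w = f u /\ w \in generic P g d} by move=> u; rewrite inE.
have sS i : S i \subset part P i :&: generic P g d by apply/subsetP=> z; rewrite inE => /andP[].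
have [phi [inj_phi _ phiS phig]] := greedy_embedding (@heavyC _ H _) inj0 gen0 sS all_gt.
have gw v : g w (phi v) by have := phiS v; rewrite !inE => /(_ isT) /andP[].
(* All of [V] has been embedded among the heavy neighbours of [w]; now [a] is moved to [w], which is
   heavily joined to every other image. *)
pose phi' v := if v == a then w else phi v.
have inj' : injective phi'.
  move=> u v; rewrite /phi'; case: eqP => [->|_]; case: eqP => [->|_] //.
  - by move=> eq; have := gw v; rewrite -eq /g heavyxx.
  - by move=> eq; have := gw u; rewrite eq /g heavyxx.
  - exact: inj_phi.
exfalso; apply: (no_almost_copy nbig inj') => u v uvF ne1 uv; rewrite /phi'.
case: eqP => [ua|/eqP ua]; case: eqP => [va|/eqP va].
- by rewrite ua va eqxx in uv.
- exact: gw.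
- by rewrite /g heavyC; apply: gw.
apply: phig; rewrite ?inE // proper_f //.
apply/negP=> /eqP eq; have : a \in [set u; v] by rewrite eq de2 set21.
by rewrite !inE ![a == _]eq_sym (negPf ua) (negPf va).
Qed.

(* A new colour for one endpoint of [e2] makes [F - e1] properly [(k+1)]-coloured. *)
Lemma no_blowup (Y : nat -> 'I_#|V| -> 'I_n) : #|V| + r <= n ->
  (forall i, i <= k -> injective (Y i)) ->
  ~ (forall i j x y, i < j -> j <= k -> g (Y i x) (Y j y)).
Proof.
move=> nbig injY gY.
have /cards2P[a [b [ab de2]]] : #|e2| == 2 by rewrite F2.
pose f' v : nat := if v == a then k else f v.
have f'k v : f' v <= k by rewrite /f'; case: eqP => // _; apply: ltnW.
have {}gY i j x y : i != j -> i <= k -> j <= k -> g (Y i x) (Y j y).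
  by rewrite neq_ltn => /orP[] lt ik jk; [|rewrite /g heavyC]; apply: gY.
(* Indexing by [enum_rank v] separates the vertices that share a colour class. *)
pose phi v := Y (f' v) (enum_rank v).
have gphi u v : f' u != f' v -> g (phi u) (phi v) by move=> ne; apply: gY.
have inj_phi : injective phi.
  move=> u v eq; have [ff|/gphi] := eqVneq (f' u) (f' v); last by rewrite eq /g heavyxx.
  by move: eq; rewrite /phi ff => /injY-/(_ (f'k v)) /enum_rank_inj.
apply: (no_almost_copy nbig inj_phi) => u v uvF ne1 uv; apply: gphi; rewrite /f'.
case: (u =P a) => [ua|/eqP ua]; case: (v =P a) => [va|/eqP va].
- by rewrite ua va eqxx in uv.
- by rewrite neq_ltn ltn_ord orbT.
- by rewrite neq_ltn ltn_ord.
apply: proper_f => //.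
apply/negP=> /eqP eq; have : a \in [set u; v] by rewrite eq de2 set21.
by rewrite !inE ![a == _]eq_sym (negPf ua) (negPf va).
Qed.

Hypothesis big : forall i, (#|V| + 4) * d.+1 + 10 * r < #|part P i :&: G|.

(** If the colours differed, [D1] and [D2] could be assigned to [e1] and [e2] and the remaining
    vertices placed greedily outside both sets. The renaming [sigma] of colour classes selects the
    parts that receive [e1] and [e2]. *)
Lemma same_color (phi0 : V -> 'I_n) (sigma : 'I_k -> 'I_k) (D1 D2 : {set 'I_n}) :
  injective sigma -> #|D1| = r -> #|D2| = r ->
  {in e1 :|: e2 &, injective phi0} ->
  {in e1 :|: e2, forall u, P (phi0 u) = sigma (f u) /\ phi0 u \in G} ->
  {in e1 :|: e2 &, forall u v, f u != f v -> g (phi0 u) (phi0 v)} ->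
  phi0 @: e1 \subset D1 -> phi0 @: e2 \subset D2 ->
  D1 :&: D2 \subset phi0 @: (e1 :&: e2) -> col D1 = col D2.
Proof.
move=> inj_s c1 c2 inj0 Pphi0 g0 /subsetP s1 /subsetP s2 /subsetP s12.
apply/eqP/contraT => /eqP ncol; exfalso; apply: no_rainbow.
pose S i := (part P i :&: G) :\: (D1 :|: D2).
have sS i : S i \subset part P i :&: G by apply: subsetDl.
have cS i : #|V| * d.+1 < #|S i|.
  have c12 : #|D1 :|: D2| <= 2 * r by have : #|D1 :|: D2| <= #|D1| + #|D2| := leq_card_setU D1 D2; lia.
  apply: leq_trans (card_setD_ge _ _); rewrite ltn_subRL.
  apply: leq_ltn_trans (big i); apply: leq_trans (leq_add c12 (leqnn _)) _; nia.
have [phi [inj_phi eqphi phiS phig]] := greedy_embedding (@heavyC _ H _) (f := sigma \o f) inj0 Pphi0 sS cS.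
have sub1 u : u \in e1 -> u \in e1 :|: e2 by rewrite in_setU => ->.
have sub2 u : u \in e2 -> u \in e1 :|: e2 by rewrite in_setU orbC => ->.
pose A e := if e == e1 then D1 else D2.
have A1 : A e1 = D1 by rewrite /A eqxx.
have A2 : A e2 = D2 by rewrite /A eq_sym (negPf e12).
have t1 : D1 :&: phi @: setT = phi @: e1.
  apply/setP=> z; apply/setIP/imsetP => [[zD /imsetP[v _ zv]]|[v ve ->]].
    have [vU|vU] := boolP (v \in e1 :|: e2); last first.
      by have := phiS v vU; rewrite -zv !inE zD.
    case: (boolP (v \in e1)) => [ve|ve]; first by exists v.
    have ve2 : v \in e2 by move: vU; rewrite in_setU (negPf ve).
    have : z \in D1 :&: D2.
      by rewrite inE zD zv eqphi // s2 //; apply: imset_f.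
    move/s12 => /imsetP[w /setIP[we1 we2] zw]; exists w => //.
    by rewrite eqphi // sub1.
  by split; [rewrite eqphi ?sub1 //; apply/s1/imset_f|apply: imset_f].
have t2 : D2 :&: phi @: setT = phi @: e2.
  apply/setP=> z; apply/setIP/imsetP => [[zD /imsetP[v _ zv]]|[v ve ->]].
    have [vU|vU] := boolP (v \in e1 :|: e2); last first.
      by have := phiS v vU; rewrite -zv !inE zD orbT.
    case: (boolP (v \in e2)) => [ve|ve]; first by exists v.
    have ve1 : v \in e1 by move: vU; rewrite in_setU (negPf ve) orbF.
    have : z \in D1 :&: D2.
      by rewrite inE zD andbT zv eqphi // s1 //; apply: imset_f.
    move/s12 => /imsetP[w /setIP[we1 we2] zw]; exists w => //.
    by rewrite eqphi // sub1.
  by split; [rewrite eqphi ?sub2 //; apply/s2/imset_f|apply: imset_f].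
have d12 : D1 :&: D2 \subset phi @: setT.
  apply/subsetP=> z /s12 /imsetP[v /setIP[ve _] ->].
  by rewrite -eqphi ?sub1 //; apply: imset_f.
apply: (rainbow_copy_of_heavy r2 F2 Hr colH (E := [set e1; e2]) (A := A) inj_phi).
- by apply/subsetP=> e /set2P[] ->.
- split.
  + by move=> e /set2P[] ->; rewrite ?A1 ?A2.
  + by move=> e /set2P[] ->; rewrite ?A1 ?A2.
  + move=> e e' /set2P[] -> /set2P[] ->; rewrite ?eqxx ?A1 ?A2 //.
    by rewrite setIC.
  + by move=> e e' /set2P[] -> /set2P[] ->; rewrite ?A1 ?A2 // => /esym.
move=> u v; rewrite in_setD in_set2 negb_or => /andP[/andP[ne1 ne2] uvF] uv.
have fuv := proper_f uvF ne1 ne2 uv.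
suff /andP[] : g (phi u) (phi v) by [].
have [uU|uU] := boolP (u \in e1 :|: e2); last first.
  by apply: phig; rewrite ?uU //= (inj_eq inj_s).
have [vU|vU] := boolP (v \in e1 :|: e2); last first.
  by apply: phig; rewrite ?vU ?orbT //= (inj_eq inj_s).
by rewrite !eqphi // g0.
Qed.

(** [D] is not asked to lie in [H]: fresh [r]-sets of unknown colour serve as links between two
    given sets. *)
Definition carrier i x y (D : {set 'I_n}) :=
  [/\ #|D| = r, x \in D, y \in D, x != y & [/\ P x = i, P y = i, x \in G & y \in G]].

(** This spends the slack that [big] leaves beyond the greedy embedding: four light neighbourhoods
    and ten [r]-sets can be avoided. *)
Lemma pick_generic i (Z : {set 'I_n}) : #|Z| <= 4 * d.+1 + 10 * r ->
  exists2 z, z \in part P i :&: G & z \notin Z.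
Proof.
move=> cZ; apply/subsetPn; apply: contraTN (big i) => /subset_leq_card le; rewrite -leqNgt.
by apply: leq_trans le _; apply: leq_trans cZ _; nia.
Qed.

Lemma carrierC i x y D : carrier i x y D -> carrier i y x D.
Proof. by case=> cD xD yD xy [Px Py xG yG]; split=> //; rewrite eq_sym. Qed.

(** All four endpoints have one colour, so they go to the same part and no heavy pair is needed
    among them. *)
Lemma same_color_disjoint i x y x' y' D D' a1 c1 a2 c2 :
  e1 = [set a1; c1] -> e2 = [set a2; c2] -> a1 != c1 -> a2 != c2 -> e1 :&: e2 = set0 ->
  f a1 = f a2 ->
  carrier i x y D -> carrier i x' y' D' -> D :&: D' = set0 -> col D = col D'.
Proof.
move=> de1 de2 ac1 ac2 disj fa [cD xD yD xy [Px Py xG yG]] [cD' xD' yD' xy' [Px' Py' xG' yG']] dD.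
have nD z z' : z \in D -> z' \in D' -> z' != z.
  move=> zD zD'; apply: contraTneq isT => eq; have : z \in D :&: D' by rewrite inE zD -eq.
  by rewrite dD inE.
have n12 u v : u \in e1 -> v \in e2 -> v == u = false.
  move=> u1 v2; apply/eqP=> eq; have : u \in e1 :&: e2 by rewrite inE u1 -eq.
  by rewrite disj inE.
have [a11 c11 a22 c22] : [/\ a1 \in e1, c1 \in e1, a2 \in e2 & c2 \in e2].
  by rewrite de1 de2 !inE !eqxx !orbT.
pose phi0 v := if v == a1 then x else if v == c1 then y else if v == a2 then x' else y'.
have pa1 : phi0 a1 = x by rewrite /phi0 eqxx.
have pc1 : phi0 c1 = y by rewrite /phi0 eq_sym (negPf ac1) eqxx.
have pa2 : phi0 a2 = x' by rewrite /phi0 (n12 a1 a2) // (n12 c1 a2) // eqxx.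
have pc2 : phi0 c2 = y' by rewrite /phi0 (n12 a1 c2) // (n12 c1 c2) // eq_sym (negPf ac2).
have eU u : u \in e1 :|: e2 -> [\/ u = a1, u = c1, u = a2 | u = c2].
  rewrite in_setU de1 de2 => /orP[] /set2P[] ->;
  by [constructor 1|constructor 2|constructor 3|constructor 4].
apply: (@same_color phi0 (tperm (f a1) i)) => //.
- exact: perm_inj.
- move=> u v /eU[] -> /eU[] ->; rewrite ?pa1 ?pa2 ?pc1 ?pc2 //.
  + by move=> eq; rewrite eq eqxx in xy.
  + by move=> eq; have := nD x x' xD xD'; rewrite eq eqxx.
  + by move=> eq; have := nD x y' xD yD'; rewrite eq eqxx.
  + by move=> eq; rewrite eq eqxx in xy.
  + by move=> eq; have := nD y x' yD xD'; rewrite eq eqxx.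
  + by move=> eq; have := nD y y' yD yD'; rewrite eq eqxx.
  + by move=> eq; have := nD x x' xD xD'; rewrite eq eqxx.
  + by move=> eq; have := nD y x' yD xD'; rewrite eq eqxx.
  + by move=> eq; rewrite eq eqxx in xy'.
  + by move=> eq; have := nD x y' xD yD'; rewrite eq eqxx.
  + by move=> eq; have := nD y y' yD yD'; rewrite eq eqxx.
  + by move=> eq; rewrite eq eqxx in xy'.
- move=> u /eU[] ->; rewrite ?pa1 ?pa2 ?pc1 ?pc2.
  + by rewrite tpermL.
  + by rewrite (mono1 c11 a11) tpermL.
  + by rewrite -fa tpermL.
  + by rewrite (mono2 c22 a22) -fa tpermL.
- move=> u v uU vU; suff H' w : w \in e1 :|: e2 -> f w = f a1 by rewrite !H' ?eqxx.
  by move=> /eU[] -> //; rewrite ?(mono1 c11 a11) ?(mono2 c22 a22) // -fa.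
- by apply/subsetP=> z /imsetP[v]; rewrite de1 => /set2P[] -> ->; rewrite ?pa1 ?pc1.
- by apply/subsetP=> z /imsetP[v]; rewrite de2 => /set2P[] -> ->; rewrite ?pa2 ?pc2.
by rewrite dD sub0set.
Qed.

(** The common endpoint [a] is sent to [x], the only common vertex of the two sets. *)
Lemma same_color_sharing i x y y' D D' a c1 c2 :
  e1 = [set a; c1] -> e2 = [set a; c2] -> a != c1 -> a != c2 ->
  carrier i x y D -> carrier i x y' D' -> D :&: D' = [set x] -> col D = col D'.
Proof.
move=> de1 de2 ac1 ac2 [cD xD yD xy [Px Py xG yG]] [cD' xD' yD' xy' [_ Py' _ yG']] dD.
have c12 : c1 != c2 by apply: contraNneq e12 => eq; rewrite de1 de2 eq.
have yy' : y != y'.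
  apply: contraTneq isT => eq; have : y \in D :&: D' by rewrite inE yD eq.
  by rewrite dD inE eq_sym (negPf xy).
have [a1 c11 a2 c22] : [/\ a \in e1, c1 \in e1, a \in e2 & c2 \in e2].
  by rewrite de1 de2 !inE !eqxx !orbT.
pose phi0 v := if v == a then x else if v == c1 then y else y'.
have pa : phi0 a = x by rewrite /phi0 eqxx.
have pc1 : phi0 c1 = y by rewrite /phi0 eq_sym (negPf ac1) eqxx.
have pc2 : phi0 c2 = y' by rewrite /phi0 !(eq_sym c2) (negPf ac2) (negPf c12).
have eU u : u \in e1 :|: e2 -> [\/ u = a, u = c1 | u = c2].
  rewrite in_setU de1 de2 => /orP[] /set2P[] ->;
  by [constructor 1|constructor 2|constructor 3].
have fU u : u \in e1 :|: e2 -> f u = f a.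
  by move=> /eU[] ->; rewrite ?(mono1 c11 a1) ?(mono2 c22 a2).
apply: (@same_color phi0 (tperm (f a) i)) => //.
- exact: perm_inj.
- move=> u v /eU[] -> /eU[] ->; rewrite ?pa ?pc1 ?pc2 // => eq; exfalso.
  + by rewrite eq eqxx in xy.
  + by rewrite eq eqxx in xy'.
  + by rewrite eq eqxx in xy.
  + by rewrite eq eqxx in yy'.
  + by rewrite eq eqxx in xy'.
  + by rewrite eq eqxx in yy'.
- by move=> u uU; rewrite fU // tpermL; case/eU: uU => ->; rewrite ?pa ?pc1 ?pc2.
- by move=> u v uU vU; rewrite !fU ?eqxx.
- by apply/subsetP=> z /imsetP[v]; rewrite de1 => /set2P[] -> ->; rewrite ?pa ?pc1.
- by apply/subsetP=> z /imsetP[v]; rewrite de2 => /set2P[] -> ->; rewrite ?pa ?pc2.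
by rewrite dD sub1set -pa; apply: imset_f; rewrite inE a1.
Qed.

(** The edges have different colours, so they go to different parts; the four pairs between them may
    be edges of [F] and must be heavy. *)
Lemma same_color_cross i j x y x' y' D D' a1 c1 a2 c2 :
  e1 = [set a1; c1] -> e2 = [set a2; c2] -> a1 != c1 -> a2 != c2 -> f a1 != f a2 ->
  i != j -> carrier i x y D -> carrier j x' y' D' ->
  D :&: D' = set0 -> [&& g x x', g x y', g y x' & g y y'] -> col D = col D'.
Proof.
move=> de1 de2 ac1 ac2 fa ij [cD xD yD xy [Px Py xG yG]] [cD' xD' yD' xy' [Px' Py' xG' yG']] dD.
move=> /and4P[g1 g2 g3 g4].
have nD z z' : z \in D -> z' \in D' -> z' != z.
  move=> zD zD'; apply: contraTneq isT => eq; have : z \in D :&: D' by rewrite inE zD -eq.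
  by rewrite dD inE.
have [a11 c11 a22 c22] : [/\ a1 \in e1, c1 \in e1, a2 \in e2 & c2 \in e2].
  by rewrite de1 de2 !inE !eqxx !orbT.
have f1 u : u \in e1 -> f u = f a1 by move=> ue; apply: mono1.
have f2 u : u \in e2 -> f u = f a2 by move=> ue; apply: mono2.
have n12 u v : u \in e1 -> v \in e2 -> v == u = false.
  by move=> u1 v2; apply: contraNF fa => /eqP eq; rewrite -(f1 u) // -(f2 v) // eq.
pose phi0 v := if v == a1 then x else if v == c1 then y else if v == a2 then x' else y'.
have pa1 : phi0 a1 = x by rewrite /phi0 eqxx.
have pc1 : phi0 c1 = y by rewrite /phi0 eq_sym (negPf ac1) eqxx.
have pa2 : phi0 a2 = x' by rewrite /phi0 (n12 a1 a2) // (n12 c1 a2) // eqxx.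
have pc2 : phi0 c2 = y' by rewrite /phi0 (n12 a1 c2) // (n12 c1 c2) // eq_sym (negPf ac2).
have eU u : u \in e1 :|: e2 -> [\/ u = a1, u = c1, u = a2 | u = c2].
  rewrite in_setU de1 de2 => /orP[] /set2P[] ->;
  by [constructor 1|constructor 2|constructor 3|constructor 4].
(* [c] is the place of [f a2] after the first transposition. As [i] differs from [c] and [j], the
   second transposition fixes [i] while carrying [c] to [j]. *)
pose c := tperm (f a1) i (f a2).
have ci : i != c by rewrite -(tpermL (f a1) i) (inj_eq perm_inj).
pose sigma t := tperm c j (tperm (f a1) i t).
have s1 : sigma (f a1) = i.
  by rewrite /sigma tpermL tpermD // eq_sym.
have s2 : sigma (f a2) = j by rewrite /sigma tpermL.
apply: (@same_color phi0 sigma) => //.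
- by move=> t t' /perm_inj /perm_inj.
- move=> u v /eU[] -> /eU[] ->; rewrite ?pa1 ?pa2 ?pc1 ?pc2 //.
  + by move=> eq; rewrite eq eqxx in xy.
  + by move=> eq; have := nD x x' xD xD'; rewrite eq eqxx.
  + by move=> eq; have := nD x y' xD yD'; rewrite eq eqxx.
  + by move=> eq; rewrite eq eqxx in xy.
  + by move=> eq; have := nD y x' yD xD'; rewrite eq eqxx.
  + by move=> eq; have := nD y y' yD yD'; rewrite eq eqxx.
  + by move=> eq; have := nD x x' xD xD'; rewrite eq eqxx.
  + by move=> eq; have := nD y x' yD xD'; rewrite eq eqxx.
  + by move=> eq; rewrite eq eqxx in xy'.
  + by move=> eq; have := nD x y' xD yD'; rewrite eq eqxx.
  + by move=> eq; have := nD y y' yD yD'; rewrite eq eqxx.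
  + by move=> eq; rewrite eq eqxx in xy'.
- by move=> u /eU[] ->; rewrite ?(f1 c1) ?(f2 c2) // ?s1 ?s2 ?pa1 ?pa2 ?pc1 ?pc2.
- have gC z z' : g z z' -> g z' z by rewrite /g heavyC.
  move=> u v /eU[] -> /eU[] ->; rewrite ?(f1 c1) ?(f2 c2) ?eqxx //
    ?pa1 ?pa2 ?pc1 ?pc2 // => _; exact: gC.
- by apply/subsetP=> z /imsetP[v]; rewrite de1 => /set2P[] -> ->; rewrite ?pa1 ?pc1.
- by apply/subsetP=> z /imsetP[v]; rewrite de2 => /set2P[] -> ->; rewrite ?pa2 ?pc2.
by rewrite dD sub0set.
Qed.

Let n_big : 10 * r <= n.
Proof.
have k0 : 0 < k by apply: leq_trans rk; apply: leq_trans r4.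
rewrite -[n]card_ord; apply: leq_trans (max_card (part P (Ordinal k0) :&: G)).
by apply: leq_trans (ltnW (big _)); rewrite leq_addl.
Qed.

Lemma pick2_generic i (Z : {set 'I_n}) : #|Z| <= 4 * d.+1 + 9 * r ->
  exists z z', [/\ z != z', z \in part P i :&: G, z' \in part P i :&: G, z \notin Z & z' \notin Z].
Proof.
move=> cZ; have [z zi zZ] : exists2 z, z \in part P i :&: G & z \notin Z.
  by apply: pick_generic; apply: leq_trans cZ _; rewrite leq_add2l leq_mul2r orbT.
have [z' zi' ] : exists2 z', z' \in part P i :&: G & z' \notin z |: Z.
  apply: pick_generic; rewrite cardsU1.
  apply: (@leq_trans (1 + (4 * d.+1 + 9 * r))); last by clear cZ; lia.
  by apply: leq_add => //; case: (_ \notin _).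
rewrite in_setU1 negb_or => /andP[zz' zZ'].
by exists z, z'; rewrite eq_sym.
Qed.

(* If [e1] and [e2] are disjoint, one fresh [r]-set [E] links [b1] to [b2]; if they
   share a vertex, the chain is [b1 - D1 - E - D2 - b2] with consecutive sets
   meeting in exactly one vertex. *)
Lemma same_color_carriers i j x1 y1 x2 y2 b1 b2 :
  carrier i x1 y1 b1 -> carrier j x2 y2 b2 -> col b1 = col b2.
Proof.
move=> B1 B2; have [cb1 xb1 yb1 xy1 [Px1 Py1 xG1 yG1]] := B1.
have [cb2 xb2 yb2 xy2 [Px2 Py2 xG2 yG2]] := B2.
have cbb : #|b1 :|: b2| <= r + r by apply: cardsU_le; rewrite ?cb1 ?cb2.
have /cards2P[a1 [c1 [ac1 de1]]] : #|e1| == 2 by rewrite F2.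
have /cards2P[a2 [c2 [ac2 de2]]] : #|e2| == 2 by rewrite F2.
have notin0 (A B Q Z : {set 'I_n}) : A :&: Z \subset Q -> B \subset Z -> Q :&: B = set0 -> A :&: B = set0.
  move=> /subsetP sAZ /subsetP sBZ QB; apply/setP=> z; rewrite !inE; apply/negP=> /andP[zA zB].
  have : z \in Q :&: B by rewrite inE zB sAZ // inE zA sBZ.
  by rewrite QB inE.
have [fa|fa] := eqVneq (f a1) (f a2); last first.
  (* When [e1] and [e2] have different colours the link goes through a part [m] distinct from [i]
     and [j], which exists because [k >= 4]. *)
  have [m [mi mj]] : exists m : 'I_k, i != m /\ j != m.
    have /subsetPn[m _] : ~~ ([set: 'I_k] \subset [set i; j]).
      apply/negP=> /subset_leq_card; rewrite cardsT card_ord cards2.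
      by move: (leq_trans r4 rk); clear; case: (_ != _); lia.
    by rewrite !inE negb_or ![m == _]eq_sym => /andP[]; exists m.
  (* Avoiding [L] makes the new vertices of part [m] heavily joined to [x1], [y1], [x2] and [y2]. *)
  pose L := light_in P g x1 m :|: light_in P g y1 m :|: light_in P g x2 m :|: light_in P g y2 m.
  have cL : #|L| <= d + d + d + d.
    by rewrite !cardsU_le // genericP ?Px1 ?Py1 ?Px2 ?Py2 // eq_sym.
  have [z [z' [zz' zm zm' zZ zZ']]] : exists z z', [/\ z != z', z \in part P m :&: G,
      z' \in part P m :&: G, z \notin L :|: (b1 :|: b2) & z' \notin L :|: (b1 :|: b2)].
    by apply: pick2_generic; apply: leq_trans (cardsU_le cL cbb) _; clear; lia.
  have [Pz zG] : P z = m /\ z \in G by move: zm; rewrite !inE => /andP[/eqP].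
  have [Pz' zG'] : P z' = m /\ z' \in G by move: zm'; rewrite !inE => /andP[/eqP].
  have gz w : w \in part P m :&: G -> w \notin L :|: (b1 :|: b2) ->
      [/\ g x1 w, g y1 w, g x2 w, g y2 w & w \notin b1 :|: b2].
    move=> /setIP[wm _]; have /eqP Pw : P w == m by move: wm; rewrite inE.
    rewrite in_setU negb_or => /andP[wL ->]; move: wL.
    by rewrite /L !inE Pw eqxx /= !negb_or !negbK => /andP[/andP[/andP[]]].
  have [gx1 gy1 gx2 gy2 zb] := gz z zm zZ.
  have [gx1' gy1' gx2' gy2' zb'] := gz z' zm' zZ'.
  have [E [cE sE dE]] : exists D : {set 'I_n}, [/\ #|D| = r, [set z; z'] \subset D & D :&: (b1 :|: b2) \subset [set z; z']].
    apply: extend_rset; first by rewrite cards2; case: (_ != _); apply: leq_trans r4.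
    by rewrite card_ord; apply: leq_trans n_big; apply: (@leq_trans (r + r + r)); [rewrite leq_add2r|clear; lia].
  have carE : carrier m z z' E.
    by split=> //; apply: (subsetP sE); rewrite ?set21 ?set22.
  have dEb (b : {set 'I_n}) : b \subset b1 :|: b2 -> b :&: E = set0.
    move=> sb; rewrite setIC; apply: (notin0 _ _ _ _ dE sb).
    apply/setP=> w; rewrite !inE; apply/negP=> /andP[/orP[]/eqP-> wb].
      by rewrite (subsetP sb _ wb) in zb.
    by rewrite (subsetP sb _ wb) in zb'.
  transitivity (col E).
    apply: (same_color_cross de1 de2 ac1 ac2 fa mi B1 carE); first by rewrite dEb ?subsetUl.
    by rewrite gx1 gx1' gy1 gy1'.
  apply/esym; apply: (same_color_cross de1 de2 ac1 ac2 fa mj B2 carE); first by rewrite dEb ?subsetUr.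
  by rewrite gx2 gx2' gy2 gy2'.
have [z1 [z1' [zz1 zi1 zi1' zb1 zb1']]] : exists z z', [/\ z != z', z \in part P i :&: G, z' \in part P i :&: G, z \notin b1 :|: b2 & z' \notin b1 :|: b2].
  by apply: pick2_generic; apply: leq_trans cbb _; clear; lia.
have [z2 [z2' [zz2 zj2 zj2' zb2 zb2']]] : exists z z', [/\ z != z', z \in part P j :&: G, z' \in part P j :&: G, z \notin [set z1; z1'] :|: (b1 :|: b2) & z' \notin [set z1; z1'] :|: (b1 :|: b2)].
  apply: pick2_generic; apply: leq_trans (cardsU_le (leqnn _) cbb) _; rewrite cards2.
  by move: r4; clear; case: (_ != _); lia.
(* As [r >= 4], a single [r]-set can contain [Q] and thus be a carrier for [i] and for [j]
   simultaneously. *)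
pose Q := [set z1; z1'; z2; z2'].
have cQ : #|Q| <= r by apply: leq_trans r4; apply: cards4_le.
have Pgen m w : w \in part P m :&: G -> P w = m /\ w \in G by rewrite !inE => /andP[/eqP].
have [[Pz1 Gz1] [Pz1' Gz1']] := (Pgen _ _ zi1, Pgen _ _ zi1').
have [[Pz2 Gz2] [Pz2' Gz2']] := (Pgen _ _ zj2, Pgen _ _ zj2').
have [z1b1 z1b2] : z1 \notin b1 /\ z1 \notin b2 by apply/andP; rewrite -negb_or -in_setU.
have [z1b1' z1b2'] : z1' \notin b1 /\ z1' \notin b2 by apply/andP; rewrite -negb_or -in_setU.
move: zb2 zb2'; rewrite !in_setU !in_set1 !negb_or.
move=> /andP[/andP[z21 z21'] /andP[z2b1 z2b2]] /andP[/andP[z2'1 z2'1'] /andP[z2b1' z2b2']].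
have QP w : w \in Q -> [\/ w = z1, w = z1', w = z2 | w = z2'].
  rewrite !inE -!orbA => /or4P[] /eqP ->;
  by [constructor 1|constructor 2|constructor 3|constructor 4].
have [Qz1 Qz1' Qz2 Qz2'] : [/\ z1 \in Q, z1' \in Q, z2 \in Q & z2' \in Q].
  by rewrite !inE !eqxx !orbT.
have [disj|[a ae]] := set_0Vmem (e1 :&: e2).
  have [E [cE sE dE]] : exists D : {set 'I_n}, [/\ #|D| = r, Q \subset D & D :&: (b1 :|: b2) \subset Q].
    apply: extend_rset => //.
    by rewrite card_ord; apply: leq_trans n_big; apply: (@leq_trans (r + r + r)); [rewrite leq_add2r|clear; lia].
  have carE1 : carrier i z1 z1' E by split=> //; apply: (subsetP sE).
  have carE2 : carrier j z2 z2' E by split=> //; apply: (subsetP sE).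
  transitivity (col E).
    apply: (same_color_disjoint de1 de2 ac1 ac2 disj fa B1 carE1).
    rewrite setIC; apply: (notin0 _ _ _ _ dE (subsetUl _ _)).
    apply/setP=> w; rewrite [RHS]inE in_setI; apply/negP=> /andP[/QP[]->].
    + by rewrite (negPf z1b1).
    + by rewrite (negPf z1b1').
    + by rewrite (negPf z2b1).
    + by rewrite (negPf z2b1').
  apply/esym; apply: (same_color_disjoint de1 de2 ac1 ac2 disj fa B2 carE2).
  rewrite setIC; apply: (notin0 _ _ _ _ dE (subsetUr _ _)).
  apply/setP=> w; rewrite [RHS]inE in_setI; apply/negP=> /andP[/QP[]->].
  + by rewrite (negPf z1b2).
  + by rewrite (negPf z1b2').
  + by rewrite (negPf z2b2).
  + by rewrite (negPf z2b2').
have other (e : {set V}) : #|e| = 2 -> a \in e -> exists2 c, a != c & e = [set a; c].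
  move=> ce aE; have /cards2P[u [v [uv de]]] : #|e| == 2 by rewrite ce.
  move: aE; rewrite de => /set2P[] ->; [by exists v|by exists u; rewrite 1?eq_sym // setUC].
have [ae1 ae2] := setIP ae.
have [c1' ac1' {}de1] := other e1 (F2 e1F) ae1.
have [c2' ac2' {}de2] := other e2 (F2 e2F) ae2.
pose Z := Q :|: (b1 :|: b2).
have cZ : #|Z| <= 3 * r by apply: leq_trans (cardsU_le cQ cbb) _; clear; lia.
have ext x z : z \in Q -> exists D : {set 'I_n}, [/\ #|D| = r, [set x; z] \subset D & D :&: Z \subset [set x; z]].
  move=> zQ; apply: extend_rset; first by rewrite cards2; case: (_ != _); apply: leq_trans r4.
  by rewrite card_ord; apply: leq_trans n_big; apply: (@leq_trans (3 * r + r)); [rewrite leq_add2r|clear; lia].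
(* [D1] is fresh except for [x1] and [z1]: it meets [b1] only in [x1], and will meet [E] only in
   [z1]. [D2] plays the same role for [b2]. *)
have [D1 [cD1 sD1 dD1]] := ext x1 z1 Qz1.
have [D2 [cD2 sD2 dD2]] := ext x2 z2 Qz2.
have [E [cE sE dE]] : exists D : {set 'I_n}, [/\ #|D| = r, Q \subset D & D :&: (D1 :|: D2) \subset Q].
  apply: extend_rset => //; rewrite card_ord; apply: leq_trans n_big.
  apply: (@leq_trans (r + r + r)); last by clear; lia.
  by rewrite leq_add2r; apply: cardsU_le; rewrite ?cD1 ?cD2.
have xz1 w : w \notin b1 -> x1 != w /\ y1 != w.
  by move=> wb; split; apply: contraNneq wb => <-.
have xz2 w : w \notin b2 -> x2 != w /\ y2 != w.
  by move=> wb; split; apply: contraNneq wb => <-.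
have carD1 : carrier i x1 z1 D1.
  by split=> //; [apply: (subsetP sD1); rewrite set21|apply: (subsetP sD1); rewrite set22|case: (xz1 z1 z1b1)].
have carD2 : carrier j x2 z2 D2.
  by split=> //; [apply: (subsetP sD2); rewrite set21|apply: (subsetP sD2); rewrite set22|case: (xz2 z2 z2b2)].
have carE1 : carrier i z1 z1' E by split=> //; apply: (subsetP sE).
have carE2 : carrier j z2 z2' E by split=> //; apply: (subsetP sE).
have capD (b D : {set 'I_n}) x z : b \subset b1 :|: b2 -> x \in b -> z \notin b -> [set x; z] \subset D ->
    D :&: Z \subset [set x; z] -> b :&: D = [set x].
  move=> sb xb zb sD /subsetP dD; apply/setP=> w; rewrite in_set1; apply/setIP/eqP => [[wb wD]|->].
    have : w \in [set x; z].
      by apply: dD; rewrite inE wD in_setU (subsetP sb) ?orbT.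
    by case/set2P=> // wz; rewrite -wz wb in zb.
  by split=> //; apply: (subsetP sD); rewrite set21.
have capE (b D : {set 'I_n}) x z : D \subset D1 :|: D2 -> x \in b -> b \subset b1 :|: b2 -> z \in Q ->
   {in Q, forall w, w \notin b} -> [set x; z] \subset D -> D :&: Z \subset [set x; z] -> D :&: E = [set z].
  move=> sD xb sb zQ Qb sxD /subsetP dD; apply/setP=> w; rewrite in_set1; apply/setIP/eqP => [[wD wE]|->].
    have wQ : w \in Q by apply: (subsetP dE); rewrite inE wE (subsetP sD).
    have : w \in [set x; z] by apply: dD; rewrite inE wD in_setU wQ.
    by case/set2P=> // wx; have := Qb w wQ; rewrite wx xb.
  by split; [apply: (subsetP sxD); rewrite set22|apply: (subsetP sE)].
have Qb1 : {in Q, forall w, w \notin b1} by move=> w /QP[] ->.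
have Qb2 : {in Q, forall w, w \notin b2} by move=> w /QP[] ->.
have step1 : col b1 = col D1.
  apply: (same_color_sharing de1 de2 ac1' ac2' B1 carD1).
  exact: (capD _ _ _ z1 (subsetUl _ _)).
have step2 : col b2 = col D2.
  apply: (same_color_sharing de1 de2 ac1' ac2' B2 carD2).
  exact: (capD _ _ _ z2 (subsetUr _ _)).
have step3 : col D1 = col E.
  apply: (same_color_sharing de1 de2 ac1' ac2' (carrierC carD1) carE1).
  exact: (capE b1 _ x1 z1 (subsetUl _ _) _ (subsetUl _ _)).
have step4 : col D2 = col E.
  apply: (same_color_sharing de1 de2 ac1' ac2' (carrierC carD2) carE2).
  exact: (capE b2 _ x2 z2 (subsetUr _ _) _ (subsetUr _ _)).
by rewrite step1 step3 -step4 step2.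
Qed.

End NoRainbow.

(** * Blow-ups in dense relations *)

Section BlowUp.
Variable t : nat.

(** Unfolded: there are [q] injective families of [t] points such that [R] holds for every choice of
    one point from each family. *)
Fixpoint blown_up (X : finType) (q : nat) (R : pred (seq X)) : Prop :=
  if q is q'.+1 then
    exists2 Y : {ffun 'I_t -> X}, injective Y & blown_up q' [pred s | [forall j, R (Y j :: s)]]
  else R [::].

Lemma ffact_ge_exp m : (m - t) ^ t <= m ^_ t.
Proof.
have gen l : l <= t -> (m - t) ^ l <= m ^_ l.
  elim: l => // l IH lt; rewrite ffactnSr expnSr.
  by apply: leq_mul; [apply: IH (ltnW lt)|apply: leq_sub2l (ltnW lt)].
exact: gen.
Qed.

(** Induction on the length of the tuples. Many tails admit many first entries; by averaging, some
    [t] distinct first entries are common to a positive proportion of the tails, and the induction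
    hypothesis applies to those. *)
Lemma dense_blown_up (q K : nat) : exists N, forall (X : finType) (R : pred (seq X)),
  N <= #|X| -> #|X| ^ q <= K * #|[set s : q.-tuple X | R s]| -> blown_up q R.
Proof.
elim: q K => [|q IH] K.
  exists 0 => X R _; rewrite expn0 muln_gt0 => /andP[_ /card_gt0P[s]].
  by rewrite inE tuple0.
(* The new inverse density: a proportion [1 / (2 K)] of the tails is rich, and a rich tail admits a
   proportion at least [1 / (4 K) ^ t] of the maps [Y]. *)
have [N0 HN0] := IH (2 * K * (4 * K) ^ t).
exists (maxn N0 (4 * K * t).+1) => X R; rewrite geq_max => /andP[n0 nK] dense.
set n := #|X| in n0 nK dense.
have n_gt0 : 0 < n by apply: leq_trans nK.
pose N (s : q.-tuple X) := [set x | R (x :: s)].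
pose S := [set s : q.-tuple X | n <= 2 * K * #|N s|].
have cards : #|[set s : q.+1.-tuple X | R s]| <= \sum_(s : q.-tuple X) #|N s|.
  rewrite -sum1_card (partition_big (fun s : q.+1.-tuple X => [tuple of behead s]) xpredT) //=.
  apply: leq_sum => s' _; rewrite sum1dep_card.
  have inj_h : {in [set s : q.+1.-tuple X | (s \in [set s : q.+1.-tuple X | R s]) &&
       ([tuple of behead s] == s')] &, injective (@thead q X)}.
    move=> s1 s2; rewrite !inE => /andP[_ /eqP/(congr1 val) /= e1] /andP[_ /eqP/(congr1 val) /= e2] eqh.
    apply: val_inj; case/tupleP: s1 e1 eqh => x1 s1; case/tupleP: s2 e2 => x2 s2.
    by rewrite !theadE /= => -> -> ->.
  rewrite -(card_in_imset inj_h); apply/subset_leq_card/subsetP=> x /imsetP[s].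
  rewrite !inE => /andP[Rs /eqP/(congr1 val) /= e1] ->.
  by case/tupleP: s Rs e1 => y s Rs; rewrite theadE /= => <-.
(* Tails outside [S] account for at most half of the tuples assumed to satisfy [R], and each tail in
   [S] for at most [n] of them. *)
have cS : n ^ q <= 2 * K * #|S|.
  rewrite -(leq_pmul2r n_gt0) -expnSr.
  have le1 : \sum_(s : q.-tuple X) #|N s| <= #|S| * n + \sum_(s in ~: S) #|N s|.
    rewrite (bigID (mem S)) /= leq_add //; last by rewrite leq_eqVlt; apply/orP; left; apply/eqP; apply: eq_bigl => s; rewrite in_setC.
    by rewrite -sum_nat_const; apply: leq_sum => s _; apply: max_card.
  have le2 : 2 * K * \sum_(s in ~: S) #|N s| <= n ^ q.+1.
    rewrite big_distrr /=; apply: (@leq_trans (\sum_(s in ~: S) n)).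
      by apply: leq_sum => s; rewrite !inE -ltnNge; apply: ltnW.
    by rewrite sum_nat_const expnSr leq_mul2r -card_tuple max_card orbT.
  by move: dense le1 le2 cards; clear; nia.
have cN s : s \in S -> n ^ t <= (4 * K) ^ t * #|N s| ^_ t.
  rewrite inE => nN; apply: (@leq_trans ((4 * K) ^ t * (#|N s| - t) ^ t)); last first.
    by rewrite leq_mul2l ffact_ge_exp orbT.
  rewrite -expnMn; have mono a b : a <= b -> a ^ t <= b ^ t.
    by move=> ab; elim: t => // l IHl; rewrite !expnS leq_mul.
  by apply: mono; move: nK nN; clear; nia.
pose RY (Y : {ffun 'I_t -> X}) := [set s : q.-tuple X | [forall j, R (Y j :: s)]].
(* Double counting of the pairs formed by an injective [Y] and a tail compatible with all its
   values. *)
have sumRY : \sum_(Y : {ffun 'I_t -> X} | injectiveb Y) #|RY Y| = \sum_(s : q.-tuple X) #|N s| ^_ t.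
  transitivity (\sum_(Y : {ffun 'I_t -> X} | injectiveb Y) \sum_(s : q.-tuple X) ([forall j, R (Y j :: s)] : nat)).
    apply: eq_bigr => Y _; rewrite -sum1_card -big_mkcondl; apply: eq_bigl => s.
    by rewrite inE andbT.
  rewrite exchange_big /=; apply: eq_bigr => s _.
  have := card_inj_ffuns_on 'I_t (mem (N s)); rewrite card_ord => <-.
  rewrite -sum1_card -big_mkcondr.
  apply: eq_bigl => Y; rewrite !inE andbC; congr (_ && _).
  apply/forallP/ffun_onP => RYs j; first by rewrite inE.
  by have := RYs j; rewrite inE.
have [/existsP[Y /andP[/injectiveP injY cY]]|] := boolP [exists Y : {ffun 'I_t -> X},
    injectiveb Y && (n ^ q <= 2 * K * (4 * K) ^ t * #|RY Y|)].
  by exists Y => //; apply: HN0.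
rewrite negb_exists => /forallP noY; exfalso.
have le1 : 2 * K * (4 * K) ^ t * \sum_(Y : {ffun 'I_t -> X} | injectiveb Y) #|RY Y| <= n ^ t * (n ^ q).-1.
  rewrite big_distrr /=.
  apply: (@leq_trans (\sum_(Y : {ffun 'I_t -> X} | injectiveb Y) (n ^ q).-1)).
    by apply: leq_sum => Y injY; have := noY Y; rewrite injY /= -ltnNge; case: (n ^ q).
  rewrite sum_nat_const leq_mul2r; apply/orP; right.
  by apply: leq_trans (max_card _) _; rewrite card_ffun card_ord.
have le2 : #|S| * n ^ t <= (4 * K) ^ t * \sum_(s : q.-tuple X) #|N s| ^_ t.
  rewrite (bigID (mem S)) /= mulnDr; apply: leq_trans (leq_addr _ _).
  rewrite big_distrr /= -sum_nat_const; exact: leq_sum.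
have nt : 0 < n ^ t by rewrite expn_gt0 n_gt0.
have nq : 0 < n ^ q by rewrite expn_gt0 n_gt0.
rewrite -sumRY in le2; move: cS le1 le2 nt nq; clear.
set T := \sum_(Y | _) _; set A := n ^ t; set B := n ^ q; set D := (4 * K) ^ t.
move=> h1 h2 h3 h4 h5.
have : B * A <= 2 * K * (D * T).
  by apply: leq_trans (_ : 2 * K * #|S| * A <= _); rewrite ?leq_mul2r ?h1 ?orbT // -mulnA leq_mul2l h3 orbT.
rewrite mulnA mulnC => /leq_trans /(_ h2); rewrite leq_pmul2l //.
by move: h5; clear; case: B => // b _; rewrite ltnn.
Qed.

(** The families are indexed by [nat] for convenience; [x0] only fills those of index at least
    [q]. *)
Lemma blown_up_family (X : finType) (x0 : X) (q : nat) (R : pred (seq X)) : blown_up q R ->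
  exists Y : nat -> 'I_t -> X, (forall i, i < q -> injective (Y i)) /\
    forall c : nat -> 'I_t, R (mkseq (fun i => Y i (c i)) q).
Proof.
elim: q R => [|q IH] R /=.
  by move=> R0; exists (fun _ _ => x0).
move=> [Y injY /IH[Z [injZ RZ]]].
pose W (i : nat) : 'I_t -> X := if i is i'.+1 then Z i' else Y.
exists W; split=> [[|i]|c] //; first exact: injZ.
have /forallP/(_ (c 0)) := RZ (fun i => c i.+1).
suff -> : mkseq (fun i => W i (c i)) q.+1 =
  Y (c 0) :: mkseq (fun i => Z i (c i.+1)) q by [].
by rewrite /mkseq /= (iotaDl 1 0) -map_comp.
Qed.

End BlowUp.

(** * Clique counts and the Moon-Moser inequality *)

Lemma sum_nat_sqr_le (T : finType) (K : {set T}) (d : T -> nat) :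
  (\sum_(i in K) d i) ^ 2 <= #|K| * \sum_(i in K) d i ^ 2.
Proof.
rewrite -(leq_pmul2l (isT : 0 < 2)) -mulnn big_distrlr /= big_distrr /=.
apply: (@leq_trans (\sum_(i in K) \sum_(j in K) (d i ^ 2 + d j ^ 2))).
  apply: leq_sum => i _; rewrite big_distrr /=; apply: leq_sum => j _.
  exact: nat_Cauchy.
rewrite (eq_bigr (fun i => #|K| * d i ^ 2 + \sum_(j in K) d j ^ 2)); last first.
  by move=> i _; rewrite big_split /= sum_nat_const.
by rewrite big_split /= -big_distrr /= sum_nat_const mul2n -addnn.
Qed.

Section Cliques.
Variables (X : finType) (g : rel X).
Hypotheses (g_sym : symmetric g) (g_irr : irreflexive g).
Implicit Types A B : {set X}.

Definition clique A := [forall x in A, forall y in A, (x != y) ==> g x y].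
Definition cliques s : {set {set X}} := [set A : {set X} | (#|A| == s) && clique A].
Definition ext A := [set v | [forall x in A, g v x]].

Lemma cliqueP A : reflect {in A &, forall x y, x != y -> g x y} (clique A).
Proof.
apply: (iffP forall_inP) => [h x y xA yA|h x xA].
  by move/forall_inP: (h x xA) => /(_ y yA) /implyP.
by apply/forall_inP=> y yA; apply/implyP; apply: h.
Qed.

Lemma extP A v : reflect {in A, forall x, g v x} (v \in ext A).
Proof. by rewrite inE; apply: (iffP forall_inP). Qed.

Lemma ext_notin A v : v \in ext A -> v \notin A.
Proof. by move=> /extP vA; apply/negP=> /vA; rewrite g_irr. Qed.

Lemma clique_ext A v : v \in ext A -> clique (v |: A) = clique A.
Proof.
move=> /extP vA; apply/cliqueP/cliqueP => cA x y xA yA xy.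
  by apply: cA; rewrite ?in_setU1 ?xA ?yA ?orbT.
move: xA yA xy; rewrite !in_setU1 => /orP[/eqP->|xA] /orP[/eqP->|yA].
- by rewrite eqxx.
- by move=> _; apply: vA.
- by move=> _; rewrite g_sym; apply: vA.
- exact: cA.
Qed.

(** The basic double counting of clique extensions: [(A, v)] with [v] joined to all of [A]
    corresponds to [(B, v)] with [v] in the clique [B = v |: A]. *)
Lemma sum_ext s (E : {set X} -> X -> nat) :
  \sum_(A in cliques s) \sum_(v in ext A) E A v =
  \sum_(B in cliques s.+1) \sum_(v in B) E (B :\ v) v.
Proof.
rewrite (pair_big_dep _ (fun A v => v \in ext A)) /=.
rewrite (pair_big_dep _ (fun B v => v \in B)) /=.
rewrite (reindex_onto (fun p : {set X} * X => (p.1 :\ p.2, p.2))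
   (fun p : {set X} * X => (p.2 |: p.1, p.2))) /=; last first.
  by move=> [A v] /= /andP[_ /ext_notin vA]; rewrite setU1K.
apply: eq_bigl => -[B v] /=; apply/andP/andP => [[/andP[Bv vB] /eqP[eqB]]|[cB vB]].
  split; last by rewrite -eqB setU11.
  move: Bv; rewrite !inE -(clique_ext vB) eqB => /andP[/eqP cB ->].
  by rewrite (cardsD1 v B) cB -{1}eqB setU11 eqxx.
rewrite setD1K // eqxx; split=> //.
have vext : v \in ext (B :\ v).
  apply/extP=> x /setD1P[xv xB]; move: cB; rewrite inE => /andP[_ /cliqueP].
  by apply; rewrite // eq_sym.
rewrite vext andbT; move: cB; rewrite !inE -(clique_ext vext) setD1K // => /andP[/eqP cB ->].
by rewrite andbT -eqSS -cB (cardsD1 v B) vB.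
Qed.

Lemma sum_card_ext s : \sum_(A in cliques s) #|ext A| = s.+1 * #|cliques s.+1|.
Proof.
under eq_bigr => A _ do rewrite -sum1_card.
rewrite (sum_ext s (fun _ _ => 1)) mulnC -sum_nat_const; apply: eq_bigr => B.
by rewrite inE sum1_card => /andP[/eqP ->].
Qed.

Lemma sum_ext_link s :
  \sum_(A in cliques s.+1) \sum_(a in A) #|ext (A :\ a)| = \sum_(B in cliques s) #|ext B| ^ 2.
Proof.
by rewrite -(sum_ext s (fun B _ => #|ext B|)); apply: eq_bigr => B _; rewrite sum_nat_const mulnn.
Qed.

(** For nonempty [A], these are the vertices with at least two non-neighbours in [A], a vertex of
    [A] being a non-neighbour of itself. *)
Definition uncovered A := [set v | [forall a in A, v \notin ext (A :\ a)]].

(* A vertex outside [ext A] lies in [ext (A :\ a)] for at most one [a]. *)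
Lemma ext_link_le A : 0 < #|A| ->
  \sum_(a in A) #|ext (A :\ a)| + #|uncovered A| <= #|X| + #|A|.-1 * #|ext A|.
Proof.
move=> A0.
have -> : \sum_(a in A) #|ext (A :\ a)| = \sum_(v : X) \sum_(a in A) (v \in ext (A :\ a) : nat).
  rewrite exchange_big /=; apply: eq_bigr => a _; rewrite -sum1_card big_mkcond /=.
  by apply: eq_bigr => v _; case: (_ \in _).
have -> : #|X| + #|A|.-1 * #|ext A| = \sum_(v : X) (1 + #|A|.-1 * (v \in ext A)).
  rewrite big_split /= -big_distrr /= sum1_card; congr (_ + _ * _).
  by rewrite -sum1_card big_mkcond; apply: eq_bigr => v _; case: (_ \in _).
rewrite -[#|uncovered A|]sum1_card [X in _ + X]big_mkcond -big_split /=.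
apply: leq_sum => v _; case: ifPn => [|_].
  rewrite inE => /forall_inP vU; rewrite big1 ?leq_addr // => a aA.
  by rewrite (negPf (vU a aA)).
rewrite addn0; have [vA|vA] := boolP (v \in ext A).
  rewrite muln1 add1n prednK // -sum1_card; apply: leq_sum => a _.
  by case: (_ \in _).
rewrite muln0 addn0 -big_mkcondr /= sum1dep_card.
apply/card_le1_eqP => a b; rewrite !inE => /andP[aA /forall_inP va] /andP[bA /forall_inP vb].
apply: contraNeq vA => ab; apply/extP=> x xA.
have [xa|xa] := eqVneq x a; last by apply: va; rewrite in_setD1 xa.
by apply: vb; rewrite in_setD1 xA xa eq_sym ab.
Qed.

(** Cauchy-Schwarz is applied to the numbers of extensions of the cliques of order [s]. The sum of
    their squares is regrouped over cliques of order [s.+1] and bounded there by [ext_link_le]. *)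
Lemma moon_moser s :
  (s.+1 * #|cliques s.+1|) ^ 2 <=
  #|cliques s| * (#|X| * #|cliques s.+1| + s * (s.+2 * #|cliques s.+2|)).
Proof.
rewrite -sum_card_ext; apply: leq_trans (sum_nat_sqr_le _ _) _.
rewrite leq_mul2l; apply/orP; right; rewrite -sum_ext_link.
rewrite -sum_card_ext big_distrr /= mulnC -sum_nat_const -big_split /=.
apply: leq_sum => A; rewrite inE => /andP[/eqP cA _].
by have := ext_link_le (A := A); rewrite cA => /(_ isT) /(leq_trans (leq_addr _ _)).
Qed.

(** Twice the number of edges of [g] inside the common neighbourhood of [A]. *)
Definition inner A := \sum_(u in ext A) #|[set v in ext A | g u v]|.

Lemma innerE A : inner A = \sum_(u in ext A) #|ext (u |: A)|.
Proof.
apply: eq_bigr => u uA; apply: eq_card => v; rewrite !inE.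
apply/andP/forall_inP => [[/forall_inP vA guv] x|vuA].
  by rewrite in_setU1 => /orP[/eqP->|]; [rewrite g_sym|apply: vA].
split; first by apply/forall_inP=> x xA; apply: vuA; rewrite in_setU1 xA orbT.
by rewrite g_sym; apply: vuA; rewrite setU11.
Qed.

Lemma sum_inner s : \sum_(B in cliques s) inner B = s.+1 * (s.+2 * #|cliques s.+2|).
Proof.
under eq_bigr => B _ do rewrite innerE.
rewrite (sum_ext s (fun B u => #|ext (u |: B)|)) -sum_card_ext big_distrr /=.
apply: eq_bigr => A; rewrite inE => /andP[/eqP cA _].
by rewrite -{1}cA -sum_nat_const; apply: eq_bigr => u uA; rewrite setD1K.
Qed.

(** Regrouped over [B = A :\ a], each [inner B] occurs [#|ext B|] times, hence at most [#|X|]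
    times. *)
Lemma sum_inner_link s :
  \sum_(A in cliques s.+1) \sum_(a in A) inner (A :\ a) <= #|X| * (s.+1 * (s.+2 * #|cliques s.+2|)).
Proof.
rewrite -(sum_ext s (fun B _ => inner B)) -sum_inner big_distrr /=; apply: leq_sum => B _.
by rewrite sum_nat_const leq_mul2r max_card orbT.
Qed.

Lemma cliques0 : #|cliques 0| = 1.
Proof.
rewrite (_ : cliques 0 = [set set0]) ?cards1 //; apply/setP=> A; rewrite !inE cards_eq0.
by case: eqP => //= ->; apply/cliqueP=> x y; rewrite inE.
Qed.

Lemma sum_degree : \sum_(x : X) #|[set y | g x y]| = 2 * #|cliques 2|.
Proof.
have := sum_inner 0; rewrite mul1n => <-.
have e0 : cliques 0 = [set set0].
  apply/setP=> A; rewrite !inE cards_eq0.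
  by case: eqP => //= ->; apply/cliqueP=> x y; rewrite inE.
rewrite e0 big_set1 /inner.
have -> : ext set0 = setT by apply/setP=> x; rewrite !inE; apply/forall_inP=> y; rewrite inE.
by apply: eq_big => [x|x _]; rewrite ?inE //; apply: eq_card => y; rewrite !inE.
Qed.

Lemma cliques_le_exp s : s`! * #|cliques s| <= #|X| ^ s.
Proof.
elim: s => [|s IH]; first by rewrite cliques0 mul1n.
rewrite factS mulnAC -sum_card_ext [X in X <= _]mulnC expnS.
apply: (@leq_trans (s`! * (#|X| * #|cliques s|))); last first.
  by rewrite mulnCA leq_mul2l IH orbT.
rewrite leq_mul2l; apply/orP; right; rewrite mulnC -sum_nat_const.
by apply: leq_sum => A _; apply: max_card.
Qed.

End Cliques.

(** * Nearly tight Moon-Moser sequences *)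

Section Chain.
Local Open Scope ring_scope.
Variables (R : realFieldType) (k r : nat).
Hypotheses (r2 : (2 <= r)%N) (rk : (r <= k)%N).
Implicit Types (y : nat -> R) (eta eps : R) (s : nat).

(* [turan_density s] is the limit of [s! * #cliques of order s / n^s] in the
   balanced complete [k]-partite graph on [n] vertices. *)
Definition turan_ratio s : R := 1 - s%:R / k%:R.
Definition turan_density s : R := \prod_(i < s) turan_ratio i.

(** The last clause is the Moon-Moser inequality rewritten for the densities
    [s! * #cliques / n ^ s]. *)
Definition moon_moser_seq y := [/\ y 0%N = 1, forall s, 0 <= y s <= 1 &
  forall s, s.+1%:R * y s.+1 ^+ 2 <= y s * (y s.+1 + s%:R * y s.+2)].

(** [eps] is uniform in [y]. Closure under conjunction and consequence then replaces explicit
    bookkeeping of the errors. *)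
Definition near_extremal (Q : (nat -> R) -> Prop) := exists2 eps, 0 < eps &
  forall y, moon_moser_seq y -> y k.+1 <= eps -> turan_density r - eps <= y r -> Q y.

Lemma near_and Q1 Q2 : near_extremal Q1 -> near_extremal Q2 ->
  near_extremal (fun y => Q1 y /\ Q2 y).
Proof.
move=> [e1 e1_gt0 h1] [e2 e2_gt0 h2].
exists (Num.min e1 e2) => [|y my]; first by rewrite lt_min e1_gt0.
rewrite le_min lerBlDr => /andP[l1 l2] l3; split; [apply: h1|apply: h2] => //.
  by rewrite lerBlDr; apply: le_trans l3 _; rewrite lerD2l ge_min lexx.
by rewrite lerBlDr; apply: le_trans l3 _; rewrite lerD2l ge_min lexx orbT.
Qed.

Lemma near_imp (Q1 Q2 : (nat -> R) -> Prop) :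
  (forall y, moon_moser_seq y -> Q1 y -> Q2 y) -> near_extremal Q1 -> near_extremal Q2.
Proof. by move=> h [e e_gt0 h1]; exists e => // y *; apply: h => //; apply: h1. Qed.

Let k_gt0 : 0 < k%:R :> R.
Proof. by rewrite ltr0n; apply: leq_trans rk; apply: leq_trans r2. Qed.

Lemma ratio_ge0 s : (s <= k)%N -> 0 <= turan_ratio s.
Proof. by move=> sk; rewrite subr_ge0 ler_pdivrMr // mul1r ler_nat. Qed.

Lemma ratio_ge s : (s < k)%N -> k%:R^-1 <= turan_ratio s.
Proof.
move=> sk; rewrite lerBrDr -{1}[k%:R^-1]mul1r -mulrDl ler_pdivrMr // mul1r.
by rewrite addrC natr1 ler_nat.
Qed.

Lemma ratio_le1 s : turan_ratio s <= 1.
Proof. by rewrite gerBl divr_ge0 ?ler0n // ltW. Qed.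

(** Equality in the Moon-Moser inequality for the Turan densities, divided by two consecutive
    densities. *)
Lemma ratioS s : s.+1%:R * turan_ratio s = 1 + s%:R * turan_ratio s.+1.
Proof. by rewrite /turan_ratio -natr1; field; rewrite gt_eqF. Qed.

Lemma ratio_k : turan_ratio k = 0.
Proof. by rewrite /turan_ratio divff ?subrr // gt_eqF. Qed.

Lemma turan_densityS s : turan_density s.+1 = turan_ratio s * turan_density s.
Proof. by rewrite /turan_density big_ord_recr mulrC. Qed.

Lemma turan_density_bounds s : (s <= k)%N -> 0 < turan_density s <= 1.
Proof.
elim: s => [|s IH] sk; first by rewrite /turan_density big_ord0 ltr01 lexx.
have /andP[Y0 Y1] := IH (ltnW sk); rewrite turan_densityS.
have r0 : 0 < turan_ratio s by apply: lt_le_trans (ratio_ge sk); rewrite invr_gt0.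
by rewrite mulr_gt0 //= mulr_ile1 ?ratio_le1 // ltW.
Qed.

Lemma turan_density_anti s j : (s + j <= k)%N -> turan_density (s + j) <= turan_density s.
Proof.
elim: j => [|j IH] sk; first by rewrite addn0.
rewrite addnS in sk *; apply: le_trans (IH (ltnW sk)); rewrite turan_densityS.
have /andP[Y0 _] := turan_density_bounds (ltnW sk).
by apply: ler_piMl; [apply: ltW|apply: ratio_le1].
Qed.

(** Descending induction from [s = k], where [turan_ratio k = 0] and the claim is the smallness of
    [y k.+1]. An upper bound on one ratio of consecutive terms gives, through Moon-Moser, an upper
    bound on the preceding ratio. *)
Lemma near_ratio_le s eta : (s <= k)%N -> 0 < eta ->
  near_extremal (fun y => y s.+1 <= turan_ratio s * y s + eta).
Proof.
move=> sk; rewrite -(subKn sk); move: (k - s)%N (leq_subr s k) => j.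
elim: j eta => [|j IH] eta jk eta0.
  by exists eta => // y my le _; rewrite subn0 ratio_k mul0r add0r.
have /IH : (j <= k)%N by apply: ltnW.
(* The error is squared because the inequality reached is [x ^+ 2 <= b * x * z + eta ^+ 2], which is
   incompatible with [x > b * z + eta]. *)
move=> /(_ (eta ^+ 2)) []; first by rewrite exprn_gt0.
rewrite subnS; have : (0 < k - j)%N by rewrite subn_gt0.
case: (k - j)%N (leq_subr j k) => // m mk _ /= e e0 h.
exists e => // y my yk yr; have le2 := h y my yk yr.
have [_ y01 /(_ m) mm] := my.
have /andP[ym0 ym1] := y01 m; have /andP[ys0 ys1] := y01 m.+1.
rewrite leNgt; apply/negP=> lt.
have rm0 : 0 <= turan_ratio m by apply: ratio_ge0; apply: ltnW.
have m0 : 0 <= m%:R :> R by apply: ler0n.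
have mS : m.+1%:R = m%:R + 1 :> R by rewrite natr1.
have := ratioS m; rewrite mS => rS.
rewrite mS in mm.
set x := y m.+1 in lt le2 ys0 ys1 mm *; set z := y m in lt mm ym0 ym1 *.
set a := turan_ratio m.+1 in le2 rS *; set b := turan_ratio m in lt rS rm0 *.
have h1 : m%:R * y m.+2 <= m%:R * (a * x + eta ^+ 2) by apply: ler_wpM2l.
have h2 : z * (x + m%:R * y m.+2) <= z * (x + m%:R * (a * x + eta ^+ 2)).
  by apply: ler_wpM2l => //; rewrite lerD2l.
have h3 : z * (x + m%:R * (a * x + eta ^+ 2)) = (m%:R + 1) * (b * x * z) + m%:R * eta ^+ 2 * z.
  rewrite (_ : z * _ = x * z * (1 + m%:R * a) + m%:R * eta ^+ 2 * z); last by ring.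
  by rewrite -rS; ring.
have h4 : m%:R * eta ^+ 2 * z <= (m%:R + 1) * eta ^+ 2.
  apply: (@le_trans _ _ (m%:R * eta ^+ 2)).
    by apply: ler_piMr => //; rewrite mulr_ge0 // exprn_ge0 // ltW.
  by apply: ler_wpM2r; [rewrite exprn_ge0 // ltW|rewrite lerDl].
have h5 : x ^+ 2 <= b * x * z + eta ^+ 2.
  have m1 : 0 < m%:R + 1 :> R by rewrite ltr_wpDl.
  rewrite -(ler_pM2l m1) mulrDr.
  apply: le_trans mm _; apply: le_trans h2 _; rewrite h3.
  by rewrite lerD2l.
have x_eta : eta < x by apply: le_lt_trans lt; rewrite lerDr mulr_ge0.
have : x * (b * z + eta) < x * x by rewrite ltr_pM2l // (lt_trans eta0).
have : eta * eta < x * eta by rewrite ltr_pM2r.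
by move: h5; rewrite !expr2; lra.
Qed.

Lemma near_density_le s eta : (s <= k.+1)%N -> 0 < eta ->
  near_extremal (fun y => y s <= turan_density s + eta).
Proof.
elim: s eta => [|s IH] eta sk eta0.
  exists 1 => // y [y0 _ _] _ _; rewrite y0 /turan_density big_ord0; lra.
have e2 : 0 < eta / 2 by rewrite divr_gt0.
have := near_and (near_ratio_le sk e2) (IH _ (ltnW sk) e2).
apply: near_imp => y _ [h1 h2]; rewrite turan_densityS.
have h3 : turan_ratio s * y s <= turan_ratio s * (turan_density s + eta / 2).
  by apply: ler_wpM2l => //; apply: ratio_ge0.
have h4 : turan_ratio s * (eta / 2) <= eta / 2 by apply: ler_piMl; [apply: ltW|apply: ratio_le1].
by rewrite mulrDr in h3; lra.
Qed.

(** Descending induction from [r]: the upper bound on the ratio converts a lower bound on [y m.+1]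
    into one on [y m]. The division by [turan_ratio m >= 1 / k] explains the error
    [eta / (2 * k)]. *)
Lemma near_density_ge s eta : (s <= r)%N -> 0 < eta ->
  near_extremal (fun y => turan_density s - eta <= y s).
Proof.
move=> sr; rewrite -(subKn sr); move: (r - s)%N (leq_subr s r) => j.
elim: j eta => [|j IH] eta jr eta0.
  by exists eta => // y _ _; rewrite subn0.
have := IH (eta / (2 * k%:R)) (ltnW jr).
have e0 : 0 < eta / (2 * k%:R) by rewrite divr_gt0 // mulr_gt0.
move=> /(_ e0); rewrite subnS; have : (0 < r - j)%N by rewrite subn_gt0.
case: (r - j)%N (leq_subr j r) => // m mr _ /= near1.
have mk : (m < k)%N by apply: leq_trans rk.
have := near_and near1 (near_ratio_le (ltnW mk) e0).
apply: near_imp => y _ [h1 h2].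
have rk1 := ratio_ge mk; have r0 : 0 < turan_ratio m by apply: lt_le_trans rk1; rewrite invr_gt0.
rewrite turan_densityS in h1.
have h3 : turan_ratio m * (turan_density m - y m) <= eta / k%:R.
  rewrite mulrBr; have -> : eta / k%:R = eta / (2 * k%:R) + eta / (2 * k%:R).
    by field; rewrite gt_eqF.
  by move: h1 h2; set w := eta / _; lra.
rewrite lerBlDr -lerBlDl leNgt; apply/negP=> h4.
have h5 : turan_ratio m * eta < turan_ratio m * (turan_density m - y m) by rewrite ltr_pM2l.
have h6 : k%:R^-1 * eta <= turan_ratio m * eta by rewrite ler_pM2r.
by move: h3; rewrite mulrC; lra.
Qed.

(** Ascending induction from [r] to [k]: a lower bound on one ratio gives, through Moon-Moser, a
    lower bound on the next. Since [r >= 2], the inequality is used only for [s >= 1], where the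
    term in [y s.+2] is present. *)
Lemma near_lower j eta : (j + r <= k)%N -> 0 < eta ->
  near_extremal (fun y => [/\ turan_density (j + r).-1 - eta <= y (j + r).-1,
    turan_density (j + r) - eta <= y (j + r)%N &
    turan_ratio (j + r).-1 * y (j + r).-1 - eta <= y (j + r)%N]).
Proof.
have r0 : (0 < r)%N by apply: leq_trans r2.
elim: j eta => [|j IH] eta jk eta0.
  rewrite add0n; have e2 : 0 < eta / 2 by rewrite divr_gt0.
  have r1k : (r.-1 <= k.+1)%N by rewrite (leq_trans (leq_pred r)) // ltnW.
  have := near_and (near_density_ge (leq_pred r) e2) (near_and (near_density_ge (leqnn r) e2)
           (near_density_le r1k e2)).
  apply: near_imp => y _ [h1 [h2 h3]]; split; [lra|lra|].
  have /= := turan_densityS r.-1; rewrite prednK // => tS.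
  have r0' : 0 <= turan_ratio r.-1 by apply: ratio_ge0; apply: leq_trans (leq_pred r) rk.
  have h4 : turan_ratio r.-1 * y r.-1 <= turan_ratio r.-1 * (turan_density r.-1 + eta / 2) by apply: ler_wpM2l.
  have h5 : turan_ratio r.-1 * (eta / 2) <= eta / 2 by apply: ler_piMl; [apply: ltW|apply: ratio_le1].
  by rewrite mulrDr -tS in h4; lra.
(* [c] keeps [y s] away from zero, as Moon-Moser is about to be divided by it. *)
set c := turan_density k / 2.
have /andP[Yk0 Yk1] := turan_density_bounds (leqnn k).
have c0 : 0 < c by rewrite divr_gt0.
have e0 : 0 < Num.min c (eta * c / 4) by rewrite lt_min c0 divr_gt0 // mulr_gt0.
have := IH _ (ltnW jk) e0; rewrite addSn /=.
have : (0 < j + r)%N by rewrite addn_gt0 r0 orbT.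
move: jk; rewrite addSn; have : (1 < j + r)%N by apply: leq_trans (leq_addl _ _).
case: (j + r)%N => // s s1 sk _ /=.
set e := Num.min c _ in e0 *.
have ec : e <= c by rewrite ge_min lexx.
have ee : e <= eta * c / 4 by rewrite ge_min lexx orbT.
apply: near_imp => y [y0 y01 mm] [h1 h2 h3].
have mm' := mm s.
have /andP[a0 a1] := y01 s; have /andP[b0 b1] := y01 s.+1; have /andP[d0 d1] := y01 s.+2.
have Ys : turan_density k <= turan_density s.
  have := @turan_density_anti s (k - s); rewrite subnKC; first by apply.
  by apply: ltnW; apply: ltnW.
have ys : c <= y s by move: h1 Ys ec; rewrite /c; lra.
have sR : 1 <= s%:R :> R by rewrite ler1n.
have rS := ratioS s; rewrite -natr1 in rS mm'.
rewrite (turan_densityS s.+1).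
set x := y s.+2 in mm' d0 d1 *; set z := y s.+1 in mm' h2 h3 b0 b1 *; set w := y s in mm' h1 h3 a0 a1 ys *.
set p := turan_ratio s in h3 rS *; set q := turan_ratio s.+1 in rS *.
have q1 : q <= 1 by apply: ratio_le1.
have q0 : 0 <= q by apply: ratio_ge0; apply: ltnW.
have k1 : (s%:R + 1) * (p * w - e) * z <= (s%:R + 1) * z * z.
  rewrite -!mulrA ler_pM2l; last by lra.
  by apply: ler_wpM2r.
have k2 : - ((s%:R + 1) * e) <= s%:R * w * (x - q * z).
  have -> : s%:R * w * (x - q * z) = w * (z + s%:R * x) - w * z * (1 + s%:R * q) by ring.
  rewrite -rS.
  have : (s%:R + 1) * e * z <= (s%:R + 1) * e by apply: ler_piMr => //; rewrite mulr_ge0 //; lra.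
  move: mm' k1; rewrite expr2.
  have -> : w * z * ((s%:R + 1) * p) = (s%:R + 1) * (p * w) * z by ring.
  have -> : (s%:R + 1) * (p * w - e) * z = (s%:R + 1) * (p * w) * z - (s%:R + 1) * e * z by ring.
  rewrite mulrA; lra.
have k3 : q * z - eta / 2 <= x.
  rewrite leNgt; apply/negP=> lt.
  have l1 : eta / 2 < q * z - x by lra.
  have l2 : s%:R * w * (eta / 2) <= s%:R * w * (q * z - x).
    by apply: ler_wpM2l; [rewrite mulr_ge0 //; lra|apply: ltW].
  have l3 : s%:R * c * (eta / 2) <= s%:R * w * (eta / 2).
    by apply: ler_wpM2r; [lra|apply: ler_wpM2l; [lra|]].
  have l4 : (s%:R + 1) * e <= (s%:R + 1) * (eta * c / 4) by apply: ler_wpM2l => //; lra.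
  have l5 : 1 * (eta * c) <= s%:R * (eta * c) by apply: ler_wpM2r => //; rewrite mulr_ge0 ?ltW.
  have l6 : s%:R * w * (eta / 2) < s%:R * w * (q * z - x).
    by rewrite ltr_pM2l // mulr_gt0 //; lra.
  move: k2 l3 l4 l5 l6.
  have -> : s%:R * c * (eta / 2) = s%:R * (eta * c) / 2 by ring.
  have -> : (s%:R + 1) * (eta * c / 4) = s%:R * (eta * c) / 4 + eta * c / 4 by ring.
  have -> : s%:R * w * (x - q * z) = - (s%:R * w * (q * z - x)) by ring.
  lra.
have ec' : eta * c <= eta by apply: ler_piMr; [apply: ltW|rewrite /c; lra].
have k4 : q * (turan_density s.+1 - e) <= q * z by apply: ler_wpM2l.
have k5 : q * e <= e by apply: ler_piMl; [apply: ltW|].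
by rewrite mulrBr in k4; split; lra.
Qed.

(** The bounds needed for stability: the edge density for the size of the cut, the term [y k] for
    the existence of cliques of order [k], and the last ratio for the sum of squared extension
    numbers. *)
Lemma near_extremal_conclusion eta : 0 < eta -> near_extremal (fun y =>
  [/\ turan_density 2 - eta <= y 2%N, turan_density k - eta <= y k &
      k%:R^-1 * y k.-1 - eta <= y k]).
Proof.
move=> eta0; have := near_lower (j := k - r) (eta := eta); rewrite subnK // => /(_ (leqnn k) eta0) nl.
have := near_and nl (near_density_ge r2 eta0); apply: near_imp => y _ [[_ h1 h2] h3]; split=> //.
have -> // : k%:R^-1 = turan_ratio k.-1.
rewrite /turan_ratio; have k0 : (0 < k)%N by rewrite -(ltr0n R).
have -> : k.-1%:R = k%:R - 1 :> R by rewrite -[in RHS](prednK k0) -natr1 addrK.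
by field; rewrite gt_eqF.
Qed.

End Chain.

(** * Partitions from cliques and maximum cuts *)

Section Cuts.
Variables (X : finType) (g : rel X).
Hypotheses (g_sym : symmetric g) (g_irr : irreflexive g).

(** Here and below pairs are ordered, so each edge counts twice. *)
Definition inside (I : finType) (P : X -> I) := [set q : X * X | (P q.1 == P q.2) && g q.1 q.2].
Definition cut (I : finType) (P : X -> I) := [set q : X * X | (P q.1 != P q.2) && g q.1 q.2].
Definition light_cross (I : finType) (P : X -> I) := [set q : X * X | (P q.1 != P q.2) && ~~ g q.1 q.2].
Definition neighbours_in (I : finType) (P : X -> I) w i := [set z | (P z == i) && g w z].

Lemma sum_card_pairs (E : rel X) : #|[set q : X * X | E q.1 q.2]| = \sum_x #|[set y | E x y]|.
Proof.
rewrite -sum1dep_card -(pair_big_dep xpredT E (fun _ _ => 1)) /=.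
by apply: eq_bigr => x _; rewrite sum1dep_card.
Qed.

Lemma card_inside_cut (I : finType) (P : X -> I) :
  #|inside P| + #|cut P| = 2 * #|cliques g 2|.
Proof.
rewrite -sum_degree // -(sum_card_pairs g) -(cardsID [set q : X * X | P q.1 == P q.2] [set q : X * X | g q.1 q.2]).
by congr (_ + _); apply: eq_card => q; rewrite !inE // andbC.
Qed.

Lemma card_cut_light (I : finType) (P : X -> I) :
  #|cut P| + #|light_cross P| + \sum_i #|part P i| ^ 2 = #|X| ^ 2.
Proof.
have -> : \sum_i #|part P i| ^ 2 = #|[set q : X * X | P q.1 == P q.2]|.
  rewrite (sum_card_pairs (fun x y => P x == P y)) (partition_big P xpredT) //=.
  apply: eq_bigr => i _; rewrite -mulnn -sum_nat_const.
  rewrite (eq_bigl (fun x => P x == i)); last by move=> x; rewrite inE.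
  by apply: eq_bigr => x /eqP ->; apply: eq_card => y; rewrite !inE eq_sym.
have -> : #|X| ^ 2 = #|[set: X * X]| by rewrite cardsT card_prod mulnn.
rewrite -(cardsID [set q : X * X | P q.1 == P q.2] setT) setTI addnC; congr (_ + _).
rewrite -(cardsID [set q : X * X | g q.1 q.2] (setT :\: _)).
by congr (_ + _); apply: eq_card => q; rewrite !inE ?andbT // andbC.
Qed.

(** A vertex joined to all of [A] but possibly [a] is put in the class of [a]. An edge inside a
    class then lies in the common neighbourhood of [A :\ a], unless it touches an uncovered
    vertex. *)
Lemma stable_partition k (A : {set X}) : 0 < k -> #|A| = k ->
  exists P : X -> 'I_k, #|inside P| <= \sum_(a in A) inner g (A :\ a) + 2 * #|X| * #|uncovered g A|.
Proof.
move=> k0 cA; have /card_gt0P[a0 a0A] : 0 < #|A| by rewrite cA.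
(* Uncovered vertices go to the class of [a0]. *)
pose P' v := if [pick a in A | v \in ext g (A :\ a)] is Some a then a else a0.
have P'A v : P' v \in A by rewrite /P'; case: pickP => // a /andP[].
have P'ext v : v \notin uncovered g A -> v \in ext g (A :\ P' v).
  rewrite inE negb_forall_in => /exists_inP[a aA]; rewrite negbK => va.
  by rewrite /P'; case: pickP => [b /andP[]|/(_ a)] //; rewrite aA va.
pose P v := cast_ord cA (enum_rank_in a0A (P' v)).
have PP' u v : (P u == P v) = (P' u == P' v).
  apply/eqP/eqP => [/cast_ord_inj eq|eq]; last by rewrite /P eq.
  by rewrite -(enum_rankK_in a0A (P'A u)) eq enum_rankK_in.
exists P; pose U := uncovered g A.
pose S a := [set q : X * X | [&& q.1 \in ext g (A :\ a), q.2 \in ext g (A :\ a) & g q.1 q.2]].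
have cS a : #|S a| = inner g (A :\ a).
  rewrite (sum_card_pairs (fun x y => [&& x \in ext g (A :\ a), y \in ext g (A :\ a) & g x y])).
  rewrite /inner [RHS]big_mkcond; apply: eq_bigr => x _; case: ifP => xA.
    by apply: eq_card => y; rewrite [LHS]inE [RHS]inE.
  by rewrite -(cards0 X); apply: eq_card => y; rewrite !inE.
have sub : inside P \subset \bigcup_(a in A) S a :|: (setX U setT :|: setX setT U).
  apply/subsetP=> -[u v]; rewrite !in_setU !in_setX !in_setT andbT /= inE /= PP' => /andP[/eqP euv guv].
  have [uU|uU] := boolP (u \in U); first by rewrite orbT.
  have [vU|vU] := boolP (v \in U); first by rewrite !orbT.
  rewrite !orbF; apply/bigcupP; exists (P' u) => //.
  by rewrite inE /= guv P'ext // euv P'ext.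
apply: leq_trans (subset_leq_card sub) _; apply: leq_trans (leq_card_setU _ _) _; apply: leq_add.
  under [X in _ <= X]eq_bigr => a _ do rewrite -cS.
  elim/big_rec2: _ => [|i m' W iJ IH]; first by rewrite cards0.
  by apply: leq_trans (leq_card_setU _ _) _; rewrite leq_add2l.
apply: leq_trans (leq_card_setU _ _) _; rewrite !cardsX cardsT -/U.
by rewrite mulnC -mulnA mul2n -addnn.
Qed.

Section MaxCut.
Variable I : finType.

(** In a maximum cut, moving [w] to part [j] cannot enlarge the cut, and only the pairs containing
    [w] are affected by the move. *)
Lemma max_cut (P0 : X -> I) : exists P : {ffun X -> I}, #|cut P0| <= #|cut P| /\
  forall w j, #|neighbours_in P w (P w)| <= #|neighbours_in P w j|.
Proof.
pose Q0 := [ffun x => P0 x].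
have -> : cut P0 = cut Q0 by apply/setP=> q; rewrite !inE !ffunE.
have [P _ maxP] := @arg_maxnP _ Q0 xpredT (fun P : {ffun X -> I} => #|cut P|) isT.
exists P; split=> [|w j]; first exact: maxP.
have [<-//|jw] := eqVneq (P w) j.
pose P' := [ffun x => if x == w then j else P x].
have := maxP P' isT.
pose rest := [set q : X * X | [&& q.1 != w, q.2 != w, P q.1 != P q.2 & g q.1 q.2]].
have split_cut (Q : {ffun X -> I}) : (forall x, x != w -> Q x = P x) ->
    #|cut Q| = #|rest| + 2 * #|[set z | (Q z != Q w) && g w z]|.
  move=> QP; set N := [set z | _].
  have -> : cut Q = rest :|: (setX [set w] N :|: setX N [set w]).
    apply/setP=> -[u v]; rewrite !in_setU !in_setX !in_set1 !inE /=.
    have [->|uw] := eqVneq u w; have [->|vw] := eqVneq v w; rewrite /= ?g_irr ?andbF ?orbF //=.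
    - by rewrite eq_sym.
    - by rewrite ?andbT [g u w]g_sym.
    - by rewrite !QP.
  rewrite cardsU cardsU !cardsX cards1.
  have -> : setX [set w] N :&: setX N [set w] = set0.
    apply/setP=> -[u v]; rewrite !inE /=; apply/negP=> /andP[/andP[_ /andP[h _]] /andP[_ /eqP vw]].
    by rewrite vw eqxx in h.
  have -> : rest :&: (setX [set w] N :|: setX N [set w]) = set0.
    apply/setP=> -[u v]; rewrite in_setI in_setU !in_setX !in_set1 in_set0 in_set /=.
    by apply/negP=> /andP[/and4P[/negPf-> /negPf-> _ _]]; rewrite andbF.
  by rewrite cards0 !subn0 mul1n muln1 mul2n addnn.
rewrite (split_cut P) // (split_cut P') => [|x /negPf xw]; last by rewrite ffunE xw.
rewrite /geq /= leq_add2l leq_pmul2l // => le.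
have deg (Q : {ffun X -> I}) : #|[set z | (Q z != Q w) && g w z]| + #|[set z | (Q z == Q w) && g w z]| = #|[set z | g w z]|.
  rewrite addnC -(cardsID [set z | Q z == Q w] [set z | g w z]).
  by congr (_ + _); apply: eq_card => z; rewrite !inE // andbC.
have -> : neighbours_in P w j = [set z | (P' z == P' w) && g w z].
  apply/setP=> z; rewrite !inE !ffunE eqxx.
  by case: (eqVneq z w) => [->|//]; rewrite g_irr !andbF.
by rewrite /neighbours_in -(leq_add2l #|[set z | (P z != P w) && g w z]|) deg -(deg P') leq_add2r.
Qed.

End MaxCut.
End Cuts.

(** * Stability *)

Section Stability.
Local Open Scope ring_scope.

Lemma exists_ge_average (R : realFieldType) (T : finType) (K : {set T}) (E : T -> R) M :
  (0 < #|K|)%N -> M * #|K|%:R <= \sum_(i in K) E i -> exists2 i, i \in K & M <= E i.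
Proof.
move=> /card_gt0P[i0 i0K] le; apply/exists_inP; apply: contraT.
rewrite negb_exists_in => /forall_inP lt.
suff : \sum_(i in K) E i < \sum_(i in K) M by rewrite sumr_const -mulr_natr ltNge le.
apply: ltr_sum => [|i iK]; first by apply/hasP; exists i0; rewrite ?mem_index_enum.
by rewrite ltNge lt.
Qed.

(** * Averaging over cliques *)

Section GoodClique.
Variables (R : realFieldType) (X : finType) (g : rel X).
Hypotheses (g_sym : symmetric g) (g_irr : irreflexive g).
Let n : R := #|X|%:R.
Let K s : R := #|cliques g s|%:R.

Definition clique_density s : R := s`!%:R * K s / n ^+ s.

Hypothesis n_gt0 : 0 < n.

Lemma cliquesE s : K s = clique_density s * n ^+ s / s`!%:R.
Proof.
rewrite /clique_density divfK ?expf_neq0 ?gt_eqF // mulrC mulKf //.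
by rewrite pnatr_eq0 -lt0n fact_gt0.
Qed.

Lemma moon_moser_clique_density : moon_moser_seq clique_density.
Proof.
have f0 s : 0 < s`!%:R :> R by rewrite ltr0n fact_gt0.
split=> [|s|s].
- by rewrite /clique_density /K cliques0 fact0 expr0 mulr1 divr1.
- rewrite divr_ge0 ?mulr_ge0 ?ler0n ?exprn_ge0 ?ler0n //= ler_pdivrMr ?exprn_gt0 // mul1r.
  by rewrite /n /K -natrM -natrX ler_nat cliques_le_exp.
have mm := moon_moser g_sym g_irr s.
have {}mm : (s.+1%:R * K s.+1) ^+ 2 <= K s * (n * K s.+1 + s%:R * (s.+2%:R * K s.+2)).
  by rewrite /n /K -!(natrM, natrD, natrX) ler_nat.
have nE m : n ^+ m != 0 by rewrite expf_neq0 // gt_eqF.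
have nn : n != 0 by rewrite gt_eqF.
rewrite -subr_ge0.
have -> : clique_density s * (clique_density s.+1 + s%:R * clique_density s.+2) - s.+1%:R * clique_density s.+1 ^+ 2
  = s`!%:R * s.+1`!%:R / n ^+ s.+1 ^+ 2 * (K s * (n * K s.+1 + s%:R * (s.+2%:R * K s.+2)) - (s.+1%:R * K s.+1) ^+ 2).
  rewrite /clique_density !factS !natrM !exprS; field.
  by rewrite nn nE.
rewrite mulr_ge0 ?subr_ge0 // divr_ge0 ?exprn_ge0 ?mulr_ge0 //; exact: ltW.
Qed.

(** A single quantity, [L A - k * #|ext g A| - J A / n], is averaged so that one clique controls
    everything. Compared with [ext_link_le], it bounds the sum of [#|ext g A|], [J A / n] and
    [#|uncovered g A|] by [d * n]. *)
Lemma good_clique s (d1 d2 : R) : 0 < K s.+1 -> 0 <= d1 -> 0 <= d2 ->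
  (1 - d1) * n * K s.+1 <= (\sum_(B in cliques g s) #|ext g B| ^ 2)%N%:R ->
  s.+2%:R * K s.+2 <= d2 * n * K s.+1 ->
  let d := d1 + 2 * s.+1%:R * d2 in
  exists2 A, A \in cliques g s.+1 &
    (\sum_(a in A) inner g (A :\ a))%N%:R <= d * n ^+ 2 /\
    #|uncovered g A|%:R <= s.+1%:R * d * n.
Proof.
move=> K0 d10 d20 h1 h2 d; set k : R := s.+1%:R.
have k1 : 1 <= k by rewrite ler1n.
pose L (A : {set X}) := (\sum_(a in A) #|ext g (A :\ a)|)%N%:R : R.
pose J (A : {set X}) := (\sum_(a in A) inner g (A :\ a))%N%:R : R.
have sL : \sum_(A in cliques g s.+1) L A = (\sum_(B in cliques g s) #|ext g B| ^ 2)%N%:R.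
  by rewrite -sum_ext_link // natr_sum.
have sE : \sum_(A in cliques g s.+1) (#|ext g A|%:R : R) = s.+2%:R * K s.+2.
  by rewrite -natr_sum sum_card_ext // natrM.
have sJ : \sum_(A in cliques g s.+1) J A <= n * (k * (s.+2%:R * K s.+2)).
  by rewrite -natr_sum -!natrM ler_nat sum_inner_link.
have cK : (0 < #|cliques g s.+1|)%N by rewrite -(ltr0n R).
have [|A AK hA] := @exists_ge_average R _ _ (fun A => L A - k * #|ext g A|%:R - J A / n) ((1 - d) * n) cK.
  rewrite !sumrB -mulr_sumr -mulr_suml sL sE -/(K s.+1).
  have b1 : k * (s.+2%:R * K s.+2) <= k * (d2 * n * K s.+1) by apply: ler_wpM2l => //; lra.
  have b2 : (\sum_(A in cliques g s.+1) J A) / n <= k * (d2 * n * K s.+1).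
    rewrite ler_pdivrMr //; apply: le_trans sJ _; rewrite mulrC.
    by apply: ler_wpM2r => //; apply: ltW.
  have -> : (1 - d) * n * K s.+1 = (1 - d1) * n * K s.+1 - k * (d2 * n * K s.+1) - k * (d2 * n * K s.+1).
    by rewrite /d -/k; ring.
  lra.
exists A => //; have cA : #|A| = s.+1 by move: AK; rewrite inE => /andP[/eqP].
have := @ext_link_le X g A; rewrite cA => /(_ isT).
rewrite -(ler_nat R) !natrD natrM -/n -/(L A) /=.
set e : R := #|ext g A|%:R; set u : R := #|uncovered g A|%:R.
have e0 : 0 <= e by apply: ler0n.
have u0 : 0 <= u by apply: ler0n.
have kE : s%:R = k - 1 by rewrite /k -natr1 addrK.
rewrite kE => h3.
have J0 : 0 <= J A / n by rewrite divr_ge0 ?ler0n // ltW.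
have h4 : J A / n <= d * n by move: hA; rewrite -/e; lra.
have h5 : e <= d * n by move: hA; rewrite -/e; lra.
split; first by rewrite -/(J A) expr2 mulrA -ler_pdivrMr.
have : (k - 1) * e <= (k - 1) * (d * n) by apply: ler_wpM2l => //; lra.
have ke : 0 <= k * e by rewrite mulr_ge0 //; lra.
by move: hA; rewrite -/e; lra.
Qed.

End GoodClique.

(** A good clique of order [k] yields a partition with few inner edges, and a maximum cut is at
    least as large. The cut almost reaches the bound [(1 - 1 / k) * n ^+ 2], so few crossing pairs
    are light and the part sizes have small variance. *)
Theorem graph_stability (R : realFieldType) (k r : nat) (eta : R) :
  (2 <= r <= k)%N -> 0 < eta -> exists2 eps : R, 0 < eps &
  forall (X : finType) (g : rel X), symmetric g -> irreflexive g -> (0 < #|X|)%N ->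
    clique_density R g k.+1 <= eps ->
    turan_density R k r - eps <= clique_density R g r ->
    exists P : {ffun X -> 'I_k},
    [/\ forall w j, (#|neighbours_in g P w (P w)| <= #|neighbours_in g P w j|)%N,
        #|light_cross g P|%:R <= eta * #|X|%:R ^+ 2 &
        forall i, #|X|%:R <= 2 * k%:R * #|part P i|%:R :> R].
Proof.
move=> /andP[r2 rk] eta0.
have k2 : (2 <= k)%N := leq_trans r2 rk.
have kR : 2 <= k%:R :> R by rewrite ler_nat.
have k0 : 0 < k%:R :> R by lra.
have /andP[Yk0 Yk1] := turan_density_bounds R r2 rk (leqnn k).
set c := turan_density R k k / 2.
have c0 : 0 < c by rewrite divr_gt0.
(* The second bound limits the deviation of a part size from [n / k] to [n / (2 * k)]. *)
set tau := Num.min eta (1 / (4 * k%:R ^+ 2)).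
have tau0 : 0 < tau by rewrite lt_min eta0 divr_gt0 // mulr_gt0 // exprn_gt0.
set eta1 := Num.min c (tau * c / (4 * (2 * k%:R + 1))).
have m0 : 0 < 4 * (2 * k%:R + 1) :> R by lra.
have eta10 : 0 < eta1 by rewrite lt_min c0 divr_gt0 // mulr_gt0.
have [eps0 eps00 near] := near_extremal_conclusion r2 rk eta10.
set eps1 := tau * c / (8 * k%:R * (2 * k%:R + 1)).
have eps10 : 0 < eps1 by rewrite divr_gt0 ?mulr_gt0 //; lra.
exists (Num.min eps0 eps1) => [|X g g_sym g_irr X0]; first by rewrite lt_min eps00.
set n : R := #|X|%:R; have n0 : 0 < n by rewrite ltr0n.
rewrite le_min => /andP[yk1 yk2] yr.
have mm := moon_moser_clique_density g_sym g_irr n0.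
have [|y2 yk ykr] := near _ mm yk1.
  by apply: le_trans yr; rewrite lerD2l lerN2 ge_min lexx.
have etac : eta1 <= c by rewrite ge_min lexx.
have eta1t : eta1 <= tau * c / (4 * (2 * k%:R + 1)) by rewrite ge_min lexx orbT.
have ykc : c <= clique_density R g k by rewrite /c; move: yk etac; rewrite /c; lra.
case: k k2 kR k0 Yk0 Yk1 @c c0 @tau tau0 @eta1 m0 eta10 near @eps1 eps10 yk1 yk2 yr y2 yk ykr etac eta1t ykc rk => // s.
move=> k2 kR k0 Yk0 Yk1 c c0 tau tau0 eta1 m0 eta10 near eps1 eps10 yk1 yk2 yr y2 yk ykr etac eta1t ykc rk.
set k : R := s.+1%:R in kR k0 m0 ykr *.
have f0 m : 0 < m`!%:R :> R by rewrite ltr0n fact_gt0.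
have Kk := @cliquesE R X g n0 s.+1; have Ks := @cliquesE R X g n0 s; have KS := @cliquesE R X g n0 s.+2.
rewrite -/n in Kk Ks KS.
have K0 : 0 < #|cliques g s.+1|%:R :> R.
  by rewrite Kk divr_gt0 // mulr_gt0 ?exprn_gt0 // (lt_le_trans c0).
have [] := @good_clique R X g g_sym g_irr n0 s (eta1 / c) (eps1 / c) K0.
- by rewrite divr_ge0 // ltW.
- by rewrite divr_ge0 // ltW.
(* Cauchy-Schwarz bounds the sum of squares [D] below by the numbers of cliques of orders [s] and
   [s.+1], and the near-extremal ratio compares these two numbers. *)
- set x := eta1 / c; set y := clique_density R g s.+1 in ykc Kk ykr *; set z := clique_density R g s in Ks ykr *.
  have {}ykr : k^-1 * z - eta1 <= y := ykr.
  set D : R := (\sum_(B in _) _)%N%:R; have x1 : x <= 1 by rewrite ler_pdivrMr // mul1r.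
  have x0 : 0 <= x by rewrite divr_ge0 // ltW.
  have csD : (k * #|cliques g s.+1|%:R) ^+ 2 <= #|cliques g s|%:R * D.
    rewrite /D /k -!(natrM, natrX) ler_nat -sum_card_ext //; exact: sum_nat_sqr_le.
  have zy : z <= k * y * (1 + x).
    have h1 : eta1 <= y * x.
      by rewrite (_ : eta1 = c * x); [apply: ler_wpM2r|rewrite /x mulrC divfK ?gt_eqF].
    have h2 : k * (k^-1 * z) <= k * (y + y * x).
      apply: ler_wpM2l; first exact: ltW.
      by apply: (@le_trans _ _ (y + eta1)); [rewrite -lerBlDr|rewrite lerD2l].
    by move: h2; rewrite mulrA divff ?mul1r ?gt_eqF // => /le_trans; apply; rewrite le_eqVlt; apply/orP; left; apply/eqP; ring.
  have nKs : n * #|cliques g s|%:R <= k ^+ 2 * #|cliques g s.+1|%:R * (1 + x).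
    rewrite Ks Kk factS natrM -/k (exprS n s).
    have -> : n * (z * n ^+ s / s`!%:R) = z * (n * n ^+ s / s`!%:R) by ring.
    have -> : k ^+ 2 * (y * (n * n ^+ s) / (k * s`!%:R)) * (1 + x) = k * y * (1 + x) * (n * n ^+ s / s`!%:R).
      have aux (a b u v w : R) : a != 0 -> b != 0 -> a ^+ 2 * (u * v / (a * b)) * w = a * u * w * (v / b).
        by move=> a0 b0; field; rewrite a0 b0.
      by apply: aux; rewrite gt_eqF.
    by apply: ler_wpM2r => //; rewrite divr_ge0 ?mulr_ge0 ?exprn_ge0 // ltW.
  set N := #|cliques g s.+1|%:R in K0 csD nKs *.
  have D0 : 0 <= D by apply: ler0n.
  have kN0 : 0 < k ^+ 2 * N by rewrite mulr_gt0 // exprn_gt0.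
  have hD : n * N <= D * (1 + x).
    rewrite -(ler_pM2l kN0).
    have e1 : n * (k * N) ^+ 2 <= n * (#|cliques g s|%:R * D) by apply: ler_wpM2l => //; apply: ltW.
    have e2 : n * #|cliques g s|%:R * D <= k ^+ 2 * N * (1 + x) * D by apply: ler_wpM2r.
    have -> : k ^+ 2 * N * (n * N) = n * (k * N) ^+ 2 by ring.
    have -> : k ^+ 2 * N * (D * (1 + x)) = k ^+ 2 * N * (1 + x) * D by ring.
    by apply: le_trans e2; rewrite -mulrA.
  have e3 : (1 - x) * (n * N) <= (1 - x) * (D * (1 + x)) by apply: ler_wpM2l => //; lra.
  have e4 : 0 <= D * (x * x) by apply: mulr_ge0 => //; apply: mulr_ge0.
  rewrite -/n -/N -mulrA; apply: le_trans e3 _.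
  by rewrite (_ : _ * (_ * _) = D - D * (x * x)); [rewrite lerBlDr lerDl|ring].
- rewrite -/n KS Kk; set y := clique_density R g s.+1 in ykc *.
  have -> : s.+2%:R * (clique_density R g s.+2 * n ^+ s.+2 / s.+2`!%:R) =
      clique_density R g s.+2 * (n * n ^+ s.+1 / s.+1`!%:R).
    rewrite (factS s.+1) natrM (exprS n s.+1).
    have aux (a b u v w : R) : a != 0 -> b != 0 -> a * (u * (v * w) / (a * b)) = u * (v * w / b).
      by move=> a0 b0; field; rewrite a0 b0.
    by apply: aux; rewrite gt_eqF ?f0 ?ltr0n.
  have -> : eps1 / c * n * (y * n ^+ s.+1 / s.+1`!%:R) = eps1 / c * y * (n * n ^+ s.+1 / s.+1`!%:R) by ring.
  apply: ler_wpM2r; first by rewrite divr_ge0 ?mulr_ge0 ?exprn_ge0 // ltW.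
  apply: le_trans yk2 _; rewrite mulrAC ler_pdivlMr //.
  by apply: ler_wpM2l => //; apply: ltW.
move=> A AK [hJ hU]; have cA : #|A| = s.+1 by move: AK; rewrite inE => /andP[/eqP].
have [P0 hP0] := @stable_partition X g s.+1 A isT cA.
have [P [cutP maxP]] := max_cut g_sym g_irr P0.
exists P.
rewrite -/n -/k in hJ hU; set d := eta1 / c + _ in hJ hU.
have c1 : c <= 1 / 2 by rewrite /c; lra.
(* Error budget: three contributions of at most [tau / 4], from [eta1], from the defect [eta1 / c]
   and from [eps1]. *)
have hd : eta1 + (2 * k + 1) * d <= tau.
  have k0' : 2 * k + 1 != 0 by rewrite gt_eqF //; lra.
  have h1 : eta1 <= tau / 4.
    apply: le_trans eta1t _; rewrite ler_pdivrMr //.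
    have t1 : tau * c <= tau * (1 / 2) by apply: ler_wpM2l => //; apply: ltW.
    have t2 : tau * 2 <= tau * k by apply: ler_wpM2l => //; apply: ltW.
    by lra.
  have h2 : (2 * k + 1) * (eta1 / c) <= tau / 4.
    rewrite mulrA ler_pdivrMr // mulrC -ler_pdivlMr; last by lra.
    by apply: le_trans eta1t _; rewrite -/k invfM le_eqVlt; apply/orP; left; apply/eqP; ring.
  have h3 : (2 * k + 1) * (2 * k * (eps1 / c)) = tau / 4.
    have aux (a b u v : R) : a != 0 -> b != 0 -> v != 0 -> b * (2 * a * (u * v / (8 * a * b) / v)) = u / 4.
      by move=> a0 b0 v0; field; rewrite a0 b0 v0.
    by apply: aux => //; rewrite gt_eqF.
  by rewrite /d -/k mulrDr h3; lra.
have hin : #|inside g P0|%:R <= (2 * k + 1) * d * n ^+ 2.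
  move: hP0; rewrite -(ler_nat R) natrD !natrM -/n => /le_trans; apply.
  have : 2 * n * #|uncovered g A|%:R <= 2 * n * (k * d * n) by apply: ler_wpM2l => //; lra.
  by move: hJ; lra.
have Y2 : turan_density R s.+1 2 = 1 - k^-1.
  by rewrite !turan_densityS /turan_density big_ord0 /turan_ratio mul0r subr0 !mulr1 div1r.
have hcut : (1 - k^-1 - tau) * n ^+ 2 <= #|cut g P|%:R.
  have hc : #|cut g P0|%:R <= #|cut g P|%:R :> R by rewrite ler_nat.
  have := card_inside_cut g_sym g_irr P0 => /(congr1 (fun m => m%:R : R)).
  have := @cliquesE R X g n0 2%N; rewrite -/n (_ : 2`! = 2)%N // natrD natrM => -> e.
  have h1 : (1 - k^-1 - eta1) * n ^+ 2 <= clique_density R g 2 * n ^+ 2.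
    by apply: ler_wpM2r; [rewrite exprn_ge0 // ltW|rewrite -Y2].
  have h2 : (eta1 + (2 * k + 1) * d) * n ^+ 2 <= tau * n ^+ 2.
    by apply: ler_wpM2r => //; rewrite exprn_ge0 // ltW.
  have {}e : #|cut g P0|%:R = clique_density R g 2 * n ^+ 2 - #|inside g P0|%:R by move: e; lra.
  have aux (a b t w h m i0 i1 j0 : R) : i0 <= i1 -> (1 - a - b) * m <= h * m ->
      (b + w) * m <= t * m -> j0 <= w * m -> i0 = h * m - j0 -> (1 - a - t) * m <= i1.
    lra.
  exact: aux hc h1 h2 hin e.
have cardI : #|[set: 'I_s.+1]| = s.+1 by rewrite cardsT card_ord.
have sumn : (\sum_i #|part P i|)%N%:R = n by rewrite sum_card_part.
have hsum : n ^+ 2 <= k * (\sum_i #|part P i| ^ 2)%N%:R.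
  have := sum_nat_sqr_le setT (fun i => #|part P i|); rewrite cardI -(ler_nat R) natrX natrM -/k.
  have bT (G : 'I_s.+1 -> nat) : (\sum_(i in setT) G i = \sum_i G i)%N by apply: eq_bigl => i; rewrite inE.
  by rewrite !bT sumn.
have hlight := card_cut_light g P.
have {}hlight : #|cut g P|%:R + #|light_cross g P|%:R + (\sum_i #|part P i| ^ 2)%N%:R = n ^+ 2 :> R.
  by rewrite -!natrD hlight natrX.
have {}hsum : k^-1 * n ^+ 2 <= (\sum_i #|part P i| ^ 2)%N%:R by rewrite ler_pdivrMl.
set S : R := (\sum_i #|part P i| ^ 2)%N%:R in hsum hlight.
have [hL hS] : #|light_cross g P|%:R <= tau * n ^+ 2 /\ S - k^-1 * n ^+ 2 <= tau * n ^+ 2.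
  have aux (a t m u v w : R) : (1 - a - t) * m <= u -> a * m <= w -> u + v + w = m -> 0 <= v ->
      v <= t * m /\ w - a * m <= t * m.
    by move=> *; split; lra.
  exact: aux hcut hsum hlight (ler0n _ _).
split=> //.
  by apply: le_trans hL _; apply: ler_wpM2r; [rewrite exprn_ge0 // ltW|rewrite ge_min lexx].
move=> i; rewrite -/k.
(* The excess of the sum of squares over its minimum is the sum of the squared deviations. *)
have hvar : \sum_(j < s.+1) (#|part P j|%:R - n / k) ^+ 2 = S - k^-1 * n ^+ 2.
  rewrite (eq_bigr (fun j => #|part P j|%:R ^+ 2 - 2 * (n / k) * #|part P j|%:R + (n / k) ^+ 2)); last by move=> j _; ring.
  rewrite big_split /= sumrB -mulr_sumr sumr_const card_ord -natr_sum sumn -(mulr_natl (_ ^+ 2) s.+1).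
  have -> : S = \sum_(j < s.+1) #|part P j|%:R ^+ 2.
    by rewrite /S natr_sum; apply: eq_bigr => j _; rewrite natrX.
  have aux (a b t : R) : b != 0 -> t - 2 * (a / b) * a + b * (a / b) ^+ 2 = t - b^-1 * a ^+ 2.
    by move=> b0; field.
  by apply: aux; rewrite gt_eqF.
have hi : (#|part P i|%:R - n / k) ^+ 2 <= tau * n ^+ 2.
  apply: (le_trans _ hS).
  rewrite -hvar (bigD1 i) //= lerDl; apply: sumr_ge0 => j _; exact: sqr_ge0.
have htau : tau <= 1 / (4 * k ^+ 2) by rewrite ge_min lexx orbT.
rewrite leNgt; apply/negP=> lt.
have aux2 (a b : R) : b != 0 -> a / b = a / (2 * b) + a / (2 * b) /\ (a / (2 * b)) ^+ 2 = 1 / (4 * b ^+ 2) * a ^+ 2.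
  by move=> b0; split; field.
have [nk h4] := aux2 n k (lt0r_neq0 k0).
have h0 : #|part P i|%:R < n / (2 * k) by rewrite ltr_pdivlMr ?mulr_gt0 // mulrC.
have h1 : n / (2 * k) < n / k - #|part P i|%:R.
  by rewrite ltrBrDr nk ltrD2l.
have q0 : 0 < n / (2 * k) by rewrite divr_gt0 // mulr_gt0.
have h2 : (n / (2 * k)) ^+ 2 < (n / k - #|part P i|%:R) ^+ 2.
  by rewrite ltr_pXn2r ?nnegrE // ltW // (lt_trans q0).
have h3 : tau * n ^+ 2 <= 1 / (4 * k ^+ 2) * n ^+ 2 by apply: ler_wpM2r => //; rewrite exprn_ge0 // ltW.
move: h2; rewrite -[X in _ < X]sqrrN opprB h4 => h2.
by have := le_lt_trans h3 h2; rewrite ltNge hi.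
Qed.

End Stability.

(** * Counting missing and noncrossing edges *)

Section Counting.
Variables (X I : finType) (r h d m gam : nat) (H : {set {set X}}) (P : X -> I).
Let g := heavy H h.
Let n := #|X|.
Let W := ~: generic P g d.

Lemma few_nongeneric : #|W| * d.+1 <= #|light_cross g P|.
Proof.
rewrite /light_cross (sum_card_pairs (fun x y => (P x != P y) && ~~ g x y)).
rewrite -sum_nat_const [X in _ <= X](bigID (mem W)) /=; apply: leq_trans (leq_addr _ _).
apply: leq_sum => w; rewrite !inE negb_forall => /existsP[i]; rewrite negb_imply -ltnNge.
move=> /andP[iw /leq_trans]; apply; apply/subset_leq_card/subsetP => z.
by rewrite !inE => /andP[/eqP -> ->]; rewrite eq_sym iw.
Qed.

Hypotheses (Hr : is_rgraph r H) (rI : 2 <= r <= #|I|).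
Hypothesis part_ge : forall i, m <= #|part P i|.
Hypothesis few_inside : forall w, #|neighbours_in g P w (P w)| <= gam.

Definition mono_at w := [set a in H | (w \in a) && [exists y in a, (w != y) && (P y == P w)]].

(** The edges are sorted by a second vertex [y] in the part of [w]. At most [gam] such [y] are
    heavy, each giving at most [n ^ (r - 2)] edges; every light [y] gives at most [h]. *)
Lemma card_mono_at w : #|mono_at w| <= gam * n ^ (r - 2) + n * h.
Proof.
pose S := [set y | (w != y) && (P y == P w)].
pose c y := [set a in H | (w \in a) && (y \in a)].
apply: (@leq_trans (\sum_(y in S) #|c y|)).
  apply: (@leq_trans #|\bigcup_(y in S) c y|).
    apply/subset_leq_card/subsetP => a; rewrite inE => /and3P[aH wa /exists_inP[y ya yS]].
    by apply/bigcupP; exists y; rewrite !inE // aH wa.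
  elim/big_rec2: _ => [|i m' U iJ IH]; first by rewrite cards0.
  by apply: leq_trans (leq_card_setU _ _) _; rewrite leq_add2l.
rewrite (bigID (fun y => g w y)) /=; apply: leq_add.
  apply: (@leq_trans (\sum_(y in neighbours_in g P w (P w)) n ^ (r - 2))); last first.
    by rewrite sum_nat_const leq_mul2r few_inside orbT.
  rewrite [X in X <= _](eq_bigl (fun y => y \in neighbours_in g P w (P w))); last first.
    by move=> y; rewrite !inE /g /heavy; case: (w != y); rewrite ?andbF.
  apply: leq_sum => y; rewrite inE => /andP[_ /andP[wy _]].
  apply: (@leq_trans #|[set e : {set X} | (#|e| == r) && ([set w; y] \subset e)]|).
    apply/subset_leq_card/subsetP => a; rewrite !inE => /and3P[aH wa ya].
    by rewrite Hr // eqxx subUset !sub1set wa.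
  by apply: leq_trans (card_rsets_containing _ _) _; rewrite cards2 wy.
apply: (@leq_trans (\sum_(y in S | ~~ g w y) h)).
  apply: leq_sum => y; rewrite inE /g /heavy => /andP[/andP[wy _]].
  by rewrite wy /= -leqNgt.
by rewrite sum_nat_const leq_mul2r max_card orbT.
Qed.

Definition missing := crossing P r :\: H.

(** A nongeneric [w] has more than [d] light neighbours in some other part. Each of these pairs lies
    in many crossing sets but in at most [h] edges of [H], and no crossing set is counted twice,
    since it meets that part only once. *)
Lemma card_missing_at w : w \in W -> d.+1 * (m ^ (r - 2) - h) <= #|[set e in missing | w \in e]|.
Proof.
rewrite !inE negb_forall => /existsP[i]; rewrite negb_imply -ltnNge => /andP[iw dlt].
pose c z := [set e in missing | (w \in e) && (z \in e)].
apply: (@leq_trans (\sum_(z in light_in P g w i) #|c z|)).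
  apply: (@leq_trans (\sum_(z in light_in P g w i) (m ^ (r - 2) - h))).
    by rewrite sum_nat_const leq_mul2r dlt orbT.
  apply: leq_sum => z; rewrite inE => /andP[/eqP Pz ngz].
  have wz : P w != P z by rewrite Pz eq_sym.
  have := card_crossing_pair part_ge rI wz.
  have cod : codegree H w z <= h.
    rewrite leqNgt; apply: contra ngz => lt; rewrite /g /heavy lt andbT.
    by apply: contraNneq wz => ->.
  rewrite leq_subLR => /leq_trans; apply; apply: leq_trans (leq_add cod (leqnn _)).
  apply: leq_trans (leq_card_setU _ _); apply/subset_leq_card/subsetP=> e.
  by rewrite !inE => /and3P[-> -> ->]; rewrite !andbT; case: (e \in H).
rewrite -[X in _ <= X]sum1_card.
under eq_bigr => z _ do rewrite -sum1_card.
rewrite (exchange_big_dep [pred e in [set e in missing | w \in e]]) /=; last first.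
  by move=> z e _; rewrite !inE => /and3P[-> -> _].
apply: leq_sum => e; rewrite inE => /andP[eM we]; rewrite sum1dep_card.
apply/card_le1_eqP => y z; rewrite !inE.
move=> /andP[/andP[/eqP Py _] /and3P[_ _ ye]] /andP[/andP[/eqP Pz _] /and3P[_ _ ze]].
have /setDP[eC _] := eM; apply: (crossing_inj eC) => //.
by rewrite Py Pz.
Qed.

Hypothesis generic_unique : forall b1 b2 x1 y1 x2 y2, b1 \in H -> b2 \in H ->
  x1 \in b1 -> y1 \in b1 -> x1 != y1 -> P x1 = P y1 -> x1 \in generic P g d -> y1 \in generic P g d ->
  x2 \in b2 -> y2 \in b2 -> x2 != y2 -> P x2 = P y2 -> x2 \in generic P g d -> y2 \in generic P g d ->
  b1 = b2.

(** With at most one exception, a noncrossing edge of [H] contains a nongeneric vertex sharing its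
    part with another vertex of the edge. A missing set contains at most [r] nongeneric vertices, so
    [arith] makes the missing sets at least as numerous as these edges. *)
Lemma card_le_crossing : r * (gam * n ^ (r - 2) + n * h) <= d.+1 * (m ^ (r - 2) - h) ->
  #|H| <= #|crossing P r| + 1.
Proof.
move=> arith; set beta := gam * _ + _ in arith; set mu := d.+1 * _ in arith.
have MW : #|W| * mu <= r * #|missing|.
  rewrite -sum_nat_const; apply: (@leq_trans (\sum_(w in W) #|[set e in missing | w \in e]|)).
    by apply: leq_sum => w; apply: card_missing_at.
  under eq_bigr => w _ do rewrite -sum1_card.
  rewrite (exchange_big_dep [pred e in missing]) /=; last by move=> w e _; rewrite inE => /andP[].
  rewrite mulnC -sum_nat_const; apply: leq_sum => e eM; rewrite sum1dep_card.
  have /setDP[+ _] := eM; rewrite inE => /andP[/eqP <- _].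
  by apply/subset_leq_card/subsetP => w; rewrite !inE => /andP[_ /andP[]].
have r0 : 0 < r by case/andP: rI => r2 _; apply: leq_trans r2.
have WB : #|W| * beta <= #|missing|.
  rewrite -(leq_pmul2l r0); apply: leq_trans MW.
  by rewrite mulnCA leq_mul2l arith orbT.
pose B := H :\: crossing P r.
pose B1 := [set b in H | [exists x in b, exists y in b, [&& x != y, P x == P y, x \in generic P g d & y \in generic P g d]]].
have cB1 : #|B1| <= 1.
  apply/card_le1_eqP => b1 b2; rewrite !inE.
  move=> /andP[b1H /exists_inP[x1 x1b /exists_inP[y1 y1b /and4P[xy1 /eqP Pxy1 gx1 gy1]]]].
  move=> /andP[b2H /exists_inP[x2 x2b /exists_inP[y2 y2b /and4P[xy2 /eqP Pxy2 gx2 gy2]]]].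
  exact: esym (generic_unique b1H b2H x1b y1b xy1 Pxy1 gx1 gy1 x2b y2b xy2 Pxy2 gx2 gy2).
have sB : B \subset B1 :|: \bigcup_(w in W) mono_at w.
  apply/subsetP=> b /setDP[bH bC]; rewrite in_setU.
  have : ~~ [forall x in b, forall y in b, (P x == P y) ==> (x == y)].
    apply: contra bC => /forall_inP inj; rewrite inE Hr // eqxx /= -(Hr bH).
    apply/imset_injP => x y xb yb /eqP Pxy; apply/eqP.
    by move/forall_inP: (inj x xb) => /(_ y yb) /implyP; apply.
  rewrite negb_forall_in => /exists_inP[x xb]; rewrite negb_forall_in => /exists_inP[y yb].
  rewrite negb_imply => /andP[/eqP Pxy xy].
  have [xG|xG] := boolP (x \in generic P g d); last first.
    apply/orP; right; apply/bigcupP; exists x; first by rewrite in_setC.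
    by rewrite inE bH xb; apply/exists_inP; exists y; rewrite // xy Pxy eqxx.
  have [yG|yG] := boolP (y \in generic P g d); last first.
    apply/orP; right; apply/bigcupP; exists y; first by rewrite in_setC.
    by rewrite inE bH yb; apply/exists_inP; exists x; rewrite // eq_sym xy Pxy eqxx.
  apply/orP; left; rewrite inE bH; apply/exists_inP; exists x => //.
  by apply/exists_inP; exists y; rewrite // xy Pxy eqxx xG.
have cB : #|B| <= 1 + #|missing|.
  apply: leq_trans (subset_leq_card sB) _; apply: leq_trans (leq_card_setU _ _) _.
  apply: leq_add cB1 _; apply: leq_trans WB.
  by apply: leq_card_bigcup => w _; apply: card_mono_at.
rewrite -(cardsID (crossing P r) H) -(cardsID H (crossing P r)) -/B -/missing.
by rewrite [crossing P r :&: H]setIC -addnA leq_add2l addnC.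
Qed.

End Counting.

Lemma cliques_le_tuples (X : finType) (g : rel X) q :
  #|cliques g q| <= #|[set s : q.-tuple X | pairwise g s]|.
Proof.
apply: leq_trans (leq_imset_card (fun s : q.-tuple X => [set x in s]) _).
apply/subset_leq_card/subsetP => A; rewrite inE => /andP[/eqP cA /cliqueP clA].
have sz : size (enum A) == q by rewrite -cardE cA.
apply/imsetP; exists (Tuple sz); last by apply/setP=> x; rewrite inE /= mem_enum.
rewrite inE /=; have all_mem : all (mem A) (enum A) by apply/allP=> x; rewrite mem_enum.
elim: (enum A) (enum_uniq A) all_mem => //= x s IH /andP[xs us] /andP[xA sA].
rewrite IH // andbT; apply/allP=> y ys; apply: clA => //; first exact: (allP sA).
by apply: contraNneq xs => ->.
Qed.

(** An edge of [H] that is not a clique contains a light pair, and each light pair lies in at most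
    [h] edges. *)
Lemma card_le_cliques (X : finType) (H : {set {set X}}) r h : is_rgraph r H ->
  #|H| <= #|cliques (heavy H h) r| + #|X| ^ 2 * h.
Proof.
move=> Hr; pose L := [set q : X * X | (q.1 != q.2) && ~~ heavy H h q.1 q.2].
pose c (q : X * X) := [set a in H | (q.1 \in a) && (q.2 \in a)].
have sub : H \subset cliques (heavy H h) r :|: \bigcup_(q in L) c q.
  apply/subsetP=> a aH; rewrite in_setU inE Hr // eqxx /=.
  have [//|] := boolP (clique _ a); rewrite negb_forall_in => /exists_inP[x xa].
  rewrite negb_forall_in => /exists_inP[y ya]; rewrite negb_imply => xy.
  by apply/bigcupP; exists (x, y); rewrite inE //= aH xa.
apply: leq_trans (subset_leq_card sub) _; apply: leq_trans (leq_card_setU _ _) _.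
rewrite leq_add2l; apply: leq_trans (leq_card_bigcup (m := h) _) _.
  by move=> [x y]; rewrite inE /heavy /= => /andP[-> /=]; rewrite -leqNgt.
by rewrite leq_mul2r -mulnn -card_prod max_card orbT.
Qed.

(** * Asymptotics *)

Section Asymptotics.
Local Open Scope ring_scope.

Lemma clique_density_small (k t : nat) (eps : rat) : 0 < eps -> exists N : nat,
  forall (X : finType) (g : rel X), (N <= #|X|)%N ->
  (forall Y : nat -> 'I_t -> X, (forall i, (i <= k)%N -> injective (Y i)) ->
     ~ (forall i j x y, (i < j)%N -> (j <= k)%N -> g (Y i x) (Y j y))) ->
  clique_density rat g k.+1 <= eps.
Proof.
move=> eps0; pose K := Num.bound ((k.+1)`!%:R / eps).
have hK : (k.+1)`!%:R / eps < K%:R by apply: archi_boundP; rewrite divr_ge0 ?ler0n // ltW.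
have [N HN] := dense_blown_up t k.+1 K; exists N.+1 => X g nN noY.
have n0 : 0 < #|X|%:R :> rat by rewrite ltr0n; apply: leq_trans nN.
rewrite leNgt; apply/negP; rewrite /clique_density ltr_pdivlMr ?exprn_gt0 // => lt.
have /card_gt0P[x0 _] : (0 < #|X|)%N by apply: leq_trans nN.
have dense : (#|X| ^ k.+1 <= K * #|[set s : k.+1.-tuple X | pairwise g s]|)%N.
  apply: (@leq_trans (K * #|cliques g k.+1|)); last by rewrite leq_mul2l cliques_le_tuples orbT.
  rewrite -(ler_nat rat) natrX natrM.
  apply: (@le_trans _ _ ((k.+1)`!%:R / eps * #|cliques g k.+1|%:R)); last first.
    by apply: ler_wpM2r; [apply: ler0n|apply: ltW].
  by rewrite mulrAC ler_pdivlMr // mulrC; apply: ltW.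
have [Y [injY gY]] := blown_up_family x0 (HN X _ (ltnW nN) dense).
apply: (noY Y) => // i j x y ij jk.
(* One choice function tests the pair of positions [i], [j]; its values elsewhere are immaterial. *)
pose c l := if l == i then x else y.
have /(pairwiseP x0) /(_ i j) := gY c; rewrite size_mkseq !inE !ltnS.
move=> /(_ (leq_trans (ltnW ij) jk) jk ij); rewrite !nth_mkseq ?ltnS // ?(leq_trans (ltnW ij)) //.
by rewrite /c eqxx; case: eqP ij => [->|]; rewrite ?ltnn.
Qed.

Lemma bernoulli_sub (R : realFieldType) (n k : R) r : 0 <= k <= n ->
  n ^+ r.+1 - r.+1%:R * k * n ^+ r <= (n - k) ^+ r.+1.
Proof.
move=> /andP[k0 kn]; elim: r => [|r IH]; first by rewrite expr0 !expr1 mul1r mulr1.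
have n0 : 0 <= n by apply: le_trans kn.
have nk : 0 <= n - k by rewrite subr_ge0.
rewrite [(n - k) ^+ _]exprS; apply: le_trans (ler_wpM2l nk IH).
have -> : (n - k) * (n ^+ r.+1 - r.+1%:R * k * n ^+ r) =
  n ^+ r.+2 - r.+2%:R * k * n ^+ r.+1 + r.+1%:R * k ^+ 2 * n ^+ r.
  by rewrite -[r.+2%:R]natr1 !exprS; ring.
by rewrite lerDl !mulr_ge0 ?exprn_ge0 ?ler0n.
Qed.

Lemma turan_densityE (R : realFieldType) k s : (0 < k)%N -> (s <= k)%N ->
  turan_density R k s * k%:R ^+ s = (k ^_ s)%:R.
Proof.
move=> k0; elim: s => [|s IH] sk; first by rewrite /turan_density big_ord0 mul1r ffactn0.
rewrite turan_densityS ffactnSr natrM -IH ?(ltnW sk) // exprS /turan_ratio natrB ?(ltnW sk) //.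
by field; rewrite pnatr_eq0 -lt0n.
Qed.

(** The main term tends to the Turan density. The constant [c] collects the two errors of order
    [n ^ (r - 1)], from rounding [n / k] and from the edges of [H] that are not cliques. *)
Lemma clique_density_large (k r s : nat) (eps : rat) : (4 <= r)%N -> (r <= k)%N -> 0 < eps ->
  exists N : nat, forall (X : finType) (g : rel X), (N <= #|X|)%N ->
  ('C(k, r) * (#|X| %/ k) ^ r <= #|cliques g r| + #|X| ^ 2 * (s * #|X| ^ (r - 3) + s))%N ->
  turan_density rat k r - eps <= clique_density rat g r.
Proof.
move=> r4 rk eps0; pose c : rat := r%:R * k%:R + r`!%:R * 2 * s%:R.
have c0 : 0 <= c by rewrite addr_ge0 ?mulr_ge0 ?ler0n.
exists (maxn k (Num.bound (c / eps))).+1 => X g; rewrite gtn_max => /andP[nk nc] le.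
set n : rat := #|X|%:R.
have k0 : (0 < k)%N by apply: leq_trans rk; apply: leq_trans r4.
have n0 : 0 < n by rewrite ltr0n; apply: leq_trans nk.
have cn : c <= eps * n.
  rewrite mulrC -ler_pdivrMr //; apply: ltW; apply: lt_trans (archi_boundP _) _.
    by rewrite divr_ge0 // ltW.
  by rewrite ltr_nat.
have kR : 0 < k%:R :> rat by rewrite ltr0n.
set Y := turan_density rat k r.
have /andP[Y0 Y1] : 0 < Y <= 1 by apply: (turan_density_bounds rat (ltnW (ltnW r4)) rk rk).
case: r r4 rk le @c c0 nc cn @Y Y0 Y1 => // r r4 rk le c c0 nc cn Y Y0 Y1.
set T := n ^+ r; have T0 : 0 < T by rewrite exprn_gt0.
rewrite /clique_density -/n ler_pdivlMr ?exprn_gt0 // exprS -/T.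
set f : rat := r.+1`!%:R; have f0 : 0 < f by rewrite ltr0n fact_gt0.
set q : rat := (#|X| %/ k)%:R.
have q0 : 0 <= q by apply: ler0n.
have qk : n - k%:R <= k%:R * q.
  rewrite lerBlDr -natrM -natrD ler_nat mulnC; have := divn_eq #|X| k.
  by have := ltn_pmod #|X| k0; move: (_ %/ _)%N (_ %% _)%N => a b; clear; lia.
have h1 : n * T - r.+1%:R * k%:R * T <= k%:R ^+ r.+1 * q ^+ r.+1.
  have kn : (0 : rat) <= k%:R <= n by rewrite ler0n ler_nat ltnW.
  apply: (@le_trans _ _ ((n - k%:R) ^+ r.+1)); first by rewrite /T -exprS; apply: bernoulli_sub.
  by rewrite -exprMn lerXn2r ?nnegrE ?mulr_ge0 ?ler0n // subr_ge0 ler_nat ltnW.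
have Yb : Y * k%:R ^+ r.+1 = f * 'C(k, r.+1)%:R.
  by rewrite /Y turan_densityE // -bin_ffact natrM mulrC.
have h2 : n ^+ 2 * (s%:R * n ^+ (r.+1 - 3) + s%:R) <= 2 * s%:R * T.
  have e2 : n ^+ 2 * n ^+ (r.+1 - 3) = T by rewrite -exprD /T; congr (_ ^+ _); move: r4; clear; lia.
  have e1 : 1 <= n ^+ (r.+1 - 3) by rewrite exprn_ege1 // ler1n; apply: leq_trans nk.
  have : n ^+ 2 * s%:R * 1 <= n ^+ 2 * s%:R * n ^+ (r.+1 - 3).
    by apply: ler_wpM2l => //; rewrite mulr_ge0 ?exprn_ge0 ?ler0n // ltW.
  by rewrite -e2; lra.
have {}le : 'C(k, r.+1)%:R * q ^+ r.+1 <= #|cliques g r.+1|%:R + n ^+ 2 * (s%:R * n ^+ (r.+1 - 3) + s%:R).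
  by rewrite -!(natrX, natrM, natrD) ler_nat.
have h3 : f * ('C(k, r.+1)%:R * q ^+ r.+1) <= f * (#|cliques g r.+1|%:R + 2 * s%:R * T).
  by apply: ler_wpM2l; [apply: ltW|apply: le_trans le _; rewrite lerD2l].
have h4 : Y * (n * T - r.+1%:R * k%:R * T) <= Y * (k%:R ^+ r.+1 * q ^+ r.+1).
  by apply: ler_wpM2l => //; apply: ltW.
have h5 : Y * (r.+1%:R * k%:R * T) <= r.+1%:R * k%:R * T.
  by apply: ler_piMl => //; rewrite !mulr_ge0 ?ler0n // ltW.
have h6 : c * T <= eps * n * T by apply: ler_wpM2r => //; apply: ltW.
have e7 : Y * (k%:R ^+ r.+1 * q ^+ r.+1) = f * ('C(k, r.+1)%:R * q ^+ r.+1) by rewrite !mulrA Yb.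
have aux (A fN Z YY f' w : rat) : A <= f' * (fN + 2 * w * T) -> YY * (n * T - Z * T) <= A ->
    YY * (Z * T) <= Z * T -> (Z + f' * 2 * w) * T <= eps * n * T -> (YY - eps) * (n * T) <= f' * fN.
  by move=> *; lra.
by apply: aux h3 _ h5 h6; rewrite -e7.
Qed.

End Asymptotics.

(** * Colour representatives and the choice of constants *)

Lemma rainbow_representatives (T C : finType) (S : {set T}) (col : T -> C) :
  exists H : {set T}, [/\ H \subset S, {in H &, injective col} & #|H| = #|col @: S|].
Proof.
pose rep a := [pick b in S | col b == col a].
have rep_eq a b : col a = col b -> rep a = rep b.
  by move=> eq; apply: eq_pick => c; rewrite /= eq.
pose H := [set a in S | rep a == Some a].
have inj : {in H &, injective col}.
  move=> a b; rewrite !inE => /andP[_ /eqP ra] /andP[_ /eqP rb] /rep_eq.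
  by rewrite ra rb => -[].
exists H; split=> //; first by apply/subsetP=> a; rewrite inE => /andP[].
rewrite -(card_in_imset inj); congr #|pred_of_set _|; apply/setP=> c.
apply/imsetP/imsetP => -[a]; first by rewrite inE => /andP[aS _] ->; exists a.
move=> aS ->; have : rep a = rep a by [].
rewrite {2}/rep; case: pickP => [b /andP[bS /eqP ba] ra|/(_ a)]; last by rewrite aS eqxx.
by exists b; rewrite // inE bS (rep_eq _ _ ba) ra eqxx.
Qed.

Section FinalArithmetic.
Local Open Scope ring_scope.

Lemma few_nongeneric_ratio (W d D L n : nat) (eta : rat) : (0 < D)%N -> (0 < n)%N ->
  d = (n %/ D)%N -> (W * d.+1 <= L)%N -> L%:R <= eta * n%:R ^+ 2 -> W%:R <= eta * D%:R * n%:R.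
Proof.
move=> D0 n0 -> WL Ln.
have nR : 0 < n%:R :> rat by rewrite ltr0n.
have h : (n <= D * (n %/ D).+1)%N by rewrite mulnC ltnW // ltn_ceil.
have : (W * n <= D * L)%N.
  by apply: (@leq_trans (W * (D * (n %/ D).+1))); rewrite ?leq_mul2l ?h ?orbT // mulnCA leq_mul2l WL orbT.
rewrite -(ler_nat rat) !natrM => h1.
rewrite -(ler_pM2r nR); apply: le_trans h1 _.
have -> : eta * D%:R * n%:R * n%:R = D%:R * (eta * n%:R ^+ 2) by ring.
by apply: ler_wpM2l.
Qed.

Lemma generic_part_arith (k v r n W p d : nat) (eta : rat) : (0 < k)%N ->
  d = (n %/ (8 * k * (v + 4)))%N -> (4 * k * (v + 4 + 10 * r) < n)%N ->
  n%:R <= 2 * k%:R * p%:R :> rat -> 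
  eta * (8 * k * (v + 4))%N%:R <= 1 / (8 * k%:R) -> W%:R <= eta * (8 * k * (v + 4))%N%:R * n%:R ->
  ((v + 4) * d.+1 + 10 * r < p - W)%N.
Proof.
move=> k0 dE nbig np etaD Wn; rewrite ltn_subRL -(ltr_nat rat).
have kR : 0 < k%:R :> rat by rewrite ltr0n.
have nR : 0 <= n%:R :> rat by apply: ler0n.
have h1 : W%:R <= n%:R / (8 * k%:R) :> rat.
  apply: le_trans Wn _; apply: le_trans (ler_wpM2r nR etaD) _.
  by rewrite mulrAC mul1r.
have h2 : (8 * k * ((v + 4) * d) <= n)%N.
  by rewrite dE mulnA -mulnA mulnA mulnC leq_divM.
have {}h2 : ((v + 4) * d)%N%:R <= n%:R / (8 * k%:R) :> rat.
  by rewrite ler_pdivlMr ?mulr_gt0 // mulrC -!natrM ler_nat.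
have h3 : (v + 4 + 10 * r)%N%:R < n%:R / (4 * k%:R) :> rat.
  by rewrite ltr_pdivlMr ?mulr_gt0 // mulrC -!natrM ltr_nat.
have h4 : n%:R / (2 * k%:R) <= p%:R :> rat by rewrite ler_pdivrMr ?mulr_gt0 // mulrC.
have aux (b x : rat) : b != 0 -> x / (2 * b) = 4 * (x / (8 * b)) /\ x / (4 * b) = 2 * (x / (8 * b)).
  by move=> b0; split; field.
have [e1 e2] := aux k%:R n%:R (lt0r_neq0 kR); rewrite e1 in h4; rewrite e2 in h3.
rewrite (_ : W + _ = W + (v + 4) * d + (v + 4 + 10 * r))%N; last by clear; lia.
by rewrite 2!natrD; move: h1 h2 h3 h4; clear; lra.
Qed.

(** The main term on the right is [4 * u] times [n ^ (r - 2)]. The two linear terms of [gam] take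
    [u] each, and all lower-order terms together take the remaining [2 * u]. [Q] reflects
    [n %/ (2 * k) >= n / (4 * k)]. *)
Lemma counting_arith (k v r s n gam W : nat) (eta : rat) : (0 < k)%N -> (3 <= r)%N ->
  let D1 := (8 * k * (v + 4))%N in let Q := ((4 * k) ^ (r - 2))%N in
  let D2 := (4 * D1 * r * v * Q).+1 in let h := (s * n ^ (r - 3) + s)%N in
  W%:R <= eta * D2%:R * n%:R -> eta * (4 * D1 * r * Q * D2)%N%:R <= 1 ->
  gam = (v * (n %/ D2).+1 + W)%N ->
  (4 * k < n)%N -> (2 * D1 * Q * (r * v + 2 * r * s + 2 * s) < n)%N ->
  (r * (gam * n ^ (r - 2) + n * h) <= (n %/ D1).+1 * ((n %/ (2 * k)) ^ (r - 2) - h))%N.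
Proof.
move=> k0 r3 D1 Q D2 h hW heta -> nk nbig.
have D10 : (0 < D1)%N by rewrite /D1 !muln_gt0 k0 addn_gt0 orbT.
have Q0 : (0 < Q)%N by rewrite expn_gt0 muln_gt0 k0.
have n0 : (0 < n)%N by apply: leq_trans nk.
set x : rat := n%:R; have x0 : 0 < x by rewrite ltr0n.
set T : rat := x ^+ (r - 3); have T1 : 1 <= T by rewrite exprn_ege1 // ler1n.
have xT : x ^+ (r - 2) = x * T by rewrite /T -exprS; congr (_ ^+ _); move: r3; clear; lia.
have r0 : 0 < r%:R :> rat by rewrite ltr0n; move: r3; clear; lia.
have D1R : 0 < D1%:R :> rat by rewrite ltr0n.
have D2R : 0 < D2%:R :> rat by rewrite ltr0n.
have QR : 0 < Q%:R :> rat by rewrite ltr0n.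
have vR : 0 <= v%:R :> rat by apply: ler0n.
have sR : 0 <= s%:R :> rat by apply: ler0n.
have hh : h%:R <= 2 * s%:R * T.
  rewrite /h natrD natrM natrX -/x -/T; have : s%:R * 1 <= s%:R * T by apply: ler_wpM2l.
  by clear; lra.
set G := (v * (n %/ D2).+1 + W)%N; set M := (n %/ (2 * k))%N.
have gE : G%:R <= v%:R * (x / D2%:R) + v%:R + eta * D2%:R * x.
  rewrite natrD natrM; apply: lerD => //; rewrite -natr1 mulrDr mulr1 lerD2r.
  by apply: ler_wpM2l => //; rewrite ler_pdivlMr // -natrM ler_nat leq_divM.
pose u := x / (4 * (D1%:R * Q%:R)).
have DQ0 : 0 < 4 * (D1%:R * Q%:R) :> rat by rewrite !mulr_gt0.
have a1 : r%:R * (v%:R * (x / D2%:R)) <= u.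
  have e1 : r%:R * v%:R * (4 * (D1%:R * Q%:R)) <= D2%:R :> rat.
    have aux (a b c d : nat) : (a * b * (4 * (c * d)) = 4 * c * a * b * d)%N.
      by move: a b c d; clear => a b c d; lia.
    by rewrite -!natrM ler_nat /D2 aux.
  rewrite /u ler_pdivlMr // (_ : r%:R * (v%:R * (x / D2%:R)) * _ = r%:R * v%:R * (4 * (D1%:R * Q%:R)) * x / D2%:R); last by ring.
  by rewrite ler_pdivrMr // [x * _]mulrC; apply: ler_wpM2r => //; apply: ltW.
have a2 : r%:R * (eta * D2%:R * x) <= u.
  rewrite /u ler_pdivlMr // (_ : r%:R * (eta * D2%:R * x) * _ = eta * (4 * D1 * r * Q * D2)%N%:R * x).
    by apply: ler_piMl => //; apply: ltW.
  by rewrite !natrM; ring.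
have a3 : r%:R * G%:R <= 2 * u + r%:R * v%:R.
  by apply: le_trans (ler_wpM2l (ltW r0) gE) _; move: a1 a2; clear; lra.
have b1 : x * T <= Q%:R * (M ^ (r - 2))%N%:R.
  rewrite -xT /x /Q -natrM -natrX -expnMn ler_nat leq_exp2r ?subn_gt0 //.
  have := divn_eq n (2 * k); have := ltn_pmod n (_ : 0 < 2 * k)%N.
  rewrite muln_gt0 k0 => /(_ isT); rewrite -/M; move: (n %% _)%N => z; move: nk; clear.
  by move=> h1 h2 ->; nia.
have b2 : x / D1%:R <= (n %/ D1).+1%:R.
  by rewrite ler_pdivrMr // -natrM ler_nat ltnW // ltn_ceil.
have b3 : x * T / Q%:R - 2 * s%:R * T <= (M ^ (r - 2) - h)%N%:R.
  apply: (@le_trans _ _ ((M ^ (r - 2))%N%:R - h%:R)).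
    by apply: lerB => //; rewrite ler_pdivrMr // (mulrC _ Q%:R).
  by rewrite lerBlDr -natrD ler_nat; clear; lia.
rewrite -(ler_nat rat) !natrM natrD !natrM [(n ^ _)%N%:R]natrX -/x xT.
have xD0 : 0 <= x / D1%:R by rewrite divr_ge0 // ltW.
apply: (@le_trans _ _ (x / D1%:R * (x * T / Q%:R - 2 * s%:R * T))); last first.
  apply: (@le_trans _ _ (x / D1%:R * (M ^ (r - 2) - h)%N%:R)); first exact: ler_wpM2l.
  by apply: ler_wpM2r.
have xT0 : 0 <= x * T by rewrite mulr_ge0 //; lra.
have c1 : r%:R * G%:R * (x * T) <= (2 * u + r%:R * v%:R) * (x * T) by apply: ler_wpM2r.
have c2 : r%:R * x * h%:R <= r%:R * x * (2 * s%:R * T).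
  by apply: ler_wpM2l => //; rewrite mulr_ge0 // ltW.
have c3 : x / D1%:R * (x * T / Q%:R - 2 * s%:R * T) = (4 * u - 2 * s%:R / D1%:R) * (x * T).
  have aux (a b y t w : rat) : a != 0 -> b != 0 ->
    y / a * (y * t / b - 2 * w * t) = (4 * (y / (4 * (a * b))) - 2 * w / a) * (y * t).
    by move=> a0 b0; field; rewrite a0 b0.
  by apply: aux; apply: lt0r_neq0.
have c4 : 2 * s%:R / D1%:R <= 2 * s%:R :> rat.
  by rewrite ler_pdivrMr // ler_peMr ?mulr_ge0 // ler1n.
have c5 : r%:R * v%:R + 2 * r%:R * s%:R + 2 * s%:R <= 2 * u.
  rewrite /u (_ : 2 * (x / (4 * (D1%:R * Q%:R))) = x / (2 * D1%:R * Q%:R)).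
    rewrite ler_pdivlMr ?mulr_gt0 // mulrC -!natrM -!natrD -natrM ler_nat; exact: ltnW.
  have aux (a b y : rat) : a != 0 -> b != 0 -> 2 * (y / (4 * (a * b))) = y / (2 * a * b).
    by move=> a0 b0; field; rewrite a0 b0.
  by apply: aux; apply: lt0r_neq0.
rewrite c3; apply: (@le_trans _ _ ((2 * u + r%:R * v%:R + 2 * r%:R * s%:R) * (x * T))).
  by move: c1 c2; clear; lra.
by apply: ler_wpM2r => //; move: c4 c5; clear; lra.
Qed.

Lemma inv_mul_le (E a b : nat) : (0 < E)%N -> (0 < b)%N -> (a * b <= E)%N ->
  1 / E%:R * a%:R <= 1 / b%:R :> rat.
Proof.
move=> E0 b0 abE; rewrite !div1r mulrC ler_pdivrMr ?ltr0n // mulrC ler_pdivlMr ?ltr0n //.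
by rewrite -natrM ler_nat.
Qed.

End FinalArithmetic.

(** * The upper bound *)

Section UpperBound.
Variables (r k : nat) (V : finType) (F : {set {set V}}) (e1 e2 : {set V}) (f : V -> 'I_k).
Hypotheses (r4 : 4 <= r) (rk : r <= k) (F2 : is_rgraph 2 F).
Hypotheses (e1F : e1 \in F) (e2F : e2 \in F) (e12 : e1 != e2).
Hypothesis proper_f : forall u v, [set u; v] \in F -> [set u; v] != e1 ->
  [set u; v] != e2 -> u != v -> f u != f v.
Hypothesis mono1 : {in e1 &, forall u v, f u = f v}.
Hypothesis mono2 : {in e2 &, forall u v, f u = f v}.

Lemma eventually_forces_rainbow : exists N, forall n, N <= n ->
  forces_rainbow n r (expansion r F) (#|turan_rgraph k.+1 n r| + 2).
Proof.
have k0 : 0 < k by apply: leq_trans rk; apply: leq_trans r4.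
have r2 : 2 <= r by apply: leq_trans r4.
have r3 : 3 <= r by apply: leq_trans r4.
pose v := #|V|; pose s := #|V| + r * #|F|.
(* [D1] makes [(v + 4) * (n %/ D1)] at most [n / (8 * k)], while every part will have at least
   [n / (2 * k)] vertices. *)
pose D1 := 8 * k * (v + 4); pose Q := (4 * k) ^ (r - 2).
pose D2 := (4 * D1 * r * v * Q).+1.
pose eta : rat := (1 / (8 * k * D1 + 4 * D1 * r * Q * D2)%N%:R)%R.
have D10 : 0 < D1 by rewrite /D1 !muln_gt0 k0 addn_gt0 orbT.
have E0 : 0 < 8 * k * D1 + 4 * D1 * r * Q * D2.
  by rewrite ltn_addr // muln_gt0 D10 muln_gt0 k0.
have eta0 : (0 < eta)%R by rewrite divr_gt0 // ltr0n.
have eta1 : (eta * D1%:R <= 1 / (8 * k%:R))%R.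
  by rewrite -natrM; apply: inv_mul_le; rewrite ?muln_gt0 // mulnC leq_addr.
have eta2 : (eta * (4 * D1 * r * Q * D2)%N%:R <= 1)%R.
  by rewrite -[1%R]divr1; apply: (@inv_mul_le _ _ 1); rewrite // muln1 leq_addl.
have [eps eps0 stab] := @graph_stability rat k r eta (introT andP (conj r2 rk)) eta0.
have [N1 HN1] := clique_density_small k v eps0.
have [N2 HN2] := clique_density_large s r4 rk eps0.
pose N3 := v + r + 4 * k + 4 * k * (v + 4 + 10 * r) + 2 * D1 * Q * (r * v + 2 * r * s + 2 * s).
exists (N1 + N2 + N3).+1 => n nbig C col hc.
have [n1 n2 n3] : [/\ N1 <= n, N2 <= n & N3 < n] by move: nbig; clear; split; lia.
have [nvr n4k nA nB] : [/\ v + r <= n, 4 * k < n, 4 * k * (v + 4 + 10 * r) < n &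
    2 * D1 * Q * (r * v + 2 * r * s + 2 * s) < n].
  move: n3; rewrite /N3; clear; move: (4 * k * (v + 4 + 10 * r)) (2 * D1 * Q * _) => a b.
  by split; lia.
have n0 : 0 < n by apply: leq_trans n4k.
apply: boolp.contrapT => no_rainbow.
have [H [sH colH cH]] := rainbow_representatives (complete_rgraph n r) col.
rewrite -cH in hc.
have Hr : is_rgraph r H by move=> e /(subsetP sH); rewrite inE => /eqP.
pose h := s * n ^ (r - 3) + s; pose g := heavy H h.
have g_sym : symmetric g by apply: heavyC.
have g_irr : irreflexive g by apply: heavyxx.
have cX : #|'I_n| = n := card_ord n.
have small : (clique_density rat g k.+1 <= eps)%R.
  apply: HN1; first by rewrite cX.
  move=> Y injY; exact: (no_blowup r4 F2 Hr colH no_rainbow e1F e2F proper_f nvr injY).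
have large : (turan_density rat k r - eps <= clique_density rat g r)%R.
  apply: HN2; first by rewrite cX.
  rewrite cX; apply: leq_trans (turan_ge n k0 r) _.
  have := card_le_cliques h Hr; rewrite cX => /(leq_trans _); apply.
  by apply: leq_trans hc; apply: leq_addr.
have cX0 : 0 < #|'I_n| by rewrite cX.
have [P [maxP lightP partP]] := stab _ _ g_sym g_irr cX0 small large.
rewrite cX in lightP.
(* Two notions of generic vertex: [d1] serves the linking argument and the count of missing sets,
   while the finer [d2] serves the apex bound, which must be small compared with [d1]. *)
pose d1 := n %/ D1; pose d2 := n %/ D2.
have fewW d : #|~: generic P g d| * d.+1 <= #|light_cross g P| by apply: few_nongeneric.
have W1 := few_nongeneric_ratio D10 n0 (erefl d1) (fewW d1) lightP.
have W2 := few_nongeneric_ratio (ltn0Sn _) n0 (erefl d2) (fewW d2) lightP.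
have part_gen i d : #|part P i| - #|~: generic P g d| <= #|part P i :&: generic P g d|.
  by apply: leq_trans (card_setD_ge _ _) _; rewrite setDE setCK.
have big i : (#|V| + 4) * d1.+1 + 10 * r < #|part P i :&: generic P g d1|.
  apply: leq_trans (part_gen i d1).
  have := partP i; rewrite cX => partPi.
  exact: (generic_part_arith k0 (erefl d1) nA partPi eta1 W1).
pose gam := v * d2.+1 + #|~: generic P g d2|.
(* By the maximum cut property, [w] has no more heavy neighbours in its own part than in the part
   [i] where the apex bound holds. *)
have few_inside w : #|neighbours_in g P w (P w)| <= gam.
  have [i apex] := no_apex r4 F2 Hr colH no_rainbow e1F e2F proper_f P d2 w nvr.
  apply: leq_trans (maxP w i) _; apply: leq_trans (leq_add apex (leqnn _)).
  apply: leq_trans (leq_card_setU _ _); apply/subset_leq_card/subsetP => z.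
  rewrite inE => /andP[Pz gwz]; rewrite in_setU in_setC.
  case: (boolP (z \in generic P g d2)) => [zG|_]; last by rewrite orbT.
  by rewrite orbF; apply/setIdP; split=> //; apply/setIP; split; rewrite // in_set.
have arith := counting_arith k0 r3 W2 eta2 (erefl gam) n4k nB.
have part_ge i : n %/ (2 * k) <= #|part P i|.
  have := partP i; rewrite cX -natrM -natrM ler_nat => le.
  by have := leq_div2r (2 * k) le; rewrite mulKn // muln_gt0.
have : #|H| <= #|crossing P r| + 1.
  apply: (card_le_crossing (h := h) (d := d1) (m := n %/ (2 * k)) (gam := gam)) => //.
  - by rewrite card_ord r2.
  - move=> b1 b2 x1 y1 x2 y2 b1H b2H x1b y1b xy1 Pxy1 gx1 gy1 x2b y2b xy2 Pxy2 gx2 gy2.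
    apply: (colH _ _ b1H b2H).
    apply: (same_color_carriers r4 rk F2 Hr colH no_rainbow e1F e2F e12 proper_f mono1 mono2 big
      (i := P x1) (j := P x2) (x1 := x1) (y1 := y1) (x2 := x2) (y2 := y2)).
    + by split=> //; rewrite Hr.
    + by split=> //; rewrite Hr.
  - by rewrite cX.
apply/negP; rewrite -ltnNge; apply: leq_trans hc; rewrite -addnS leq_add2r.
exact: crossing_le_turan.
Qed.

End UpperBound.

(** * Combination of the two bounds *)

Theorem theorem1p3 (r p l : nat) (V : finType) (F : {set {set V}})
    (hr : 4 <= r) (hp : r < p) (hl : 2 <= l <= p)
    (hF : is_rgraph 2 F)
    (hcrit : doubly_edge_critical p F)
    (hclass : in_class p l F) :
  exists N : nat, forall n : nat, N <= n ->
    ar n r (expansion r F) = #|turan_rgraph p n r| + 2.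
Proof.
have [crit [e1 [e2 [e1F e2F e12 chi]]]] := hcrit.
have p0 : 0 < p by apply: leq_trans hp.
have {}crit e : e \in F -> ~~ colorable (F :\ e) p.-1.
  by move=> eF; apply: not_colorable_sub1 => //; apply: crit.
have F0 : F != set0 by apply/set0Pn; exists e1.
have := colorable_chromatic (F :\ e1 :\ e2); rewrite chi => /existsP[f /forallP fP].
have proper_f u v : [set u; v] \in F -> [set u; v] != e1 -> [set u; v] != e2 -> u != v -> f u != f v.
  move=> uvF ne1 ne2 uv; move/forallP: (fP u) => /(_ v) /implyP; apply.
  by rewrite uv !inE ne1 ne2.
(* If [f] separated the endpoints of [e'], it would properly colour [F :\ e] with [p.-1] colours,
   contrary to criticality. *)
have mono e e' : e \in F -> e' \in F -> (forall d, d \in F -> d != e -> d != e' -> d \in F :\ e1 :\ e2) ->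
    {in e' &, forall u v, f u = f v}.
  move=> eF e'F sub u v ue ve; apply/eqP; apply: contraT => fuv.
  case/negP: (crit e eF); apply/existsP; exists f.
  apply/forallP=> x; apply/forallP=> y; apply/implyP=> /andP[xy].
  rewrite in_setD1 => /andP[xye xyF]; have [xye'|xye'] := eqVneq [set x; y] e'.
    move: ue ve; rewrite -xye' => /set2P[] eu /set2P[] ev; move: fuv; rewrite eu ev ?eqxx //.
    by rewrite eq_sym.
  by move/forallP: (fP x) => /(_ y) /implyP; apply; rewrite xy sub.
have mono1 : {in e1 &, forall u v, f u = f v}.
  by apply: (mono e2) => // d dF d2 d1; rewrite !inE d1 d2.
have mono2 : {in e2 &, forall u v, f u = f v}.
  by apply: (mono e1) => // d dF d1 d2; rewrite !inE d1 d2.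
have rk : r <= p.-1 by rewrite -ltnS prednK.
have [N upper] := eventually_forces_rainbow hr rk hF e1F e2F e12 proper_f mono1 mono2.
exists (N + p + r) => n nbig; apply/eqP; rewrite eqn_leq; apply/andP; split; last first.
  by apply: ar_lower => //; move: hr hp nbig; clear; lia.
rewrite /ar; case: ex_minnP => m _; apply; apply/boolp.asboolP.
have := upper n; rewrite prednK //; apply.
by move: nbig; clear; lia.
Qed.
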